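(* Fix $n\in\mathbb N$ and let $\sigma_n:[0,1]\to\mathbb R$ be a strictly increasing function, twice differentiable on $(0,1)$ with $\sigma_n'>0$ there, satisfying for every $r\in(0,\infty)$ $$1+\frac{\sigma_n''(\Psi_n(r))\, \Psi_n(r)}{\sigma_n'(\Psi_n(r))} = \frac{2}{n} - \frac{c_n}{n^2\,\Psi_n(r)}\, r^n e^{-r^2/2},$$ where $c_n^{-1} = 2^{\frac{n}{2}-1}\Gamma(n/2)$. Then for every origin-symmetric convex sets $K,L\subseteq\mathbb R^n$ and every $\lambda\in(0,1)$, $$\sigma_n\big(\gamma_n\big(\lambda K+(1-\lambda)L\big)\big) \geq \lambda\, \sigma_n(\gamma_n(K))+(1-\lambda)\,\sigma_n(\gamma_n(L)).$$
   Context: $\gamma_n$ is the standard Gaussian measure on $\mathbb R^n$ with density $(2\pi)^{-n/2}e^{-|x|^2/2}$. $\Psi_n(r)=\gamma_n(rB_2^n)$, where $rB_2^n=\{x\in\mathbb R^n: |x|\le r\}$. A set $K$ is symmetric if $K=-K$; $\lambda K+(1-\lambda)L=\{\lambda a+(1-\lambda)b: a\in K, b\in L\}$. *)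

(* Defs.v *)
From HB Require Import structures.
From mathcomp Require Import all_boot all_order all_algebra.
From mathcomp Require Import all_classical all_reals all_analysis.
Set Implicit Arguments. Unset Strict Implicit. Unset Printing Implicit Defensive.
Import Order.TTheory GRing.Theory Num.Theory.
Import numFieldNormedType.Exports.
Local Open Scope classical_set_scope.
Local Open Scope ring_scope.

Section Defs.
Context {R : realType}.

(* Lebesgue integral over R^n = 'rV[R]_n, as the iterated one-dimensional
   Lebesgue integral (Fubini/Tonelli); integrands are nonnegative here. *)
Fixpoint leb_int (n : nat) : ('rV[R]_n -> \bar R) -> \bar R :=
  match n with
  | 0 => fun f => f 0
  | m.+1 => fun f =>
      (\int[@lebesgue_measure R]_x
          leb_int (fun t : 'rV[R]_m => f (row_mx (const_mx x : 'rV[R]_1) t)))%E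
  end.

Definition sqnorm (n : nat) (x : 'rV[R]_n) : R := \sum_(i < n) x ord0 i ^+ 2.

Definition gauss_density (n : nat) (x : 'rV[R]_n) : R :=
  (pi *+ 2) `^ (- (n%:R / 2)) * expR (- (sqnorm x / 2)).

Definition gamma_n (n : nat) (A : set 'rV[R]_n) : R :=
  fine (leb_int (fun x => ((\1_A x : R) * gauss_density x)%:E)).

Definition ball2 (n : nat) (r : R) : set 'rV[R]_n := [set x | sqnorm x <= r ^+ 2].

Definition Psi (n : nat) (r : R) : R := gamma_n (@ball2 n r).

Definition Gamma (s : R) : R :=
  fine (\int[@lebesgue_measure R]_(t in `]0%R, +oo[) (t `^ (s - 1) * expR (- t))%:E)%E.

Definition c_const (n : nat) : R := (2 `^ (n%:R / 2 - 1) * Gamma (n%:R / 2))^-1.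

Definition symmetric_set (n : nat) (K : set 'rV[R]_n) : Prop :=
  K = [set - x | x in K].

Definition mink_comb (n : nat) (l : R) (K L : set 'rV[R]_n) : set 'rV[R]_n :=
  [set l *: a + (1 - l) *: b | a in K & b in L].

End Defs.

(* Main.v *)
(* Write K, L as limits of finite intersections of symmetric strips |<th_j, x>| <= h_j, and let
   the widths h_j + t d_j vary linearly in t.  Replace the indicator of the strips by the
   product w_t of logistic functions of lam(t) (h_j + t d_j - <th_j, x>), where lam(t) is
   proportional to exp(- c t), and put Z = E w_t.  The weight w_t is even and log-concave with
   respect to the Gaussian.  Solving L u = g approximately by polynomials u, where L is the
   Ornstein-Uhlenbeck operator with drift attached to w_t, and applying Bochner's formula and
   the Poincare inequality to the odd functions grad u - c x, one obtains, up to a small error,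
     Z'' <= Z'^2 / Z - 2 c Z' + c^2 (n Z - E (|x|^2 w_t)).
   By the bathtub principle n Z - E (|x|^2 w_t) <= c_n r^n exp(- r^2 / 2) if Psi_n r = Z.  For
   c = Z' / (n Z) the bound is exactly what the differential equation for sigma turns into
   (sigma o Z)'' <= 0.  As the approximation depends on c, which has to be fixed in advance,
   the inequality is used only where sigma o Z is touched from below by a parabola. *)
Require Import Defs.
From HB Require Import structures.
From mathcomp Require Import all_boot all_order all_algebra.
From mathcomp Require Import all_classical all_reals all_analysis measurable_realfun.
From mathcomp Require Import ring lra.
Set Implicit Arguments. Unset Strict Implicit. Unset Printing Implicit Defensive.
Import Order.TTheory GRing.Theory Num.Theory.
Import numFieldNormedType.Exports.
Local Open Scope classical_set_scope.
Local Open Scope ring_scope.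

(** * Integration against the one-dimensional Gaussian *)

(** The obstacle is the equation L u = g: an exact solution would call for regularity and decay at
    infinity before Bochner's formula could be applied. Only density of the range of L on
    polynomials is proved. For the plain Gaussian, L maps polynomials onto the centred ones by pure
    algebra. For the potential s W one passes from s = 0 to s = 1 in finitely many equal steps, each
    a truncated Neumann series; the step length does not depend on s because convexity of W bounds
    grad u by L u with constant 1. This dictates the logistic weight: its potential is convex with
    bounded gradient, and that gradient is a combination of logistic functions, multiplication by
    which preserves the closure of polynomials in L2 of the Gaussian. Balls are treated without
    polar coordinates: the distribution of |x|^2 is found from an integration by parts, and its
    constant from total mass one. General convex sets are not shown to be measurable; they are
    squeezed between functions that are. *)

Section normal_integral.
Context {R : realType}.
Local Notation mu := (@lebesgue_measure R).
Local Notation N := (normal_prob (0 : R) 1).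
Local Notation pdf := (normal_pdf (0 : R) 1).

Lemma normal_pdf01 (x : R) : pdf x = (Num.sqrt (pi *+ 2))^-1 * expR (- (x ^+ 2 / 2)).
Proof.
rewrite normal_pdfE ?oner_neq0// /normal_peak /normal_fun expr1n mul1r subr0.
by rewrite mulNr mulr2n.
Qed.

(** A Radon-Nikodym derivative is determined only almost everywhere; it is identified with the
    explicit density because both have the same integral over every measurable set. *)
Let ae_eq_normal_density :
  ae_eq mu setT (Radon_Nikodym_SigmaFinite.f N mu) (fun x => (pdf x)%:E).
Proof.
have dom := @normal_prob_dominates R 0 1.
apply: integral_ae_eq => //.
- exact: Radon_Nikodym_SigmaFinite.f_integrable.
- by apply/measurable_EFinP; exact: measurable_normal_pdf.
- by move=> A _ mA; rewrite -Radon_Nikodym_SigmaFinite.f_integral.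
Qed.

Let integral_normal0 (f : measurableTypeR R -> \bar R) :
  measurable_fun setT f -> (forall x, 0 <= f x)%E ->
  (\int[N]_x f x = \int[mu]_x (f x * (pdf x)%:E))%E.
Proof.
move=> mf f0; have dom := @normal_prob_dominates R 0 1.
rewrite -(Radon_Nikodym_SigmaFinite.change_of_variables dom)//.
apply: ae_eq_integral => //.
- apply: emeasurable_funM => //.
  exact: measurable_int (Radon_Nikodym_SigmaFinite.f_integrable dom).
- apply: emeasurable_funM => //; apply/measurable_EFinP.
  exact: measurable_normal_pdf.
- exact: ae_eqe_mul2l ae_eq_normal_density.
Qed.

Lemma integral_normal (f : R -> \bar R) :
  measurable_fun [set: R] f -> (forall x, 0 <= f x)%E ->
  (\int[N]_x f x = \int[mu]_x (f x * (pdf x)%:E))%E.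
Proof. exact: integral_normal0. Qed.

End normal_integral.

Section normal_facts.
Context {R : realType}.
Local Notation mu := (@lebesgue_measure R).
Local Notation N := (normal_prob (0 : R) 1).
Local Notation pdf := (normal_pdf (0 : R) 1).

Lemma measurable_expk (k : R) :
  measurable_fun setT (fun x : R => expR (k * (1 + `|x|))).
Proof.
apply: measurableT_comp => //; apply: measurable_funM => //.
by apply: measurable_funD => //; exact: measurableT_comp.
Qed.

Lemma integral_normal_expk (k : R) :
  (\int[N]_x (expR (k * (1 + `|x|)))%:E < +oo)%E.
Proof.
rewrite integral_normal//; last first.
  by apply/measurable_EFinP; exact: measurable_expk.
(* Compare with the normal density of variance 2: the inequality k |x| <= k^2 + x^2 / 4 trades half
   of the Gaussian exponent for the exponential growth. *)
pose s : R := Num.sqrt 2.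
have s0 : s != 0 by rewrite sqrtr_eq0 -ltNge.
have s2 : s ^+ 2 = 2 by rewrite sqr_sqrtr.
pose C := (Num.sqrt (pi *+ 2))^-1 * expR (k + k ^+ 2) / normal_peak s.
have p0 := normal_peak_gt0 s0.
have C0 : 0 <= C.
  by rewrite /C !mulr_ge0 ?expR_ge0 ?invr_ge0 ?sqrtr_ge0// ltW.
apply: (@le_lt_trans _ _ (\int[mu]_x (C%:E * (normal_pdf 0 s x)%:E))%E); last first.
  rewrite ge0_integralZl//=; last 2 first.
  - by apply/measurable_EFinP; exact: measurable_normal_pdf.
  - by move=> x _; rewrite lee_fin normal_pdf_ge0.
  by rewrite integral_normal_pdf mule1 ltry.
apply: ge0_le_integral => //.
- by move=> x _; rewrite -EFinM lee_fin mulr_ge0 ?expR_ge0 ?normal_pdf_ge0.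
- apply: emeasurable_funM; apply/measurable_EFinP; first exact: measurable_expk.
  exact: measurable_normal_pdf.
- apply: emeasurable_funM => //; apply/measurable_EFinP.
  exact: measurable_normal_pdf.
move=> x _; rewrite -!EFinM lee_fin normal_pdf01 normal_pdfE// /C.
rewrite -(mulrA _ _ (normal_peak s * _)) mulKf ?gt_eqF// /normal_fun s2 subr0.
rewrite mulrCA -mulrA -!expRD ler_wpM2l// ?invr_ge0 ?sqrtr_ge0// ler_expR.
have := sqr_ge0 (k - `|x| / 2).
rewrite sqrrB expr_div_n real_normK ?num_real//.
set y := x ^+ 2; set z := `|x|; rewrite -mulr_natr; lra.
Qed.

Lemma integral_normalN (f : R -> \bar R) : measurable_fun [set: R] f ->
  (forall x, 0 <= f x)%E -> (\int[N]_x f (- x)%R = \int[N]_x f x)%E.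
Proof.
move=> mf f0.
have mfN : measurable_fun [set: R] (fun x => f (- x)).
  by apply: (measurableT_comp mf); exact: oppr_measurable.
rewrite !integral_normal//.
transitivity (\int[mu]_x ((fun y => f y * (pdf y)%:E) (- x)%R))%E.
  by apply: eq_integral => x _; rewrite /= !normal_pdf01 sqrrN.
have mg : measurable_fun [set: R] (fun y => f y * (pdf y)%:E)%E.
  apply: emeasurable_funM => //; apply/measurable_EFinP.
  exact: measurable_normal_pdf.
have mN : measurable_fun setT (-%R : measurableTypeR R -> measurableTypeR R).
  exact: oppr_measurable.
have := @ge0_integral_pushforward _ _ _ _ R _ mN mu setT
  (fun y : measurableTypeR R => f y * (pdf y)%:E)%E measurableT mg.
rewrite preimage_setT /comp /= => <-; last first.
  by move=> x _; rewrite mule_ge0// lee_fin normal_pdf_ge0.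
by apply: eq_measure_integral => A mA _; exact: lebesgue_measureN.
Qed.

End normal_facts.

Section normal_ibp.
Context {R : realType}.
Local Notation mu := (@lebesgue_measure R).
Local Notation N := (normal_prob (0 : R) 1).
Local Notation pdf := (normal_pdf (0 : R) 1).

Lemma integrable_normal_growth (f : R -> R) (k : R) : measurable_fun [set: R] f ->
  (forall x, `|f x| <= expR (k * (1 + `|x|))) ->
  N.-integrable setT (fun x => (f x)%:E).
Proof.
move=> mf fk; apply: (@le_integrable _ _ R N setT measurableT _ (fun x => (expR (k * (1 + `|x|)))%:E)) => //.
- exact/measurable_EFinP.
- by move=> x _; rewrite /= lee_fin [leRHS]ger0_norm ?expR_ge0.
apply/integrableP; split; first by apply/measurable_EFinP; exact: measurable_expk.
under eq_integral do rewrite gee0_abs ?lee_fin ?expR_ge0//.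
exact: integral_normal_expk.
Qed.

Lemma integral_normal_signed (f : R -> R) : measurable_fun [set: R] f ->
  (\int[N]_x (f x)%:E = \int[mu]_x (f x * pdf x)%:E)%E.
Proof.
move=> mf; rewrite integralE [RHS]integralE.
have E (g : R -> R) : measurable_fun [set: R] g ->
    (\int[N]_x maxe (g x)%:E 0 = \int[mu]_x (maxe (g x * pdf x)%:E 0))%E.
  move=> mg; rewrite integral_normal//; last 2 first.
  - apply: measurable_maxe => //; exact/measurable_EFinP.
  - by move=> x; rewrite le_max lexx orbT.
  apply: eq_integral => x _; rewrite -!EFin_max -EFinM.
  by rewrite maxr_pMl ?normal_pdf_ge0// mul0r.
congr (_ - _)%E.
  under eq_integral do rewrite funeposE.
  by under [RHS]eq_integral do rewrite funeposE; exact: E.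
under eq_integral do rewrite funenegE -EFinN.
under [RHS]eq_integral do rewrite funenegE -EFinN -mulNr.
by rewrite (E (fun x => - f x))//; exact: measurableT_comp.
Qed.

(** These are the boundary terms of the integration by parts below; completing the square in the
    exponent leaves a decay exp(- |x|). *)
Lemma normal_pdf_growth (f : R -> R) (k : R) :
  (forall x, `|f x| <= expR (k * (1 + `|x|))) ->
  (fun n : nat => f n%:R * pdf n%:R) @ \oo --> (0 : R) /\
  (fun n : nat => f (- n%:R) * pdf (- n%:R)) @ \oo --> (0 : R).
Proof.
move=> fk.
pose c : R := (Num.sqrt (pi *+ 2))^-1 * expR (2 * k + k ^+ 2 + 1).
have c0 : 0 <= c by rewrite mulr_ge0 ?expR_ge0// invr_ge0 sqrtr_ge0.
have bnd (x : R) : `|f x * pdf x| <= c * expR (- `|x|).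
  rewrite normrM (ger0_norm (normal_pdf_ge0 _ _ _)) normal_pdf01.
  rewrite mulrCA /c -[leRHS]mulrA; apply: ler_wpM2l; first by rewrite invr_ge0 sqrtr_ge0.
  rewrite -expRD.
  apply: le_trans (_ : expR (k * (1 + `|x|)) * expR (- (x ^+ 2 / 2)) <= _).
    by rewrite ler_wpM2r ?expR_ge0.
  rewrite -expRD ler_expR.
  have y0 : 0 <= (k + 1 - `|x|) ^+ 2 by exact: sqr_ge0.
  have k0 : 0 <= k ^+ 2 by exact: sqr_ge0.
  have zE : x ^+ 2 = `|x| ^+ 2 by rewrite real_normK ?num_real.
  rewrite zE; move: y0 k0; set z := `|x| => y0 k0; rewrite -subr_ge0.
  have -> : 2 * k + k ^+ 2 + 1 - z - (k * (1 + z) - z ^+ 2 / 2) =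
    2^-1 * ((k + 1 - z) ^+ 2 + k ^+ 2 + 1) by field.
  by rewrite mulr_ge0 ?invr_ge0// !addr_ge0.
have cv : (fun n : nat => c * expR (- n%:R)) @ \oo --> (0 : R).
  rewrite -(mulr0 c); apply: cvgM; first exact: cvg_cst.
  have := @cvgr_idn R; move/cvgryPge => H.
  apply/cvgrPdist_le => e e0.
  near=> n; rewrite sub0r normrN ger0_norm ?expR_ge0//.
  have : - ln e <= n%:R by near: n; exact: H.
  by move=> h; rewrite -[leRHS]lnK ?posrE// ler_expR lerNl.
split; apply/norm_cvg0P; apply: (squeeze_cvgr _ (cvg_cst 0) cv); apply: nearW => n /=.
- by rewrite normr_ge0/= (le_trans (bnd _))// ger0_norm.
- by rewrite normr_ge0/= (le_trans (bnd _))// normrN ger0_norm.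
Unshelve. all: end_near. Qed.

Lemma is_derive_normal_pdf (x : R) : is_derive x 1 pdf (- x * pdf x).
Proof.
have -> : pdf = fun x : R => (Num.sqrt (pi *+ 2))^-1 * expR (- (x ^+ 2 / 2)).
  by apply/funext => y; exact: normal_pdf01.
have h : is_derive x 1 (fun y : R => - (y ^+ 2 / 2)) (- x).
  apply: is_derive_eq.
  by rewrite /GRing.scale/=; field.
have H : is_derive x 1 (fun y : R => expR (- (y ^+ 2 / 2))) _ :=
  @is_derive1_comp _ expR (fun y : R => - (y ^+ 2 / 2)) _ _ _ (is_derive_expR (- (x ^+ 2 / 2))) h.
apply: is_derive_eq.
by rewrite /GRing.scale/=; ring.
Qed.

(** The derivative of f times the density is (f' - x f) times the density, so the difference of the
    two sides is a limit of boundary terms over growing intervals. *)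
Lemma normal_ibp (f f' : R -> R) (k : R) :
  (forall x : R, is_derive x 1 f (f' x)) -> continuous f' ->
  (forall x, `|f x| <= expR (k * (1 + `|x|))) ->
  (forall x, `|f' x| <= expR (k * (1 + `|x|))) ->
  \int[N]_x f' x = \int[N]_x (x * f x).
Proof.
move=> df cf' fk f'k.
have cf : continuous f.
  move=> x; apply: differentiable_continuous; apply/derivable1_diffP.
  by have := df x.
have mf : measurable_fun [set: R] f by exact: continuous_measurable_fun.
have mf' : measurable_fun [set: R] f' by exact: continuous_measurable_fun.
have mxf : measurable_fun [set: R] (fun x => x * f x) by exact: measurable_funM.
pose k1 := k + 1.
have xfk x : `|x * f x| <= expR ((k + 1) * (1 + `|x|)).
  rewrite normrM mulrDl mul1r expRD mulrC ler_pM//.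
  by rewrite (le_trans _ (expR_ge1Dx _))// addrA lerDr.
have if' := integrable_normal_growth mf' f'k.
have ixf := integrable_normal_growth mxf xfk.
apply/eqP; rewrite -subr_eq0 -RintegralB//.
pose g x := f' x - x * f x.
have mg : measurable_fun [set: R] g by exact: measurable_funB.
have ig : N.-integrable setT (fun x => (g x)%:E).
  under eq_fun do rewrite EFinB.
  exact: integrableB.
have cpdf : continuous pdf by apply: continuous_normal_pdf; exact: oner_neq0.
have cg : continuous (fun x => g x * pdf x).
  move=> x; apply: cvgM; last exact: cpdf.
  apply: cvgB; first exact: cf'.
  by apply: cvgM; [exact: cvg_id|exact: cf].
have dh (x : R) : is_derive x 1 (fun x => f x * pdf x) (g x * pdf x).
  have dp := is_derive_normal_pdf x; have dfx := df x.
  apply: is_derive_eq.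
  by rewrite /GRing.scale/= /g; ring.
have [cv1 cv2] := normal_pdf_growth fk.
have igpdf : mu.-integrable setT (fun x => (g x * pdf x)%:E).
  apply/integrableP; split.
    apply/measurable_EFinP; apply: continuous_measurable_fun.
    exact: cg.
  move/integrableP : ig => [_].
  rewrite integral_normal//; last first.
    by apply: measurableT_comp => //; exact/measurable_EFinP.
  apply: le_lt_trans; rewrite le_eqVlt; apply/orP; left; apply/eqP.
  apply: eq_integral => x _.
  by rewrite EFinM abseM; congr (_ * _)%E; rewrite gee0_abs// lee_fin normal_pdf_ge0.
rewrite /Rintegral -/(g _) integral_normal_signed//.
pose h_ (n : nat) (x : R) := (g x * pdf x * \1_(`[- n.+1%:R, n.+1%:R]%classic) x)%:E.
have mh n : measurable_fun setT (h_ n).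
  apply/measurable_EFinP; apply: measurable_funM.
    by apply: continuous_measurable_fun; exact: cg.
  exact: measurable_indic.
have h_cvg : {ae mu, forall x, setT x -> h_ ^~ x @ \oo --> (g x * pdf x)%:E}.
  apply/aeW => x _; apply: cvg_near_cst; near=> n.
  rewrite /h_ indicE mem_set ?mulr1//= in_itv/= -ler_norml.
  by rewrite (@le_trans _ _ n%:R) ?ler_nat//; near: n; exact: nbhs_infty_ger.
have h_bnd : {ae mu, forall x n, setT x -> (`|h_ n x| <= `|(g x * pdf x)%:E|)%E}.
  apply/aeW => x n _; rewrite lee_fin /h_ normrM ler_piMr// indicE.
  by case: (_ \in _); rewrite ?normr1// normr0.
have [_ _ lim1] := @dominated_convergence _ _ R mu setT measurableT h_
   (fun x => (g x * pdf x)%:E) (fun x => `|(g x * pdf x)%:E|%E) mh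
   (measurable_int _ igpdf) h_cvg (integrable_abse igpdf) h_bnd.
have lim2 : (fun n => \int[mu]_x h_ n x)%E @ \oo --> (0%:E : \bar R).
  have -> : (fun n => \int[mu]_x h_ n x)%E =
      (fun n : nat => (f n.+1%:R * pdf n.+1%:R - f (- n.+1%:R) * pdf (- n.+1%:R))%:E).
    apply/funext => n.
    rewrite EFinB -(@continuous_FTC2 _ (fun x => g x * pdf x) (fun x => f x * pdf x)).
    - rewrite [RHS]integral_mkcond; apply: eq_integral => x _.
      rewrite /h_ indicE patchE; case: ifPn => _; rewrite ?mulr1// mulr0//.
    - by rewrite (@lt_trans _ _ 0)// ltrNl oppr0.
    - exact: continuous_subspaceT.
    - split.
      + by move=> x _; have := dh x.
      + apply: cvg_at_right_filter.
        by apply: cvgM; [exact: cf|exact: cpdf].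
      + apply: cvg_at_left_filter.
        by apply: cvgM; [exact: cf|exact: cpdf].
    - by move=> x _; rewrite derive1E; apply: derive_val; exact: dh.
  apply: cvg_EFin; first exact: nearW.
  have c1 : (fun n : nat => f n.+1%:R * pdf n.+1%:R) @ \oo --> (0 : R).
    by rewrite (cvg_shiftS (fun n : nat => f n%:R * pdf n%:R)).
  have c2 : (fun n : nat => f (- n.+1%:R) * pdf (- n.+1%:R)) @ \oo --> (0 : R).
    by rewrite (cvg_shiftS (fun n : nat => f (- n%:R) * pdf (- n%:R))).
  have c3 := cvgB c1 c2; rewrite subr0 in c3; exact: c3.
by have := cvg_unique _ lim1 lim2; rewrite /= => ->.

Unshelve. all: end_near. Qed.

End normal_ibp.

(** * Functions of exponential growth *)

Section growth_functions.
Context {R : realType}.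

(** The l1 norm is additive over the coordinates, so an exponential bound in it splits into factors
    under Fubini. Exponential and not just polynomial growth is allowed because the power series of
    the sine needs such a majorant later. *)
Definition l1norm n (x : 'rV[R]_n) : R := \sum_(i < n) `|x ord0 i|.

(* Measurability with respect to the coordinates, tested on all random vectors:
   closed under every pointwise operation, and stable under freezing some of the
   coordinates. *)
Definition mfun n (F : 'rV[R]_n -> R) : Prop :=
  forall d (T : measurableType d) (X : T -> 'rV[R]_n),
    (forall i, measurable_fun [set: T] (fun w => X w ord0 i)) ->
    measurable_fun [set: T] (fun w => F (X w)).

Definition growth n (F : 'rV[R]_n -> R) : Prop :=
  exists k : nat, forall x, `|F x| <= expR (k%:R * (1 + l1norm x)).

Definition good n (F : 'rV[R]_n -> R) : Prop := mfun F /\ growth F.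

Section closure.
Variable n : nat.
Implicit Types (F G : 'rV[R]_n -> R).

Lemma l1norm_ge0 (x : 'rV[R]_n) : 0 <= l1norm x.
Proof. by apply: sumr_ge0. Qed.

Lemma l1normZ (t : R) (x : 'rV[R]_n) : l1norm (t *: x) = `|t| * l1norm x.
Proof. by rewrite /l1norm mulr_sumr; apply: eq_bigr => i _; rewrite mxE normrM. Qed.

Lemma growthW (k m : nat) (x : 'rV[R]_n) : (k <= m)%N ->
  expR (k%:R * (1 + l1norm x)) <= expR (m%:R * (1 + l1norm x)).
Proof.
by move=> km; rewrite ler_expR ler_wpM2r ?addr_ge0 ?l1norm_ge0// ler_nat.
Qed.

Lemma growth_le F G : growth G -> (forall x, `|F x| <= `|G x|) -> growth F.
Proof. by move=> [k Gk] FG; exists k => x; rewrite (le_trans (FG x)). Qed.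

Lemma growth_bounded F (c : R) : (forall x, `|F x| <= c) -> growth F.
Proof.
move=> Fc; exists (Num.bound c) => x; rewrite (le_trans (Fc x))//.
have c0 : 0 <= c by rewrite (le_trans _ (Fc 0)).
have cb := archi_boundP c0; rewrite (le_trans (ltW cb))//.
apply: le_trans (expR_ge1Dx _); rewrite mulrDr mulr1 addrCA lerDl.
by rewrite addr_ge0// mulr_ge0// l1norm_ge0.
Qed.

Lemma growthD F G : growth F -> growth G -> growth (fun x => F x + G x).
Proof.
move=> [k Fk] [m Gm]; exists (maxn k m).+1 => x.
rewrite (le_trans (ler_normD _ _))// -natr1 mulrDl mul1r expRD.
apply: (@le_trans _ _ (expR ((maxn k m)%:R * (1 + l1norm x)) * 2)).
  rewrite mulrDr mulr1 lerD//.
    by rewrite (le_trans (Fk x))// growthW// leq_maxl.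
  by rewrite (le_trans (Gm x))// growthW// leq_maxr.
rewrite ler_wpM2l ?expR_ge0// (le_trans _ (expR_ge1Dx _))//.
by have := l1norm_ge0 x; lra.
Qed.

Lemma growthM F G : growth F -> growth G -> growth (fun x => F x * G x).
Proof.
move=> [k Fk] [m Gm]; exists (k + m)%N => x.
by rewrite natrD mulrDl expRD normrM ler_pM.
Qed.

Lemma mfun_cst (c : R) : mfun (fun _ : 'rV[R]_n => c).
Proof. by move=> d T X mX; exact: measurable_cst. Qed.

Lemma mfun_coord (i : 'I_n) : mfun (fun x : 'rV[R]_n => x ord0 i).
Proof. by move=> d T X mX; exact: mX. Qed.

Lemma mfunD F G : mfun F -> mfun G -> mfun (fun x => F x + G x).
Proof. by move=> mF mG d T X mX; apply: measurable_funD; [exact: mF|exact: mG]. Qed.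

Lemma mfunM F G : mfun F -> mfun G -> mfun (fun x => F x * G x).
Proof. by move=> mF mG d T X mX; apply: measurable_funM; [exact: mF|exact: mG]. Qed.

Lemma mfun_comp (g : R -> R) F : measurable_fun [set: R] g -> mfun F ->
  mfun (fun x => g (F x)).
Proof. by move=> mg mF d T X mX; apply: (measurableT_comp mg); exact: mF. Qed.

Lemma mfun_sum (I : Type) (r : seq I) (P : pred I) (F : I -> 'rV[R]_n -> R) :
  (forall i, mfun (F i)) -> mfun (fun x => \sum_(i <- r | P i) F i x).
Proof.
move=> mF; elim: r => [|i r IH].
  by under eq_fun do rewrite big_nil; exact: mfun_cst.
under eq_fun do rewrite big_cons.
by case: (P i); [exact: (mfunD (mF i) IH)|exact: IH].
Qed.

Lemma good_cst (c : R) : good (fun _ : 'rV[R]_n => c).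
Proof. by split; [exact: mfun_cst|apply: (growth_bounded (c := `|c|))]. Qed.

Lemma l1norm_coord (x : 'rV[R]_n) i : `|x ord0 i| <= l1norm x.
Proof. by rewrite /l1norm (bigD1 i)//= lerDl sumr_ge0. Qed.

Lemma good_coord (i : 'I_n) : good (fun x : 'rV[R]_n => x ord0 i).
Proof.
split; first exact: mfun_coord.
exists 1%N => x; rewrite mul1r (le_trans (l1norm_coord x i))//.
by rewrite (le_trans _ (expR_ge1Dx _))// addrA lerDr.
Qed.

Lemma goodD F G : good F -> good G -> good (fun x => F x + G x).
Proof. by move=> [mF gF] [mG gG]; split; [exact: mfunD|exact: growthD]. Qed.

Lemma goodM F G : good F -> good G -> good (fun x => F x * G x).
Proof. by move=> [mF gF] [mG gG]; split; [exact: mfunM|exact: growthM]. Qed.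

Lemma goodZ (c : R) F : good F -> good (fun x => c * F x).
Proof. by move=> gF; apply: goodM => //; exact: good_cst. Qed.

Lemma goodN F : good F -> good (fun x => - F x).
Proof.
move=> gF; have := goodZ (-1) gF.
by congr good; apply/funext => x; rewrite mulN1r.
Qed.

Lemma goodB F G : good F -> good G -> good (fun x => F x - G x).
Proof. by move=> gF gG; apply: goodD => //; exact: goodN. Qed.

Lemma goodX F (m : nat) : good F -> good (fun x => F x ^+ m).
Proof.
move=> gF; elim: m => [|m IH].
  by under eq_fun do rewrite expr0; exact: good_cst.
by under eq_fun do rewrite exprS; exact: goodM.
Qed.

Lemma good_sum (I : Type) (r : seq I) (P : pred I) (F : I -> 'rV[R]_n -> R) :
  (forall i, good (F i)) -> good (fun x => \sum_(i <- r | P i) F i x).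
Proof.
move=> mF; elim: r => [|i r IH].
  by under eq_fun do rewrite big_nil; exact: good_cst.
under eq_fun do rewrite big_cons.
by case: (P i); [exact: (goodD (mF i) IH)|exact: IH].
Qed.

Lemma good_bounded (c : R) F : mfun F -> (forall x, `|F x| <= c) -> good F.
Proof. by move=> mF Fc; split => //; exact: growth_bounded Fc. Qed.

Lemma good_sublevel F (c : R) : mfun F -> good (fun x => (F x <= c)%R%:R : R).
Proof.
move=> mF; apply: (@good_bounded 1) => [|x]; last by case: (F x <= c)%R; rewrite ?normr1 ?normr0.
apply: (mfun_comp (g := fun y : R => (y <= c)%R%:R)) => //.
rewrite (_ : (fun y : R => _) = \1_(`]-oo, c]%classic)); first exact: measurable_indic.
by apply/funext => y; rewrite indicE mem_setE in_itv.
Qed.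

Lemma good_norm F : good F -> good (fun x => `|F x|).
Proof.
move=> [mF gF]; split; first by apply: mfun_comp => //; exact: normr_measurable.
by apply: (growth_le gF) => x; rewrite normr_id.
Qed.

Lemma good_expl1 (k : nat) : good (fun x : 'rV[R]_n => expR (k%:R * (1 + l1norm x))).
Proof.
split; last by exists k => x; rewrite ger0_norm ?expR_ge0.
apply: mfun_comp; first exact: measurable_expR.
apply: mfunM; first exact: mfun_cst.
apply: mfunD; first exact: mfun_cst.
apply: mfun_sum => i; apply: mfun_comp; first exact: normr_measurable.
exact: mfun_coord.
Qed.

Lemma mfunN F : mfun F -> mfun (fun x => F (- x)).
Proof.
move=> mF d T X mX; apply: (mF _ _ (fun w => - X w)) => i.
by under eq_fun do rewrite mxE; apply: measurableT_comp => //; exact: mX.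
Qed.

Lemma goodNx F : good F -> good (fun x => F (- x)).
Proof.
move=> [mF [k Fk]]; split; first exact: mfunN.
exists k => x; rewrite (le_trans (Fk _))// ler_expR.
by rewrite /l1norm; under eq_bigr do rewrite mxE normrN.
Qed.

End closure.

Definition catx n (a : R) (t : 'rV[R]_n) : 'rV[R]_n.+1 :=
  row_mx (const_mx a : 'rV[R]_1) t.

Lemma catx0 n (a : R) (t : 'rV[R]_n) (j : 'I_1) : catx a t ord0 (lshift n j) = a.
Proof.
by apply: etrans (row_mxEl (const_mx a : 'rV[R]_1) t ord0 j) _; rewrite mxE.
Qed.

Lemma catxS n (a : R) (t : 'rV[R]_n) (j : 'I_n) :
  catx a t ord0 (rshift 1 j) = t ord0 j.
Proof. exact: (row_mxEr (const_mx a : 'rV[R]_1) t ord0 j). Qed.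

Lemma l1norm_cat n (a : R) (t : 'rV[R]_n) : l1norm (catx a t) = `|a| + l1norm t.
Proof.
rewrite /l1norm (@big_split_ord _ _ _ 1 n) /= big_ord1 catx0; congr (_ + _).
by apply: eq_bigr => i _; rewrite catxS.
Qed.

Lemma measurable_catx d (T : measurableType d) n (f : T -> R) (X : T -> 'rV[R]_n) :
  measurable_fun [set: T] f ->
  (forall i, measurable_fun [set: T] (fun w => X w ord0 i)) ->
  forall i, measurable_fun [set: T] (fun w => catx (f w) (X w) ord0 i).
Proof.
move=> mf mX i; case: (split_ordP (i : 'I_(1 + n))) => j ->.
  by under eq_fun do rewrite catx0.
by under eq_fun do rewrite catxS; exact: mX.
Qed.

Lemma good_sec n (F : 'rV[R]_n.+1 -> R) (a : R) :
  good F -> good (fun t : 'rV[R]_n => F (catx a t)).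
Proof.
move=> [mF [k Fk]]; split.
  by move=> d T X mX; apply: mF; apply: measurable_catx => //.
exists (Num.bound (k%:R * (1 + `|a|))) => t.
rewrite (le_trans (Fk _))// ler_expR l1norm_cat.
have b0 : 0 <= k%:R * (1 + `|a|) by rewrite mulr_ge0// addr_ge0.
have := l1norm_ge0 t; set l := l1norm t => l0.
apply: (@le_trans _ _ (k%:R * (1 + `|a|) * (1 + l))).
  rewrite -mulrA ler_wpM2l// mulrDl mul1r mulrDr mulr1.
  have : 0 <= `|a| * l by rewrite mulr_ge0.
  lra.
by rewrite ler_wpM2r ?addr_ge0// ltW// archi_boundP.
Qed.

End growth_functions.

(** * Gaussian expectation on R^n *)

Section gauss_space.
Context {R : realType}.
Local Notation mu := (@lebesgue_measure R).
Local Notation N := (normal_prob (0 : R) 1).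
Local Notation pdf := (normal_pdf (0 : R) 1).

(** The sample space is an iterated product whose measurable structure, display included, changes
    with n; the bundle lets the recursion [gauss_space] carry all of it along. *)
Record gspace (n : nat) := GSpace {
  gs_disp : measure_display ;
  gs_T : measurableType gs_disp ;
  gs_P : probability gs_T R ;
  gs_X : gs_T -> 'rV[R]_n }.

Definition gspaceS n (g : gspace n) : gspace n.+1 :=
  @GSpace n.+1 _ (measurableTypeR R * gs_T g)%type
    (normal_prob (0 : R) 1 \x gs_P g)%E
    (fun w => catx w.1 (gs_X w.2)).

Fixpoint gauss_space (n : nat) : gspace n :=
  match n with
  | 0 => @GSpace 0 _ unit (\d_tt) (fun _ => 0)
  | m.+1 => gspaceS (gauss_space m)
  end.

Definition gaussE n (F : 'rV[R]_n -> R) : R :=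
  (\int[gs_P (gauss_space n)]_w F (gs_X w))%R.

Lemma measurable_gs_X n (i : 'I_n) :
  measurable_fun [set: gs_T (gauss_space n)] (fun w => gs_X w ord0 i).
Proof.
elim: n i => [|n IH] i; first by case: i.
apply: (@measurable_catx _ _ (gs_T (gauss_space n.+1)) n fst (fun w => gs_X w.2)).
  exact: measurable_fst.
by move=> j; apply: (measurableT_comp (IH j)); exact: measurable_snd.
Qed.

Lemma mfun_gs_X n (F : 'rV[R]_n -> R) : mfun F ->
  measurable_fun [set: gs_T (gauss_space n)] (fun w => F (gs_X w)).
Proof. by move=> mF; apply: mF => i; exact: measurable_gs_X. Qed.

Lemma gaussE_expl1 n (k : nat) :
  (\int[gs_P (gauss_space n)]_w (expR (k%:R * (1 + l1norm (gs_X w))))%:E < +oo)%E.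
Proof.
elim: n => [|n IH].
  under eq_integral do rewrite /l1norm big_ord0.
  by rewrite integral_cst//= probability_setT mule1 ltry.
have mE m : measurable_fun [set: gs_T (gauss_space m)]
    (fun w => (expR (k%:R * (1 + l1norm (gs_X w))))%:E).
  by apply/measurable_EFinP; exact: (mfun_gs_X (@good_expl1 R m k).1).
pose I := (\int[gs_P (gauss_space n)]_w (expR (k%:R * (1 + l1norm (gs_X w))))%:E)%E.
have I0 : (0 <= I)%E by apply: integral_ge0 => w _; rewrite lee_fin expR_ge0.
have Ifin : I \is a fin_num by rewrite ge0_fin_numE.
rewrite [ltLHS](@fubini_tonelli1 _ _ _ _ _ N (gs_P (gauss_space n)))//; last first.
  exact: (mE n.+1).
rewrite /fubini_F /=.
(* Enlarging 1 + |x| + l to (1 + |x|) + (1 + l) turns the bound into a product. *)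
apply: (@le_lt_trans _ _ (\int[N]_x ((expR (k%:R * (1 + `|x|)))%:E * I))%E).
  apply: ge0_le_integral => //.
  - by move=> x _; apply: integral_ge0 => w _; rewrite lee_fin expR_ge0.
  - apply: (@measurable_fun_fubini_tonelli_F _ _ _ _ _ (gs_P (gauss_space n))
      (fun w : measurableTypeR R * gs_T (gauss_space n) =>
       (expR (k%:R * (1 + l1norm (catx w.1 (gs_X w.2)))))%:E)).
      exact: (mE n.+1).
    by move=> w; rewrite lee_fin expR_ge0.
  - apply: emeasurable_funM => //; apply/measurable_EFinP.
    exact: measurable_expk.
  move=> x _; rewrite /I -ge0_integralZl//.
  apply: ge0_le_integral => //.
  - apply/measurable_EFinP.
    by have [mF _] := good_sec x (@good_expl1 R n.+1 k); exact: (mfun_gs_X mF).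
  - by apply: emeasurable_funM.
  move=> w _; rewrite l1norm_cat -EFinM lee_fin -expRD ler_expR -mulrDr ler_wpM2l//.
  by rewrite -[leRHS]addrA !lerD2l lerDr.
rewrite ge0_integralZr//; last first.
  by apply/measurable_EFinP; exact: measurable_expk.
rewrite lte_mul_pinfty//.
- by apply: integral_ge0 => x _; rewrite lee_fin expR_ge0.
- rewrite ge0_fin_numE; first exact: integral_normal_expk.
  by apply: integral_ge0 => x _; rewrite lee_fin expR_ge0.
Qed.

Lemma good_integrable n (F : 'rV[R]_n -> R) : good F ->
  (gs_P (gauss_space n)).-integrable setT (fun w => (F (gs_X w))%:E).
Proof.
move=> [mF [k Fk]].
apply: (@le_integrable _ _ R _ setT measurableT _
  (fun w => (expR (k%:R * (1 + l1norm (gs_X w))))%:E)) => //.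
- by apply/measurable_EFinP; exact: mfun_gs_X.
- by move=> w _; rewrite /= lee_fin [leRHS]ger0_norm ?expR_ge0.
apply/integrableP; split.
  by apply/measurable_EFinP; exact: (mfun_gs_X (@good_expl1 R n k).1).
under eq_integral do rewrite gee0_abs ?lee_fin ?expR_ge0//.
exact: gaussE_expl1.
Qed.

Lemma gaussE_fin n (F : 'rV[R]_n -> R) : good F ->
  ((gaussE F)%:E = \int[gs_P (gauss_space n)]_w (F (gs_X w))%:E)%E.
Proof.
by move=> gF; rewrite /gaussE /Rintegral fineK// integrable_fin_num// good_integrable.
Qed.

Lemma gaussED n (F G : 'rV[R]_n -> R) : good F -> good G ->
  gaussE (fun x => F x + G x) = gaussE F + gaussE G.
Proof. by move=> gF gG; rewrite /gaussE RintegralD//; exact: good_integrable. Qed.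

Lemma gaussEB n (F G : 'rV[R]_n -> R) : good F -> good G ->
  gaussE (fun x => F x - G x) = gaussE F - gaussE G.
Proof. by move=> gF gG; rewrite /gaussE RintegralB//; exact: good_integrable. Qed.

Lemma gaussEZ n (c : R) (F : 'rV[R]_n -> R) : good F ->
  gaussE (fun x => c * F x) = c * gaussE F.
Proof. by move=> gF; rewrite /gaussE RintegralZl//; exact: good_integrable. Qed.

Lemma gaussE_le n (F G : 'rV[R]_n -> R) : good F -> good G ->
  (forall x, F x <= G x) -> gaussE F <= gaussE G.
Proof.
by move=> gF gG FG; apply: le_Rintegral => //; exact: good_integrable.
Qed.

Lemma gaussE_cst n (c : R) : gaussE (fun _ : 'rV[R]_n => c) = c.
Proof.
rewrite /gaussE Rintegral_cst//= probability_setT/=; by rewrite mulr1.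
Qed.

Lemma gaussE_ge0 n (F : 'rV[R]_n -> R) : (forall x, 0 <= F x) -> 0 <= gaussE F.
Proof. by move=> F0; apply: Rintegral_ge0. Qed.

Lemma gaussE_sum n (I : Type) (r : seq I) (P : pred I) (F : I -> 'rV[R]_n -> R) :
  (forall i, good (F i)) ->
  gaussE (fun x => \sum_(i <- r | P i) F i x) = \sum_(i <- r | P i) gaussE (F i).
Proof.
move=> gF; elim: r => [|i r IH].
  rewrite big_nil -[RHS](@gaussE_cst n 0); congr gaussE; apply/funext => x.
  by rewrite big_nil.
rewrite big_cons; case: ifPn => Pi.
  rewrite -IH -gaussED//; last exact: good_sum.
  by congr gaussE; apply/funext => x; rewrite big_cons Pi.
by rewrite -IH; congr gaussE; apply/funext => x; rewrite big_cons (negbTE Pi).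
Qed.

Lemma gaussE_dct n (F_ : nat -> 'rV[R]_n -> R) (F G : 'rV[R]_n -> R) :
  (forall m, mfun (F_ m)) -> mfun F -> good G ->
  (forall m x, `|F_ m x| <= G x) -> (forall x, F_ ^~ x @ \oo --> F x) ->
  (fun m => gaussE (F_ m)) @ \oo --> gaussE F.
Proof.
move=> mF_ mF gG F_G F_F.
have gF_ m : good (F_ m).
  split=> //; apply: (growth_le gG.2) => x.
  by rewrite (le_trans (F_G m x))// ler_norm.
have gF : good F.
  split=> //; apply: (growth_le gG.2) => x; rewrite (le_trans _ (ler_norm _))//.
  have cF : `|F_ m x| @[m --> \oo] --> `|F x| by apply: cvg_norm; exact: F_F.
  rewrite -(cvg_lim _ cF)//.
  by apply: limr_le; [exact: (cvgP _ cF)|apply: nearW => m /=; exact: F_G].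
have hF (w : gs_T (gauss_space n)) : (F_ m (gs_X w))%:E @[m --> \oo] --> (F (gs_X w))%:E.
  by apply: cvg_EFin; [exact: nearW|exact: F_F].
have [_ _ H] := @dominated_convergence _ _ R (gs_P (gauss_space n)) setT measurableT
  (fun m w => (F_ m (gs_X w))%:E) (fun w => (F (gs_X w))%:E) (fun w => (G (gs_X w))%:E)
  (fun m => measurable_int _ (good_integrable (gF_ m))) (measurable_int _ (good_integrable gF))
  (aeW _ (fun w _ => hF w))
  (good_integrable gG) (aeW _ (fun w m _ => F_G m (gs_X w))).
have H' := H; rewrite -(gaussE_fin gF) in H'; exact: (fine_cvg H').
Qed.

Lemma gaussES n (F : 'rV[R]_n.+1 -> R) : good F ->
  gaussE F = \int[N]_x gaussE (fun t : 'rV[R]_n => F (catx x t)).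
Proof.
move=> gF; rewrite {1}/gaussE /Rintegral.
rewrite -(@integral12_prod_meas1 _ _ _ _ R N (gs_P (gauss_space n))
  (fun w => (F (catx w.1 (gs_X w.2)))%:E)); last exact: (good_integrable gF).
congr fine; apply: eq_integral => x _.
by rewrite gaussE_fin//; exact: good_sec.
Qed.

Lemma growth_sec0 n (F : 'rV[R]_n.+1 -> R) (t : 'rV[R]_n) : good F ->
  exists k : R, forall x, `|F (catx x t)| <= expR (k * (1 + `|x|)).
Proof.
move=> [_ [k Fk]]; exists (k%:R * (1 + l1norm t)) => x.
rewrite (le_trans (Fk _))// ler_expR -mulrA ler_wpM2l// l1norm_cat.
rewrite mulrDl mul1r mulrDr mulr1.
have : 0 <= l1norm t * `|x| by rewrite mulr_ge0// l1norm_ge0.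
lra.
Qed.

Lemma mfun_sec0 n (F : 'rV[R]_n.+1 -> R) (t : 'rV[R]_n) : mfun F ->
  measurable_fun [set: R] (fun x => F (catx x t)).
Proof. by move=> mF; apply: mF; exact: measurable_catx. Qed.

Lemma integrable_sec0 n (F : 'rV[R]_n.+1 -> R) (t : 'rV[R]_n) : good F ->
  N.-integrable setT (fun x => (F (catx x t))%:E).
Proof.
move=> gF; have [k Fk] := growth_sec0 t gF.
by apply: (integrable_normal_growth _ Fk); exact: (mfun_sec0 t gF.1).
Qed.

(** Fubini in the other order: the inner integral runs over the first coordinate, as integration by
    parts in that coordinate requires. *)
Lemma gaussES2 n (F : 'rV[R]_n.+1 -> R) : good F ->
  gaussE F = (\int[gs_P (gauss_space n)]_w (\int[N]_x F (catx x (gs_X w))))%R.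
Proof.
move=> gF; rewrite {1}/gaussE /Rintegral.
rewrite -(@integral21_prod_meas1 _ _ _ _ R N (gs_P (gauss_space n))
  (fun w => (F (catx w.1 (gs_X w.2)))%:E)); last exact: (good_integrable gF).
congr fine; apply: eq_integral => w _.
rewrite /fubini_G /= fineK//.
by apply: integrable_fin_num => //; exact: integrable_sec0.
Qed.

Lemma measurable_gaussE_sec n (F : 'rV[R]_n.+1 -> R) : good F ->
  measurable_fun [set: R] (fun x => gaussE (fun t : 'rV[R]_n => F (catx x t))).
Proof.
move=> gF.
apply/measurable_EFinP.
have := @measurable_fubini_F _ _ _ _ R N (gs_P (gauss_space n))
  (fun w => (F (catx w.1 (gs_X w.2)))%:E) (good_integrable gF).
apply: eq_measurable_fun => x _.
by rewrite /fubini_F /= gaussE_fin//; exact: good_sec.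
Qed.

Lemma integral_normalN_signed (f : R -> R) : measurable_fun [set: R] f ->
  \int[N]_x f (- x) = \int[N]_x f x.
Proof.
move=> mf; rewrite /Rintegral; congr fine; rewrite integralE [RHS]integralE.
have E (g : R -> R) : measurable_fun [set: R] g ->
    (\int[N]_x maxe (g (- x))%:E 0 = \int[N]_x (maxe (g x)%:E 0))%E.
  move=> mg; apply: (@integral_normalN R (fun x => maxe (g x)%:E 0%E)).
    by apply: measurable_maxe => //; exact/measurable_EFinP.
  by move=> x; rewrite le_max lexx orbT.
congr (_ - _)%E.
  under eq_integral do rewrite funeposE.
  by under [RHS]eq_integral do rewrite funeposE; exact: E.
under eq_integral do rewrite funenegE -EFinN.
under [RHS]eq_integral do rewrite funenegE -EFinN.
by rewrite (E (fun x => - f x))//; exact: measurableT_comp.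
Qed.

Lemma catxN n (a : R) (t : 'rV[R]_n) : - catx a t = catx (- a) (- t).
Proof.
by rewrite /catx (opp_row_mx (const_mx a : 'rV[R]_1) t) raddfN.
Qed.

Lemma gaussEN n (F : 'rV[R]_n -> R) : good F ->
  gaussE (fun x => F (- x)) = gaussE F.
Proof.
elim: n F => [|n IH] F gF.
  by rewrite /gaussE; apply: eq_Rintegral => w _; rewrite /= oppr0.
rewrite gaussES; last exact: goodNx.
rewrite gaussES// -[RHS]integral_normalN_signed; last exact: measurable_gaussE_sec.
apply: eq_Rintegral => x _.
under eq_fun do rewrite catxN.
by rewrite (IH (fun t => F (catx (- x) t)))//; exact: good_sec.
Qed.

Lemma is_derive_shift (f : R -> R) (x d : R) :
  is_derive (0 : R) 1 (fun s => f (x + s)) d -> is_derive x 1 f d.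
Proof.
move=> df.
have dg : is_derive x 1 (fun y : R => y - x) 1.
  by apply: is_derive_eq; rewrite subr0.
have df' : is_derive (x - x) 1 (fun s => f (x + s)) d by rewrite subrr.
have := @is_derive1_comp _ (fun s => f (x + s)) (fun y : R => y - x) x _ _ df' dg.
rewrite mulr1; congr (is_derive _ _ _ _).
by apply/funext => y /=; rewrite subrKC.
Qed.

Lemma catx_delta0 n (a s : R) (t : 'rV[R]_n) (j : 'I_1) :
  catx a t + s *: delta_mx ord0 (lshift n j) = catx (a + s) t.
Proof.
apply/rowP => i.
have -> : (catx a t + s *: delta_mx ord0 (lshift n j)) ord0 i =
    catx a t ord0 i + s * (i == lshift n j)%:R.
  by rewrite [LHS]mxE; congr (_ + _); rewrite !mxE eqxx.
case: (split_ordP (i : 'I_(1 + n))) => l ->.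
  by rewrite !catx0 !ord1 eqxx mulr1.
by rewrite !catxS -val_eqE /= (ord1 j) mulr0 addr0.
Qed.

Lemma catx_deltaS n (a s : R) (t : 'rV[R]_n) (j : 'I_n) :
  catx a t + s *: delta_mx ord0 (rshift 1 j) = catx a (t + s *: delta_mx ord0 j).
Proof.
apply/rowP => i.
have -> : (catx a t + s *: delta_mx ord0 (rshift 1 j)) ord0 i =
    catx a t ord0 i + s * (i == rshift 1 j)%:R.
  by rewrite [LHS]mxE; congr (_ + _); rewrite !mxE eqxx.
case: (split_ordP (i : 'I_(1 + n))) => l ->.
  by rewrite !catx0 -val_eqE /= (ord1 l) mulr0 addr0.
by rewrite !catxS -val_eqE /= !mxE eqxx.
Qed.

Definition partial n (i : 'I_n) (F F' : 'rV[R]_n -> R) : Prop :=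
  forall x, is_derive (0 : R) 1 (fun s : R => F (x + s *: delta_mx ord0 i)) (F' x).

Definition line_continuous n (i : 'I_n) (F : 'rV[R]_n -> R) : Prop :=
  forall x, continuous (fun s : R => F (x + s *: delta_mx ord0 i)).

Lemma gauss_ibp n (i : 'I_n) (F F' : 'rV[R]_n -> R) : good F -> good F' ->
  partial i F F' -> line_continuous i F' ->
  gaussE F' = gaussE (fun x => x ord0 i * F x).
Proof.
elim: n i F F' => [|n IH] i F F' gF gF' dF cF'; first by case: i dF cF'.
have gxF : good (fun x : 'rV[R]_n.+1 => x ord0 i * F x).
  by apply: goodM => //; exact: good_coord.
case: (split_ordP (i : 'I_(1 + n))) dF cF' gxF => j -> dF cF' gxF; last first.
  rewrite !gaussES//; apply: eq_Rintegral => x _.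
  rewrite (IH j (fun t => F (catx x t)) (fun t => F' (catx x t))).
  - by congr gaussE; apply/funext => t; rewrite catxS.
  - exact: good_sec.
  - exact: good_sec.
  - move=> t; have := dF (catx x t).
    by under eq_fun do rewrite catx_deltaS.
  - move=> t; have := cF' (catx x t).
    by under eq_fun do rewrite catx_deltaS.
rewrite !gaussES2//; apply: eq_Rintegral => w _.
under [RHS]eq_Rintegral do rewrite catx0.
have [k1 F1] := growth_sec0 (gs_X w) gF.
have [k2 F2] := growth_sec0 (gs_X w) gF'.
apply: (@normal_ibp R (fun x => F (catx x (gs_X w))) (fun x => F' (catx x (gs_X w)))
  (Num.max k1 k2)).
- move=> x; apply: is_derive_shift.
  have := dF (catx x (gs_X w)).
  by under eq_fun do rewrite catx_delta0.
- have := cF' (catx 0 (gs_X w)).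
  under eq_fun do rewrite catx_delta0 add0r.
  by [].
- move=> x; rewrite (le_trans (F1 x))// ler_expR ler_wpM2r ?addr_ge0//.
  by rewrite le_max lexx.
- move=> x; rewrite (le_trans (F2 x))// ler_expR ler_wpM2r ?addr_ge0//.
  by rewrite le_max lexx orbT.
Qed.

Lemma gauss_density_cat n (a : R) (t : 'rV[R]_n) :
  gauss_density (catx a t) = pdf a * gauss_density t.
Proof.
rewrite normal_pdf01 /gauss_density.
have -> : sqnorm (catx a t) = a ^+ 2 + sqnorm t.
  rewrite /sqnorm (@big_split_ord _ _ _ 1 n) /= big_ord1 catx0; congr (_ + _).
  by apply: eq_bigr => i _; rewrite catxS.
have p0 : (0 : R) < pi *+ 2 by rewrite mulrn_wgt0// pi_gt0.
have -> : (pi *+ 2 : R) `^ (- (n.+1%:R / 2)) =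
    (Num.sqrt (pi *+ 2))^-1 * (pi *+ 2) `^ (- (n%:R / 2)).
  rewrite -natr1 mulrDl opprD addrC powRD; last first.
    by rewrite (gt_eqF p0) /= implybT.
  by rewrite mul1r powRN powR12_sqrt// ltW.
have -> : - ((a ^+ 2 + sqnorm t) / 2) = - (a ^+ 2 / 2) + - (sqnorm t / 2).
  by rewrite mulrDl opprD.
by rewrite expRD; ring.
Qed.

(** The bridge from the iterated Lebesgue integral to the probability space; the density splits off
    one coordinate at a time. *)
Lemma leb_int_gaussE n (F : 'rV[R]_n -> R) : good F -> (forall x, 0 <= F x) ->
  leb_int (fun x => (F x * gauss_density x)%:E) = (gaussE F)%:E.
Proof.
elim: n F => [|n IH] F gF F0.
  rewrite (_ : gaussE F = F 0); last first.
    by rewrite -[RHS](@gaussE_cst 0 (F 0)); exact: eq_Rintegral.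
  rewrite /= /gauss_density /sqnorm big_ord0 !mul0r oppr0 powRr0 expR0.
  by rewrite !mulr1.
rewrite /=.
transitivity (\int[mu]_x (gaussE (fun t : 'rV[R]_n => F (catx x t)) * pdf x)%:E)%E.
  apply: eq_integral => x _.
  rewrite mulrC -gaussEZ; last exact: good_sec.
  rewrite -IH.
  - by congr leb_int; apply/funext => t; rewrite -/(catx x t) gauss_density_cat mulrA (mulrC (pdf x)).
  - by apply: goodZ; exact: good_sec.
  - by move=> t; rewrite mulr_ge0// normal_pdf_ge0.
rewrite gaussES//.
under eq_integral do rewrite EFinM.
rewrite -integral_normal; last 2 first.
- by apply/measurable_EFinP; exact: measurable_gaussE_sec.
- by move=> x; rewrite lee_fin; exact: gaussE_ge0.
rewrite /Rintegral fineK// ge0_fin_numE; last first.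
  by apply: integral_ge0 => x _; rewrite lee_fin; exact: gaussE_ge0.
have := integrable_fubini_F (m1 := N) (m2 := gs_P (gauss_space n)) (good_integrable gF).
move/integrableP => [_]; apply: le_lt_trans.
rewrite le_eqVlt; apply/orP; left; apply/eqP; apply: eq_integral => x _.
rewrite [X in `|X|%E](_ : _ = (gaussE (fun t => F (catx x t)))%:E); last first.
  by rewrite gaussE_fin//; exact: good_sec.
by rewrite gee0_abs// lee_fin; exact: gaussE_ge0.
Qed.

(** The integral of a nonnegative function is a supremum over the simple functions below it, so
    monotonicity holds without measurability. Indicators of general convex sets are compared in this
    way. *)
Let ge0_le_integral_nonmeas (f g : R -> \bar R) : (forall x, 0 <= f x)%E ->
  (forall x, f x <= g x)%E -> (\int[mu]_x f x <= \int[mu]_x g x)%E.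
Proof.
move=> f0 fg.
have g0 x : (0 <= g x)%E by exact: le_trans (fg x).
rewrite !ge0_integralTE//; apply: le_ereal_sup => _ /= [h hf <-].
by exists h => // x; exact: le_trans (hf x) (fg x).
Qed.

Lemma leb_int_ge0 n (f : 'rV[R]_n -> \bar R) : (forall x, 0 <= f x)%E ->
  (0 <= leb_int f)%E.
Proof. by elim: n f => [|n IH] f f0 //=; apply: integral_ge0 => x _; exact: IH. Qed.

Lemma le_leb_int n (f g : 'rV[R]_n -> \bar R) : (forall x, 0 <= f x)%E ->
  (forall x, f x <= g x)%E -> (leb_int f <= leb_int g)%E.
Proof.
elim: n f g => [|n IH] f g f0 fg //=.
apply: ge0_le_integral_nonmeas => x; first exact: leb_int_ge0.
exact: IH.
Qed.

End gauss_space.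

(** * Differentiation under the expectation and calculus of partial derivatives *)

Section nice_functions.
Context {R : realType} {n : nat}.
Implicit Types (F G : 'rV[R]_n -> R).

Lemma gaussE_derive (f f' : R -> 'rV[R]_n -> R) (G : 'rV[R]_n -> R) (u v a : R) :
  u < a < v ->
  (forall t, u < t < v -> good (f t)) ->
  (forall t x, u < t < v -> is_derive t 1 (f ^~ x) (f' t x)) ->
  good G -> (forall t x, u < t < v -> `|f' t x| <= G x) ->
  is_derive a 1 (fun t => gaussE (f t)) (gaussE (f' a)).
Proof.
move=> uav gf df gG f'G.
have Ia : (`]u, v[%classic : set R) a by rewrite /= in_itv.
have G0 x : 0 <= G x by rewrite (le_trans _ (f'G _ x uav)).
have intf t : (`]u, v[%classic : set R) t ->
    (gs_P (gauss_space n)).-integrable setT (EFin \o (fun w => f t (gs_X w))).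
  by rewrite /= in_itv /= => tI; apply: good_integrable; exact: gf.
have derf t y : (`]u, v[%classic : set R) t -> [set: gs_T (gauss_space n)] y ->
    derivable (fun t => f t (gs_X y)) t 1.
  by rewrite /= in_itv /= => tI _; have := df t (gs_X y) tI.
have d1E t y : (`]u, v[%classic : set R) t ->
    partial1of2 (fun t w => f t (gs_X w)) t y = f' t (gs_X y).
  rewrite /= in_itv /= => tI; rewrite partial1of2E.
  by have := df t (gs_X y) tI => -[].
have Gub t y : (`]u, v[%classic : set R) t -> [set: gs_T (gauss_space n)] y ->
    `|partial1of2 (fun t w => f t (gs_X w)) t y| <= G (gs_X y).
  by move=> tI _; rewrite d1E//; move: tI; rewrite /= in_itv /=; exact: f'G.
have D := @derivable_under_integral _ _ _ (gs_P (gauss_space n))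
  (fun t w => f t (gs_X w)) setT measurableT a u v Ia intf derf
  (fun w => G (gs_X w)) (fun w => G0 _) (good_integrable gG) Gub.
have E := @differentiation_under_integral _ _ _ (gs_P (gauss_space n))
  (fun t w => f t (gs_X w)) setT measurableT a u v Ia intf derf
  (fun w => G (gs_X w)) (fun w => G0 _) (good_integrable gG) Gub.
apply: DeriveDef; first exact: D.
rewrite -derive1E [LHS]E; apply: eq_Rintegral => w _.
exact: d1E.
Qed.

(** Continuity along lines suffices for the fundamental theorem of calculus in each coordinate, and
    it reduces continuity proofs to one real variable. *)
Definition lcont F := forall x v, continuous (fun s : R => F (x + s *: v)).
Definition nice F := good F /\ lcont F.

Lemma nice_good F : nice F -> good F. Proof. by case. Qed.

Lemma nice_cst (c : R) : nice (fun=> c).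
Proof. by split; [exact: good_cst|move=> x v s; exact: cvg_cst]. Qed.

Lemma nice_coord i : nice (fun x => x ord0 i).
Proof.
split; first exact: good_coord.
move=> x v s; under eq_fun do rewrite !mxE.
apply: cvgD; first exact: cvg_cst.
apply: cvgM; [exact: cvg_id|exact: cvg_cst].
Qed.

Lemma niceD F G : nice F -> nice G -> nice (fun x => F x + G x).
Proof.
move=> [gF cF] [gG cG]; split; first exact: goodD.
by move=> x v s; apply: cvgD; [exact: cF|exact: cG].
Qed.

Lemma niceM F G : nice F -> nice G -> nice (fun x => F x * G x).
Proof.
move=> [gF cF] [gG cG]; split; first exact: goodM.
by move=> x v s; apply: cvgM; [exact: cF|exact: cG].
Qed.

Lemma niceN F : nice F -> nice (fun x => - F x).
Proof.
move=> [gF cF]; split; first exact: goodN.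
by move=> x v s; apply: cvgN; exact: cF.
Qed.

Lemma niceB F G : nice F -> nice G -> nice (fun x => F x - G x).
Proof. by move=> nF nG; apply: niceD => //; exact: niceN. Qed.

Lemma niceX F (m : nat) : nice F -> nice (fun x => F x ^+ m).
Proof.
move=> nF; elim: m => [|m IH].
  by under eq_fun do rewrite expr0; exact: nice_cst.
by under eq_fun do rewrite exprS; exact: niceM.
Qed.

Lemma nice_sum (I : Type) (r : seq I) (P : pred I) (F : I -> 'rV[R]_n -> R) :
  (forall i, nice (F i)) -> nice (fun x => \sum_(i <- r | P i) F i x).
Proof.
move=> nF; elim: r => [|i r IH].
  by under eq_fun do rewrite big_nil; exact: nice_cst.
under eq_fun do rewrite big_cons.
by case: (P i); [exact: (niceD (nF i) IH)|exact: IH].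
Qed.

Lemma nice_comp (g : R -> R) F (c : R) : continuous g -> (forall x, `|g (F x)| <= c) ->
  nice F -> nice (fun x => g (F x)).
Proof.
move=> cg gc [[mF _] cF]; split.
  apply: (good_bounded _ gc); apply: mfun_comp => //.
  exact: continuous_measurable_fun.
by move=> x v s; apply: (cvg_comp _ g); [exact: cF|exact: cg].
Qed.

Lemma partial_cst i (c : R) : partial i (fun _ : 'rV[R]_n => c) (fun=> 0).
Proof. by move=> x; exact: is_derive_cst. Qed.

Lemma partial_coord i j :
  partial i (fun x : 'rV[R]_n => x ord0 j) (fun=> (j == i)%:R).
Proof.
move=> x; under eq_fun do rewrite !mxE eqxx /=.
by apply: is_derive_eq; rewrite /GRing.scale/=; ring.
Qed.

Lemma partialD i F F' G G' : partial i F F' -> partial i G G' ->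
  partial i (fun x => F x + G x) (fun x => F' x + G' x).
Proof. by move=> dF dG x; have := dF x; have := dG x => *; exact: is_deriveD. Qed.

Lemma partialN i F F' : partial i F F' -> partial i (fun x => - F x) (fun x => - F' x).
Proof. by move=> dF x; have := dF x => *; exact: is_deriveN. Qed.

Lemma partialB i F F' G G' : partial i F F' -> partial i G G' ->
  partial i (fun x => F x - G x) (fun x => F' x - G' x).
Proof. by move=> dF dG; apply: partialD => //; exact: partialN. Qed.

Lemma partialM i F F' G G' : partial i F F' -> partial i G G' ->
  partial i (fun x => F x * G x) (fun x => F' x * G x + F x * G' x).
Proof.
move=> dF dG x; have h1 := dF x; have h2 := dG x.
apply: is_derive_eq; rewrite /= scale0r addr0 /GRing.scale/=; ring.
Qed.

Lemma partialZ i (c : R) F F' : partial i F F' ->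
  partial i (fun x => c * F x) (fun x => c * F' x).
Proof.
move=> dF x; have h1 := dF x.
by apply: is_derive_eq; rewrite /GRing.scale/=; ring.
Qed.

Lemma partial_sum i (I : Type) (r : seq I) (P : pred I) (F F' : I -> 'rV[R]_n -> R) :
  (forall k, partial i (F k) (F' k)) ->
  partial i (fun x => \sum_(k <- r | P k) F k x) (fun x => \sum_(k <- r | P k) F' k x).
Proof.
move=> dF; elim: r => [|k r IH] x.
  by rewrite big_nil; under eq_fun do rewrite big_nil; exact: is_derive_cst.
rewrite big_cons; under eq_fun do rewrite big_cons.
by case: (P k); [exact: (partialD (dF k) IH x)|exact: IH].
Qed.

Lemma partial_comp i (g g' : R -> R) F F' :
  (forall y : R, is_derive y 1 g (g' y)) -> partial i F F' ->
  partial i (fun x => g (F x)) (fun x => g' (F x) * F' x).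
Proof.
move=> dg dF x; have h1 := dF x.
have h2 : is_derive (F (x + 0 *: delta_mx ord0 i)) 1 g (g' (F x)).
  by have := dg (F x); rewrite scale0r addr0.
exact: (@is_derive1_comp _ g (fun s : R => F (x + s *: delta_mx ord0 i)) 0 _ _ h2 h1).
Qed.

Lemma gaussE_ibp i F F' : nice F -> nice F' -> partial i F F' ->
  gaussE F' = gaussE (fun x => x ord0 i * F x).
Proof.
move=> [gF _] [gF' cF'] dF; apply: (gauss_ibp gF gF' dF).
by move=> x; exact: cF'.
Qed.

End nice_functions.

(** * Polynomials as formal expressions *)

Section polynomials.
Context {R : realType} {n : nat}.

(** Formal expressions make the class visibly closed under derivatives, with [pd] a computation.
    Identities between them hold only after evaluation by [pe]; uniqueness of derivatives carries
    such identities over to [pd]. *)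
Inductive pexp : Type :=
  | PC of R
  | PX of 'I_n
  | PA of pexp & pexp
  | PM of pexp & pexp.

Fixpoint pe (p : pexp) (x : 'rV[R]_n) : R :=
  match p with
  | PC c => c
  | PX i => x ord0 i
  | PA a b => pe a x + pe b x
  | PM a b => pe a x * pe b x
  end.

Fixpoint pd (i : 'I_n) (p : pexp) : pexp :=
  match p with
  | PC _ => PC 0
  | PX j => PC (j == i)%:R
  | PA a b => PA (pd i a) (pd i b)
  | PM a b => PA (PM (pd i a) b) (PM a (pd i b))
  end.

Lemma nice_pe p : nice (pe p).
Proof.
elim: p => [c|i|a IHa b IHb|a IHa b IHb] /=.
- exact: nice_cst.
- exact: nice_coord.
- exact: niceD.
- exact: niceM.
Qed.

Lemma partial_pe i p : partial i (pe p) (pe (pd i p)).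
Proof.
elim: p => [c|j|a IHa b IHb|a IHa b IHb] /=.
- exact: partial_cst.
- exact: partial_coord.
- exact: partialD.
- exact: partialM.
Qed.

Lemma pdC i j p x : pe (pd i (pd j p)) x = pe (pd j (pd i p)) x.
Proof.
elim: p => [c|k|a IHa b IHb|a IHa b IHb] //=.
- by rewrite IHa IHb.
- by rewrite IHa IHb; ring.
Qed.

Definition psum (I : Type) (r : seq I) (f : I -> pexp) : pexp :=
  foldr (fun i p => PA (f i) p) (PC 0) r.

Lemma pe_sum I (r : seq I) (f : I -> pexp) x :
  pe (psum r f) x = \sum_(i <- r) pe (f i) x.
Proof.
elim: r => [|i r IH] /=; first by rewrite big_nil.
by rewrite big_cons IH.
Qed.

Lemma pd_sum k I (r : seq I) (f : I -> pexp) x :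
  pe (pd k (psum r f)) x = \sum_(i <- r) pe (pd k (f i)) x.
Proof.
elim: r => [|i r IH] /=; first by rewrite big_nil.
by rewrite big_cons IH.
Qed.

Fixpoint pneg (p : pexp) : pexp :=
  match p with
  | PC c => PC c
  | PX i => PM (PC (-1)) (PX i)
  | PA a b => PA (pneg a) (pneg b)
  | PM a b => PM (pneg a) (pneg b)
  end.

Lemma pe_neg p x : pe (pneg p) x = pe p (- x).
Proof.
elim: p => [c|i|a IHa b IHb|a IHa b IHb] //=.
- by rewrite mxE mulN1r.
- by rewrite IHa IHb.
- by rewrite IHa IHb.
Qed.

Lemma pd_neg i p x : pe (pd i (pneg p)) x = - pe (pd i p) (- x).
Proof.
elim: p => [c|k|a IHa b IHb|a IHa b IHb] //=.
- by rewrite oppr0.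
- by rewrite mul0r add0r mulN1r.
- by rewrite IHa IHb opprD.
- by rewrite IHa IHb !pe_neg; ring.
Qed.

End polynomials.

(** * Log-concave weights and the Bochner formula *)

Section potential.
Context {R : realType} {n : nat}.

(** [W] is minus the logarithm of the weight relative to the Gaussian, so [pot_psd] says that the
    weight is log-concave. *)
Record potential (W : 'rV[R]_n -> R) (W1 : 'I_n -> 'rV[R]_n -> R)
    (W2 : 'I_n -> 'I_n -> 'rV[R]_n -> R) : Prop := Potential {
  pot_ge0 : forall x, 0 <= W x ;
  pot_mfun : mfun W ;
  pot_lcont : lcont W ;
  pot1_nice : forall i, nice (W1 i) ;
  pot2_nice : forall i j, nice (W2 i j) ;
  pot_d1 : forall i, partial i W (W1 i) ;
  pot_d2 : forall i j, partial j (W1 i) (W2 i j) ;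
  pot_psd : forall x (v : 'I_n -> R), 0 <= \sum_i \sum_j W2 i j x * v i * v j }.

Variables (W : 'rV[R]_n -> R) (W1 : 'I_n -> 'rV[R]_n -> R)
  (W2 : 'I_n -> 'I_n -> 'rV[R]_n -> R).
Hypothesis pot : potential W W1 W2.
Let W_ge0 := pot_ge0 pot.
Let W_mfun := pot_mfun pot.
Let W_lcont := pot_lcont pot.
Let W1_nice := pot1_nice pot.
Let W2_nice := pot2_nice pot.
Let dW := pot_d1 pot.
Let dW1 := pot_d2 pot.
Let W2_psd := pot_psd pot.

Implicit Types (F G : 'rV[R]_n -> R) (s : R).

(** The scale [s] is the continuation parameter: at 0 the weight is constant and the operator is
    that of Ornstein-Uhlenbeck, at 1 it is the weight of interest. *)
Definition wt s (x : 'rV[R]_n) : R := expR (- (s * W x)).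

(** Deliberately not normalised: the mass Z is the value at the constant 1. *)
Definition avg s F : R := gaussE (fun x => wt s x * F x).

Definition Lop s (p : pexp) (x : 'rV[R]_n) : R :=
  \sum_i (pe (pd i (pd i p)) x - (x ord0 i + s * W1 i x) * pe (pd i p) x).

Definition hess2 (p : pexp) (x : 'rV[R]_n) : R :=
  \sum_k \sum_i pe (pd i (pd k p)) x ^+ 2.

Definition grad2 (p : pexp) (x : 'rV[R]_n) : R := \sum_k pe (pd k p) x ^+ 2.

Definition hessW (p : pexp) (x : 'rV[R]_n) : R :=
  \sum_i \sum_j W2 i j x * pe (pd i p) x * pe (pd j p) x.

Section fixed_scale.
Variable s : R.
Hypothesis s_ge0 : 0 <= s.

Lemma wt_gt0 x : 0 < wt s x. Proof. exact: expR_gt0. Qed.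

Lemma wt_le1 x : wt s x <= 1.
Proof. by rewrite /wt -expR0 ler_expR lerNl oppr0 mulr_ge0. Qed.

Lemma nice_wt : nice (wt s).
Proof.
split.
  apply: (@good_bounded _ _ 1).
    apply: (mfun_comp (g := fun y => expR (- (s * y)))) => //.
    by apply: measurableT_comp => //; apply: measurableT_comp => //; exact: measurable_funM.
  by move=> x; rewrite ger0_norm ?wt_le1// ltW// wt_gt0.
move=> x v t; apply: (cvg_comp _ expR); last exact: continuous_expR.
apply: cvgN; apply: cvgM; [exact: cvg_cst|exact: W_lcont].
Qed.

Lemma partial_wt i : partial i (wt s) (fun x => - (s * W1 i x) * wt s x).
Proof.
have h := @partial_comp R n i expR expR _ _ (@is_derive_expR R)
  (partialN (partialZ s (@dW i))).
move=> x; have := h x; congr is_derive.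
by rewrite /= mulrC.
Qed.

Lemma avgD F G : nice F -> nice G -> avg s (fun x => F x + G x) = avg s F + avg s G.
Proof.
move=> nF nG; rewrite /avg -gaussED; last 2 first.
- by apply/nice_good/niceM => //; exact: nice_wt.
- by apply/nice_good/niceM => //; exact: nice_wt.
by congr gaussE; apply/funext => x; rewrite mulrDr.
Qed.

Lemma avgZ (c : R) F : nice F -> avg s (fun x => c * F x) = c * avg s F.
Proof.
move=> nF; rewrite /avg -gaussEZ; last by apply/nice_good/niceM => //; exact: nice_wt.
by congr gaussE; apply/funext => x; rewrite mulrCA.
Qed.

Lemma avgN F : nice F -> avg s (fun x => - F x) = - avg s F.
Proof.
move=> nF; rewrite -mulN1r -avgZ//.
by congr (avg s); apply/funext => x; rewrite mulN1r.
Qed.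

Lemma avgB F G : nice F -> nice G -> avg s (fun x => F x - G x) = avg s F - avg s G.
Proof. by move=> nF nG; rewrite avgD ?avgN//; exact: niceN. Qed.

Lemma avg_sum (I : Type) (r : seq I) (F : I -> 'rV[R]_n -> R) :
  (forall i, nice (F i)) ->
  avg s (fun x => \sum_(i <- r) F i x) = \sum_(i <- r) avg s (F i).
Proof.
move=> nF; rewrite /avg -gaussE_sum; last first.
  by move=> i; apply/nice_good/niceM => //; exact: nice_wt.
by congr gaussE; apply/funext => x; rewrite mulr_sumr.
Qed.

Lemma avg_le F G : nice F -> nice G -> (forall x, F x <= G x) -> avg s F <= avg s G.
Proof.
move=> nF nG FG; apply: gaussE_le.
- by apply/nice_good/niceM => //; exact: nice_wt.
- by apply/nice_good/niceM => //; exact: nice_wt.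
by move=> x; rewrite ler_wpM2l// ltW// wt_gt0.
Qed.

Lemma avg_ge0 F : (forall x, 0 <= F x) -> 0 <= avg s F.
Proof. by move=> F0; apply: gaussE_ge0 => x; rewrite mulr_ge0// ltW// wt_gt0. Qed.

Lemma avg_ibp i F F' : nice F -> nice F' -> partial i F F' ->
  avg s F' = avg s (fun x => (x ord0 i + s * W1 i x) * F x).
Proof.
move=> nF nF' dF.
have nw := nice_wt.
have nW : nice (fun x => s * W1 i x) by apply: niceM => //; exact: nice_cst.
have := @gaussE_ibp _ _ i _ _ (niceM nw nF) _ (partialM (partial_wt i) dF).
move=> /(_ _)/wrap[].
  apply: niceD; last exact: niceM.
  by apply: niceM => //; apply: niceM => //; exact: niceN.
rewrite gaussED; last 2 first.
- apply/nice_good; apply: niceM => //; apply: niceM => //; exact: niceN.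
- by apply/nice_good; exact: niceM.
rewrite -/(avg s F') => h.
have -> : avg s F' = gaussE (fun x => x ord0 i * (wt s x * F x)) -
    gaussE (fun x => - (s * W1 i x) * wt s x * F x) by rewrite -h addrC addKr.
rewrite -gaussEB; last 2 first.
- apply/nice_good; apply: niceM; first exact: nice_coord.
  exact: niceM.
- apply/nice_good; apply: niceM => //; apply: niceM => //; exact: niceN.
by congr gaussE; apply/funext => x; ring.
Qed.

Lemma nice_drift i : nice (fun x => x ord0 i + s * W1 i x).
Proof.
apply: niceD; first exact: nice_coord.
by apply: niceM => //; exact: nice_cst.
Qed.

Lemma nice_Lop p : nice (Lop s p).
Proof.
apply: nice_sum => i; apply: niceB; first exact: nice_pe.
apply: niceM; [exact: nice_drift|exact: nice_pe].
Qed.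

Lemma avg_Lop F (F' : 'I_n -> 'rV[R]_n -> R) p : nice F -> (forall i, nice (F' i)) ->
  (forall i, partial i F (F' i)) ->
  avg s (fun x => F x * Lop s p x) = - avg s (fun x => \sum_i F' i x * pe (pd i p) x).
Proof.
move=> nF nF' dF.
have nD i : nice (fun x => (x ord0 i + s * W1 i x) * (F x * pe (pd i p) x)).
  by apply: niceM; [exact: nice_drift|apply: niceM => //; exact: nice_pe].
have nA i : nice (fun x => F' i x * pe (pd i p) x).
  by apply: niceM => //; exact: nice_pe.
have nB i : nice (fun x => F x * pe (pd i (pd i p)) x).
  by apply: niceM => //; exact: nice_pe.
transitivity (\sum_i (avg s (fun x => F x * pe (pd i (pd i p)) x) -
    avg s (fun x => (x ord0 i + s * W1 i x) * (F x * pe (pd i p) x)))).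
  rewrite -(eq_bigr _ (fun i _ => avgB (nB i) (nD i))) -avg_sum.
    by congr (avg s); apply/funext => x; rewrite mulr_sumr; apply: eq_bigr => i _; ring.
  by move=> i; exact: niceB.
rewrite avg_sum// -sumrN; apply: eq_bigr => i _.
rewrite -(@avg_ibp i _ (fun x => F' i x * pe (pd i p) x + F x * pe (pd i (pd i p)) x)).
- by rewrite avgD// opprD addrCA subrr addr0.
- by apply: niceM => //; exact: nice_pe.
- exact: niceD.
- by apply: partialM => //; exact: partial_pe.
Qed.

Lemma avg_Lop0 p : avg s (Lop s p) = 0.
Proof.
have h := @avg_Lop (fun=> 1) (fun _ _ => 0) p (nice_cst 1) (fun=> nice_cst 0)
  (fun i => @partial_cst R n i 1).
transitivity (avg s (fun x => 1 * Lop s p x)).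
  by congr (avg s); apply/funext => x; rewrite mul1r.
have h0 x : \sum_i 0 * pe (pd i p) x = 0 by rewrite big1// => i _; rewrite mul0r.
by rewrite h /avg; under eq_fun do rewrite h0 mulr0; rewrite gaussE_cst oppr0.
Qed.

Lemma partial_Lop k p : partial k (Lop s p) (fun x =>
  Lop s (pd k p) x - pe (pd k p) x - \sum_i s * W2 i k x * pe (pd i p) x).
Proof.
have dL : partial k (Lop s p) (fun x => \sum_i (pe (pd k (pd i (pd i p))) x -
    (((i == k)%:R + s * W2 i k x) * pe (pd i p) x +
     (x ord0 i + s * W1 i x) * pe (pd k (pd i p)) x))).
  apply: partial_sum => i; apply: partialB; first exact: partial_pe.
  apply: partialM; last exact: partial_pe.
  by apply: partialD; [exact: partial_coord|apply: partialZ].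
move=> x; have := dL x; congr is_derive.
rewrite /Lop -[in X in _ - X - _](mul1r (pe (pd k p) x)).
have -> : 1 * pe (pd k p) x = \sum_i (i == k)%:R * pe (pd i p) x.
  rewrite (bigD1 k)//= eqxx big1 ?addr0// => i /negbTE ->.
  by rewrite mul0r.
rewrite -!sumrB; apply: eq_bigr => i _.
rewrite (pdC k i p) (pdC k i (pd i p)).
(* [pdC] holds only after evaluation, so it reaches the inner derivatives through uniqueness of
   derivatives. *)
have -> : pe (pd i (pd k (pd i p))) x = pe (pd i (pd i (pd k p))) x.
  have /funext h : pe (pd k (pd i p)) =1 pe (pd i (pd k p)) by move=> y; exact: pdC.
  have d1 := @partial_pe R n i (pd k (pd i p)) x.
  have d2 := @partial_pe R n i (pd i (pd k p)) x.
  rewrite h in d1.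
  by rewrite -(@derive_val _ _ _ _ _ _ _ d1) -(@derive_val _ _ _ _ _ _ _ d2).
by ring.
Qed.

Lemma nice_hess2 p : nice (hess2 p).
Proof. by apply: nice_sum => k; apply: nice_sum => i; apply: niceX; exact: nice_pe. Qed.

Lemma nice_grad2 p : nice (grad2 p).
Proof. by apply: nice_sum => k; apply: niceX; exact: nice_pe. Qed.

Lemma nice_hessW p : nice (hessW p).
Proof.
apply: nice_sum => k; apply: nice_sum => i.
by apply: niceM; [apply: niceM => //|]; exact: nice_pe.
Qed.

(** Pair L p with itself and integrate by parts once: d_k L p is L d_k p minus a commutator, whose
    Gaussian part gives [grad2] and whose potential part gives [hessW]. *)
Lemma bochner p :
  avg s (fun x => Lop s p x ^+ 2) =
  avg s (hess2 p) + avg s (grad2 p) + s * avg s (hessW p).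
Proof.
have nW k i : nice (fun x => s * W2 i k x * pe (pd i p) x).
  by apply: niceM; [apply: niceM => //; exact: nice_cst|exact: nice_pe].
have nV k : nice (fun x => \sum_i s * W2 i k x * pe (pd i p) x).
  by apply: nice_sum => i; exact: nW.
have nLk k : nice (fun x => Lop s (pd k p) x - pe (pd k p) x -
    \sum_i s * W2 i k x * pe (pd i p) x).
  apply: niceB => //; apply: niceB; [exact: nice_Lop|exact: nice_pe].
transitivity (avg s (fun x => Lop s p x * Lop s p x)).
  by congr (avg s); apply/funext => x; rewrite expr2.
rewrite (avg_Lop p (nice_Lop p) nLk (fun k => partial_Lop k p)).
have n1 k : nice (fun x => pe (pd k p) x * Lop s (pd k p) x).
  by apply: niceM; [exact: nice_pe|exact: nice_Lop].
have n2 k : nice (fun x => pe (pd k p) x ^+ 2) by apply: niceX; exact: nice_pe.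
have n3 k : nice (fun x => (\sum_i s * W2 i k x * pe (pd i p) x) * pe (pd k p) x).
  by apply: niceM => //; exact: nice_pe.
have n12 k : nice (fun x => pe (pd k p) x * Lop s (pd k p) x - pe (pd k p) x ^+ 2).
  exact: niceB.
transitivity (- \sum_k (avg s (fun x => pe (pd k p) x * Lop s (pd k p) x) -
    avg s (fun x => pe (pd k p) x ^+ 2) -
    avg s (fun x => (\sum_i s * W2 i k x * pe (pd i p) x) * pe (pd k p) x))).
  congr (- _).
  rewrite -(eq_bigr _ (fun k _ => congr1 (fun y => y - _) (avgB (n1 k) (n2 k)))).
  rewrite -(eq_bigr _ (fun k _ => avgB (n12 k) (n3 k))) -avg_sum.
    congr (avg s); apply/funext => x; apply: eq_bigr => k _; ring.
  by move=> k; exact: niceB.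
rewrite !sumrB.
have -> : \sum_k avg s (fun x => pe (pd k p) x * Lop s (pd k p) x) = - avg s (hess2 p).
  rewrite /hess2 avg_sum; last first.
    by move=> k; apply: nice_sum => i; apply: niceX; exact: nice_pe.
  rewrite -sumrN; apply: eq_bigr => k _.
  rewrite (avg_Lop _ (nice_pe _) (fun i => nice_pe (pd i (pd k p)))
    (fun i => partial_pe i (pd k p))).
  by congr (- avg s _); apply/funext => x; apply: eq_bigr => i _; rewrite expr2.
have -> : \sum_k avg s (fun x => (\sum_i s * W2 i k x * pe (pd i p) x) * pe (pd k p) x) =
    s * avg s (hessW p).
  rewrite -avg_sum//.
  rewrite -avgZ; last exact: nice_hessW.
  congr (avg s); apply/funext => x; rewrite /hessW exchange_big mulr_sumr /=.
  apply: eq_bigr => k _; rewrite mulr_sumr mulr_suml.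
  by apply: eq_bigr => i _; ring.
rewrite -(avg_sum _ n2) -/(grad2 p); ring.
Qed.

(** Convexity of [W] makes the constant 1 independent of [s], which gives the continuation steps a
    common length. *)
Lemma grad2_le p : avg s (grad2 p) <= avg s (fun x => Lop s p x ^+ 2).
Proof.
rewrite bochner.
have h1 : 0 <= avg s (hess2 p).
  by apply: avg_ge0 => x; apply: sumr_ge0 => k _; apply: sumr_ge0 => i _; exact: sqr_ge0.
have h2 : 0 <= s * avg s (hessW p).
  by rewrite mulr_ge0//; apply: avg_ge0 => x; exact: W2_psd.
by rewrite -addrA addrCA lerDl addr_ge0.
Qed.

End fixed_scale.
End potential.

(** * Density of the range of the drift Laplacian *)

Section monomials.
Context {R : realType} {n : nat}.
Local Notation pexp := (@pexp R n).

Lemma pe_ext (p q : pexp) : pe p =1 pe q -> forall i, pe (pd i p) =1 pe (pd i q).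
Proof.
move=> /funext h i x.
have d1 := @partial_pe R n i p x; have d2 := @partial_pe R n i q x.
rewrite h in d1.
by rewrite -(@derive_val _ _ _ _ _ _ _ d1) -(@derive_val _ _ _ _ _ _ _ d2).
Qed.

Definition pm (s : seq 'I_n) : pexp := foldr (fun i p => PM (PX i) p) (PC 1) s.

Definition pspan (l : seq (R * seq 'I_n)) : pexp := psum l (fun t => PM (PC t.1) (pm t.2)).

Lemma pe_span l x : pe (pspan l) x = \sum_(t <- l) t.1 * pe (pm t.2) x.
Proof. exact: pe_sum. Qed.

(** Degree less than [d], expressed through evaluation because a formal expression has no canonical
    degree. *)
Definition spn (d : nat) (p : pexp) : Prop :=
  exists2 l : seq (R * seq 'I_n), all (fun t => size t.2 < d)%N l & pe p =1 pe (pspan l).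

Lemma spn_ext d p q : pe p =1 pe q -> spn d p -> spn d q.
Proof. by move=> pq [l ld pl]; exists l => // x; rewrite -pq pl. Qed.

Lemma spnW d e p : (d <= e)%N -> spn d p -> spn e p.
Proof.
move=> de [l ld pl]; exists l => //; apply: sub_all ld => t /= td.
exact: leq_trans de.
Qed.

Lemma spn_pm s : spn (size s).+1 (pm s).
Proof.
exists [:: (1, s)]; first by rewrite /= ltnSn.
by move=> x; rewrite pe_span big_seq1 mul1r.
Qed.

Lemma spn0 d : spn d (PC 0).
Proof. by exists [::] => // x; rewrite pe_span big_nil. Qed.

Lemma spnD d p q : spn d p -> spn d q -> spn d (PA p q).
Proof.
move=> [l ld pl] [m md qm]; exists (l ++ m); first by rewrite all_cat ld md.
by move=> x; rewrite pe_span big_cat /= pl qm !pe_span.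
Qed.

Lemma spnZ d c p : spn d p -> spn d (PM (PC c) p).
Proof.
move=> [l ld pl]; exists [seq (c * t.1, t.2) | t <- l].
  by rewrite all_map; apply: sub_all ld.
move=> x; rewrite pe_span big_map /= pl pe_span mulr_sumr.
by apply: eq_bigr => t _; rewrite mulrA.
Qed.

Lemma spnX d i p : spn d p -> spn d.+1 (PM (PX i) p).
Proof.
move=> [l ld pl]; exists [seq (t.1, i :: t.2) | t <- l].
  by rewrite all_map; apply: sub_all ld.
move=> x; rewrite pe_span big_map /= pl pe_span mulr_sumr.
by apply: eq_bigr => t _; rewrite mulrCA.
Qed.

Lemma spn_sum d (I : Type) (r : seq I) (f : I -> pexp) :
  (forall i, spn d (f i)) -> spn d (psum r f).
Proof.
by move=> sf; elim: r => [|i r IH] /=; [exact: spn0|exact: spnD].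
Qed.

Lemma spn_exists p : exists d, spn d p.
Proof.
elim: p => [c|i|a [d ad] b [e be]|a [d [l _ al]] b [e be]].
- exists 1%N; have := spnZ c (spn_pm [::]); apply: spn_ext => x /=.
  by rewrite mulr1.
- exists 2%N; have := spn_pm [:: i]; apply: spn_ext => x /=.
  by rewrite mulr1.
- exists (maxn d e); apply: spnD.
    by apply: spnW ad; exact: leq_maxl.
  by apply: spnW be; exact: leq_maxr.
suff [m h] : exists m, spn m (PM (pspan l) b).
  by exists m; apply: spn_ext h => x /=; rewrite al.
elim: l {al} => [|t l [m IH]].
  by exists 0%N; apply: spn_ext (spn0 0) => x /=; rewrite mul0r.
have [m' IH'] : exists m', spn m' (PM (pm t.2) b).
  elim: (t.2) => [|i s [m' IH']].
    by exists e; apply: spn_ext be => x /=; rewrite mul1r.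
  by exists m'.+1; apply: spn_ext (spnX i IH') => x /=; rewrite mulrA.
exists (maxn m m').
apply: (@spn_ext _ (PA (PM (PC t.1) (PM (pm t.2) b)) (PM (pspan l) b))).
  by move=> x /=; rewrite mulrDl mulrA.
apply: spnD; first by apply: spnZ; apply: spnW IH'; exact: leq_maxr.
by apply: spnW IH; exact: leq_maxl.
Qed.

Lemma spn_pd_pm i s : spn (size s) (pd i (pm s)).
Proof.
elim: s => [|a s IH] /=; first exact: spn0.
apply: spnD; first exact/spnZ/spn_pm.
exact: spnX.
Qed.

Lemma spn_pd d i p : spn d p -> spn d (pd i p).
Proof.
move=> [l ld pl]; have h := pe_ext pl i.
apply: (@spn_ext _ (pd i (pspan l))); first by move=> x; rewrite h.
elim: l ld {pl h} => [|t l IH] /=; first by move=> _; exact: spn0.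
move=> /andP[td ld]; apply: spnD; last exact: IH.
apply: spnD.
  by apply: (@spn_ext _ (PC 0)); [move=> x /=; rewrite mul0r|exact: spn0].
apply: spnZ; apply: spnW (spn_pd_pm i t.2); exact: ltnW.
Qed.

Lemma euler_pm s (x : 'rV[R]_n) : \sum_i x ord0 i * pe (pd i (pm s)) x = (size s)%:R * pe (pm s) x.
Proof.
elim: s => [|a s IH] /=; first by rewrite mul0r big1// => i _; rewrite mulr0.
transitivity (\sum_i ((a == i)%:R * x ord0 i * pe (pm s) x +
    x ord0 a * (x ord0 i * pe (pd i (pm s)) x))).
  by apply: eq_bigr => i _; ring.
rewrite big_split /= -mulr_sumr IH (bigD1 a)//= eqxx big1 => [|i]; last first.
  by rewrite eq_sym => /negbTE ->; rewrite !mul0r.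
by rewrite mul1r addr0 -natr1; ring.
Qed.

Variable W1 : 'I_n -> 'rV[R]_n -> R.

Lemma Lop_add s (p q : pexp) x : Lop W1 s (PA p q) x = Lop W1 s p x + Lop W1 s q x.
Proof. by rewrite /Lop -big_split /=; apply: eq_bigr => i _; ring. Qed.

Lemma Lop_scale s c (p : pexp) x : Lop W1 s (PM (PC c) p) x = c * Lop W1 s p x.
Proof. by rewrite /Lop mulr_sumr /=; apply: eq_bigr => i _; ring. Qed.

Lemma Lop_cst s c x : Lop W1 s (PC c) x = 0.
Proof. by rewrite /Lop big1// => i _ /=; rewrite mulr0 subr0. Qed.

Definition solvable0 (p : pexp) := exists (u : pexp) (k : R), forall x,
  Lop W1 0 u x = pe p x - k.

Let solvable0_span d : (forall s, (size s < d)%N -> solvable0 (pm s)) ->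
  forall p, spn d p -> solvable0 p.
Proof.
move=> sd p [l ld pl].
suff [u [k h]] : solvable0 (pspan l) by exists u, k => x; rewrite pl h.
elim: l ld {pl} => [_|t l IH] /=.
  by exists (PC 0), 0 => x; rewrite Lop_cst subrr.
move=> /andP[/sd[u [k h]] /IH[v [m g]]].
exists (PA (PM (PC t.1) u) v), (t.1 * k + m) => x.
by rewrite Lop_add Lop_scale h g /=; ring.
Qed.

(* The drift part of the Ornstein-Uhlenbeck operator acts on a monomial of degree d
   as multiplication by -d, by Euler's identity; the Laplacian lowers the degree. *)
Let solvable0_pm d s : (size s < d)%N -> solvable0 (pm s).
Proof.
elim: d s => [//|d IH] s; rewrite ltnS leq_eqVlt => /orP[/eqP sd|]; last exact: IH.
case: (posnP d) => d0.
  exists (PC 0), 1 => x; rewrite Lop_cst.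
  by move: sd; rewrite d0 => /size0nil -> /=; rewrite subrr.
have : spn d (psum (enum 'I_n) (fun i => pd i (pd i (pm s)))).
  by apply: spn_sum => i; apply: spn_pd; rewrite -sd; exact: spn_pd_pm.
move=> /(solvable0_span IH)[u [k h]].
have dn0 : d%:R != 0 :> R by rewrite pnatr_eq0 -lt0n.
exists (PM (PC (- d%:R^-1)) (PA (pm s) (PM (PC (-1)) u))), (k / d%:R) => x.
rewrite Lop_scale Lop_add Lop_scale h pe_sum big_enum /=.
have -> : Lop W1 0 (pm s) x = \sum_i pe (pd i (pd i (pm s))) x - d%:R * pe (pm s) x.
  rewrite -sd -euler_pm -sumrB; apply: eq_bigr => i _.
  by rewrite mul0r addr0.
by field.
Qed.

Lemma solvable0_pexp p : solvable0 p.
Proof.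
have [d pd'] := spn_exists p.
by apply: solvable0_span pd' => s; exact: solvable0_pm.
Qed.

End monomials.

(** * Continuation from the Ornstein-Uhlenbeck operator to the full weight *)

Section solvability.
Context {R : realType} {n : nat}.
Local Notation pexp := (@pexp R n).
Variables (W : 'rV[R]_n -> R) (W1 : 'I_n -> 'rV[R]_n -> R)
  (W2 : 'I_n -> 'I_n -> 'rV[R]_n -> R).
Hypothesis pot : potential W W1 W2.
Variables (I : finType) (q : I -> 'rV[R]_n -> R) (al : 'I_n -> I -> R) (M : R).
Hypothesis q_nice : forall j, nice (q j).
Hypothesis W1E : forall i x, W1 i x = \sum_j al i j * q j x.
Hypothesis M_ge0 : 0 <= M.
Hypothesis W1_le : forall x, \sum_i W1 i x ^+ 2 <= M ^+ 2.
Hypothesis q_dense : forall j (a : pexp) (e : R), 0 < e ->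
  exists r : pexp, gaussE (fun x => (q j x * pe a x - pe r x) ^+ 2) <= e.

Local Notation avg := (avg W).
Local Notation Lop := (Lop W1).

(** The module over polynomials spanned by 1 and the [q j]. The operator is linear in [W1], a
    combination of the [q j], so it maps polynomials into this class; hence the residuals of the
    iteration stay in it, and no products [q i * q j] arise. *)
Definition pbarrier (F : 'rV[R]_n -> R) : Prop :=
  exists (a0 : pexp) (a : I -> pexp), F = fun x => pe a0 x + \sum_j q j x * pe (a j) x.

Lemma nice_pbarrier F : pbarrier F -> nice F.
Proof.
move=> [a0 [a ->]]; apply: niceD; first exact: nice_pe.
by apply: nice_sum => j; apply: niceM => //; exact: nice_pe.
Qed.

Lemma pbarrier_pe p : pbarrier (pe p).
Proof.
exists p, (fun=> PC 0); apply/funext => x.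
by rewrite big1 ?addr0// => j _; rewrite mulr0.
Qed.

Lemma pbarrierD F G : pbarrier F -> pbarrier G -> pbarrier (fun x => F x + G x).
Proof.
move=> [a0 [a ->]] [b0 [b ->]]; exists (PA a0 b0), (fun j => PA (a j) (b j)).
apply/funext => x /=; rewrite addrACA -big_split /=.
by congr (_ + _); apply: eq_bigr => j _; rewrite mulrDr.
Qed.

Lemma pbarrierM F (p : pexp) : pbarrier F -> pbarrier (fun x => F x * pe p x).
Proof.
move=> [a0 [a ->]]; exists (PM a0 p), (fun j => PM (a j) p).
apply/funext => x /=; rewrite mulrDl mulr_suml.
by congr (_ + _); apply: eq_bigr => j _; rewrite mulrA.
Qed.

Lemma pbarrierB F G : pbarrier F -> pbarrier G -> pbarrier (fun x => F x - G x).
Proof.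
move=> cF cG; have := pbarrierD cF (pbarrierM (PC (-1)) cG).
by congr pbarrier; apply/funext => x /=; rewrite mulrN1.
Qed.

Lemma pbarrier_sum (J : Type) (r : seq J) (F : J -> 'rV[R]_n -> R) :
  (forall i, pbarrier (F i)) -> pbarrier (fun x => \sum_(i <- r) F i x).
Proof.
move=> cF; elim: r => [|i r IH].
  by under eq_fun do rewrite big_nil; exact: (pbarrier_pe (PC 0)).
by under eq_fun do rewrite big_cons; exact: pbarrierD.
Qed.

Lemma pbarrier_q j : pbarrier (q j).
Proof.
exists (PC 0), (fun i => PC (i == j)%:R); apply/funext => x /=.
rewrite add0r (bigD1 j)//= eqxx mulr1 big1 ?addr0// => i /negbTE ->.
by rewrite mulr0.
Qed.

Lemma pbarrier_W1 i : pbarrier (W1 i).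
Proof.
have -> : W1 i = fun x => \sum_j q j x * pe (PC (al i j) : pexp) x.
  by apply/funext => x; rewrite W1E; apply: eq_bigr => j _; rewrite mulrC.
by apply: pbarrier_sum => j; apply: pbarrierM; exact: pbarrier_q.
Qed.

Lemma pbarrier_Lop s p : pbarrier (Lop s p).
Proof.
apply: pbarrier_sum => i.
apply: pbarrierB; first exact: pbarrier_pe.
apply: pbarrierM; apply: pbarrierD; first exact: (pbarrier_pe (PX i)).
have := pbarrierM (PC s) (pbarrier_W1 i).
by congr pbarrier; apply/funext => x /=; rewrite mulrC.
Qed.

(** The constant [k] is unavoidable, as L u always has mean zero. *)
Definition dense_range (s : R) : Prop := forall F, pbarrier F -> forall e : R, 0 < e ->
  exists (u : pexp) (k : R), avg s (fun x => (F x - k - Lop s u x) ^+ 2) <= e.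

Lemma dense_range0 : dense_range 0.
Proof.
move=> F [a0 [a ->]] e e0.
(* The successor keeps the divisor nonzero when [I] is empty. *)
pose N : R := #|I|.+1%:R.
have N0 : 0 < N by rewrite ltr0n.
have eN : 0 < e / N ^+ 2 by rewrite divr_gt0// exprn_gt0.
pose r j := projT1 (cid (q_dense j (a j) eN)).
have hr j : gaussE (fun x => (q j x * pe (a j) x - pe (r j) x) ^+ 2) <= e / N ^+ 2.
  exact: projT2 (cid (q_dense j (a j) eN)).
have [u [k h]] := solvable0_pexp W1 (PA a0 (psum (enum I) r)).
exists u, k.
pose d j x := q j x * pe (a j) x - pe (r j) x.
have nd j : nice (d j).
  by apply: niceB; [apply: niceM => //|]; exact: nice_pe.
have E x : pe a0 x + \sum_j q j x * pe (a j) x - k - Lop 0 u x = \sum_j d j x.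
  rewrite h /= pe_sum big_enum /= /d sumrB; ring.
rewrite /avg /wt; under eq_fun do rewrite E mul0r oppr0 expR0 mul1r.
apply: (@le_trans _ _ (gaussE (fun x => N * \sum_j d j x ^+ 2))).
  apply: gaussE_le.
  - by apply/nice_good/niceX/nice_sum.
  - apply/nice_good; apply: niceM; first exact: nice_cst.
    by apply: nice_sum => j; exact: niceX.
  move=> x; apply: (@le_trans _ _ (#|I|%:R * \sum_j d j x ^+ 2)); last first.
    by rewrite ler_wpM2r ?ler_nat// sumr_ge0// => j _; exact: sqr_ge0.
  have : 0 <= \sum_i \sum_j (d i x - d j x) ^+ 2.
    by apply: sumr_ge0 => i _; apply: sumr_ge0 => j _; exact: sqr_ge0.
  have -> : \sum_i \sum_j (d i x - d j x) ^+ 2 =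
      2 * (#|I|%:R * \sum_j d j x ^+ 2 - (\sum_j d j x) ^+ 2).
    transitivity (\sum_i (#|I|%:R * d i x ^+ 2 + \sum_j d j x ^+ 2 -
        2 * (d i x * \sum_j d j x))).
      apply: eq_bigr => i _.
      have -> : #|I|%:R * d i x ^+ 2 = \sum_(j : I) d i x ^+ 2.
        by rewrite sumr_const mulr_natl.
      rewrite !mulr_sumr -big_split -sumrB /=.
      by apply: eq_bigr => j _; ring.
    rewrite sumrB big_split /= -mulr_sumr sumr_const -mulr_sumr -mulr_suml -mulr_natl.
    ring.
  lra.
rewrite gaussEZ; last first.
  by apply/nice_good; apply: nice_sum => j; exact: niceX.
rewrite gaussE_sum; last by move=> j; apply/nice_good/niceX.
apply: (@le_trans _ _ (N * \sum_(j : I) e / N ^+ 2)).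
  by rewrite ler_wpM2l ?(ltW N0)//; apply: ler_sum => j _; exact: hr.
rewrite sumr_const -[_ *+ _]mulr_natl.
have -> : N * (#|I|%:R * (e / N ^+ 2)) = e * (#|I|%:R / N).
  by field; rewrite gt_eqF.
by rewrite ler_piMr ?(ltW e0)// ler_pdivrMr// mul1r ler_nat.
Qed.

Section step.
Variables (s dl : R).
Hypothesis s_ge0 : 0 <= s.
Hypothesis dl_ge0 : 0 <= dl.
Hypothesis dlM : dl * M <= 4^-1.
Hypothesis dr : dense_range s.

Lemma Lop_shift (u : pexp) x :
  Lop (s + dl) u x = Lop s u x - dl * \sum_i W1 i x * pe (pd i u) x.
Proof. by rewrite mulr_sumr -sumrB; apply: eq_bigr => i _; ring. Qed.

Lemma cauchy_schwarz (a b : 'I_n -> R) :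
  (\sum_i a i * b i) ^+ 2 <= (\sum_i a i ^+ 2) * \sum_i b i ^+ 2.
Proof.
rewrite -subr_ge0.
have : 0 <= \sum_i \sum_j (a i * b j - a j * b i) ^+ 2.
  by apply: sumr_ge0 => i _; apply: sumr_ge0 => j _; exact: sqr_ge0.
have -> : \sum_i \sum_j (a i * b j - a j * b i) ^+ 2 =
    2 * ((\sum_i a i ^+ 2) * (\sum_i b i ^+ 2) - (\sum_i a i * b i) ^+ 2).
  transitivity (\sum_i (a i ^+ 2 * (\sum_j b j ^+ 2) + (\sum_j a j ^+ 2) * b i ^+ 2 -
      2 * (a i * b i * \sum_j a j * b j))).
    apply: eq_bigr => i _.
    rewrite !mulr_sumr mulr_suml -big_split -sumrB /=.
    by apply: eq_bigr => j _; ring.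
  rewrite sumrB big_split /= -mulr_suml -mulr_sumr -mulr_sumr -mulr_suml.
  ring.
lra.
Qed.

(** An approximate solution for the scale s is used for s + dl; the defect is dl <W1, grad u>. Its
    square is at most |grad u|^2 / 16, and grad u is controlled by L u, hence by F, which yields the
    contraction factor 1/4. *)
Lemma neumann F e : pbarrier F -> 0 < e -> exists (u : pexp) (k : R),
  avg s (fun x => (F x - k - Lop (s + dl) u x) ^+ 2) <=
  4^-1 * avg s (fun x => F x ^+ 2) + 3 * e.
Proof.
move=> cF e0; have [u [k h]] := dr cF e0; exists u, k.
have nF := nice_pbarrier cF.
pose er x := F x - k - Lop s u x.
have nL : nice (Lop s u) by exact: (nice_Lop pot).
have ner : nice er by apply: niceB => //; apply: niceB => //; exact: nice_cst.
pose y := avg s (fun x => Lop s u x ^+ 2).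
have nL2 : nice (fun x => Lop s u x ^+ 2) by exact: niceX.
have nF2 : nice (fun x => F x ^+ 2) by exact: niceX.
have ner2 : nice (fun x => er x ^+ 2) by exact: niceX.
have y_le : y <= 2 * avg s (fun x => F x ^+ 2) + 2 * e.
  apply: (@le_trans _ _ (avg s (fun x => (F x - er x) ^+ 2))).
    (* F - er is k + L u, and L u is orthogonal to constants, so dropping k only lowers the norm. *)
    have -> : avg s (fun x => (F x - er x) ^+ 2) =
        avg s (fun x => k ^+ 2 + ((2 * k) * Lop s u x + Lop s u x ^+ 2)).
      by congr (avg s); apply/funext => x; rewrite /er; ring.
    have nk := nice_cst (k ^+ 2 : R).
    rewrite !(avgD pot)//; [|exact: niceM (nice_cst _) nL|].
      rewrite (avgZ pot)// (avg_Lop0 pot)// mulr0 add0r lerDr.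
      by apply: avg_ge0 => x; exact: sqr_ge0.
    by apply: niceD => //; exact: niceM (nice_cst _) nL.
  apply: (@le_trans _ _ (avg s (fun x => 2 * F x ^+ 2 + 2 * er x ^+ 2))).
    apply: (avg_le pot) => //.
    - by apply: niceX; exact: niceB.
    - by apply: niceD; apply: niceM => //; exact: nice_cst.
    move=> x; have := sqr_ge0 (F x + er x); rewrite -subr_ge0 => g.
    rewrite -subr_ge0; apply: le_trans g _; rewrite le_eqVlt; apply/orP; left.
    by apply/eqP; ring.
  rewrite (avgD pot)//; try by apply: niceM => //; exact: nice_cst.
  by rewrite !(avgZ pot)// lerD2l ler_wpM2l.
have g_le := le_trans (grad2_le pot s_ge0 u) y_le.
have ng := nice_grad2 u.
apply: (@le_trans _ _ (avg s (fun x => 2 * er x ^+ 2 + 8^-1 * grad2 u x))).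
  apply: (avg_le pot) => //.
  - apply: niceX; apply: niceB; last exact: (nice_Lop pot).
    by apply: niceB => //; exact: nice_cst.
  - by apply: niceD; apply: niceM => //; exact: nice_cst.
  move=> x; rewrite Lop_shift.
  set t := dl * _.
  have t2 : t ^+ 2 <= 16^-1 * grad2 u x.
    rewrite /t exprMn.
    apply: (@le_trans _ _ (dl ^+ 2 * (M ^+ 2 * grad2 u x))).
      rewrite ler_wpM2l ?sqr_ge0//; apply: le_trans (cauchy_schwarz _ _) _.
      by rewrite ler_wpM2r// sumr_ge0// => i _; exact: sqr_ge0.
    rewrite mulrA -exprMn ler_wpM2r ?sumr_ge0// => [i _|]; first exact: sqr_ge0.
    have -> : 16^-1 = 4^-1 ^+ 2 :> R by field.
    by rewrite lerXn2r ?nnegrE ?mulr_ge0// invr_ge0.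
  have -> : F x - k - (Lop s u x - t) = er x + t by rewrite /er; ring.
  rewrite -subr_ge0.
  have -> : 2 * er x ^+ 2 + 8^-1 * grad2 u x - (er x + t) ^+ 2 =
      (er x - t) ^+ 2 + 2 * (16^-1 * grad2 u x - t ^+ 2) by field.
  by rewrite addr_ge0 ?sqr_ge0// mulr_ge0// subr_ge0.
rewrite (avgD pot)//; try by apply: niceM => //; exact: nice_cst.
rewrite !(avgZ pot)//.
have hh : avg s (fun x => er x ^+ 2) <= e by exact: h.
move: g_le hh; set gg := avg s (grad2 u); set ee := avg s _; set ff := avg s _; lra.
Qed.

(** The contraction is applied to the residual. The additive errors do not accumulate, since [4 * e]
    is the fixed point of y -> y / 4 + 3 e. *)
Lemma neumann_iter F e m : pbarrier F -> 0 < e -> exists (u : pexp) (k : R),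
  avg s (fun x => (F x - k - Lop (s + dl) u x) ^+ 2) <=
  4^-1 ^+ m * avg s (fun x => F x ^+ 2) + 4 * e.
Proof.
move=> cF e0; elim: m => [|m [u [k h]]].
  exists (PC 0), 0; rewrite expr0 mul1r.
  under eq_fun do rewrite Lop_cst !subr0.
  by rewrite lerDl mulr_ge0// ltW.
have cF' : pbarrier (fun x => F x - k - Lop (s + dl) u x).
  apply: pbarrierB; last exact: pbarrier_Lop.
  by apply: pbarrierB => //; exact: (pbarrier_pe (PC k)).
have [v [l g]] := neumann cF' e0.
exists (PA u v), (k + l).
have -> : (fun x => (F x - (k + l) - Lop (s + dl) (PA u v) x) ^+ 2) =
    (fun x => (F x - k - Lop (s + dl) u x - l - Lop (s + dl) v x) ^+ 2).
  by apply/funext => x; rewrite Lop_add; congr (_ ^+ 2); ring.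
apply: le_trans g _; rewrite exprS -mulrA.
move: h; set t := _ * avg s (fun x => F x ^+ 2); set t' := avg s _; lra.
Qed.

Lemma dense_range_step : dense_range (s + dl).
Proof.
move=> F cF e e0.
have nF := nice_pbarrier cF.
pose A := avg s (fun x => F x ^+ 2).
have A0 : 0 <= A by apply: avg_ge0 => x; exact: sqr_ge0.
have [m mA] : exists m : nat, 4^-1 ^+ m * A <= e / 2.
  have /cvgrPdist_le /(_ (e / 2 / (A + 1))) h :
      (fun m : nat => (4^-1 : R) ^+ m) @ \oo --> (0 : R).
    by apply: cvg_expr; rewrite ger0_norm ?invr_ge0// invf_lt1// ltr1n.
  have A1 : 0 < A + 1 by rewrite ltr_wpDl.
  have /h [m _ /(_ m (leqnn m))] : 0 < e / 2 / (A + 1) by rewrite !divr_gt0.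
  rewrite /= sub0r normrN ger0_norm ?exprn_ge0 ?invr_ge0// => hm.
  exists m; apply: (@le_trans _ _ (4^-1 ^+ m * (A + 1))).
    by rewrite ler_wpM2l ?exprn_ge0 ?invr_ge0// lerDl.
  by rewrite -ler_pdivlMr.
have e8 : 0 < e / 8 by rewrite divr_gt0.
have [u [k h]] := neumann_iter m cF e8.
(* The residual was measured with the weight of scale s; the weight of scale s + dl is smaller
   because W >= 0. *)
exists u, k; apply: (@le_trans _ _ (avg s (fun x => (F x - k - Lop (s + dl) u x) ^+ 2))).
  have nG : nice (fun x => (F x - k - Lop (s + dl) u x) ^+ 2).
    apply: niceX; apply: niceB; last by apply: (nice_Lop pot); rewrite addr_ge0.
    by apply: niceB => //; exact: nice_cst.
  apply: gaussE_le.
  - apply/nice_good/niceM => //; apply: (nice_wt pot); exact: addr_ge0.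
  - by apply/nice_good/niceM => //; exact: (nice_wt pot).
  move=> x; rewrite ler_wpM2r ?sqr_ge0// ler_expR lerN2 ler_wpM2r//.
    exact: (pot_ge0 pot).
  by rewrite lerDl.
apply: le_trans h _; move: mA; rewrite -/A; lra.
Qed.

End step.

(** The admissible step depends only on the bound [M] for the gradient of [W], so finitely many
    equal steps lead from 0 to 1. *)
Lemma dense_range1 : dense_range 1.
Proof.
pose N := Num.bound (4 * M).
have NM : 4 * M < N%:R by apply: archi_boundP; rewrite mulr_ge0.
have N0 : 0 < N%:R :> R by rewrite (le_lt_trans _ NM)// mulr_ge0.
have H m : dense_range (m%:R / N%:R).
  elim: m => [|m IH]; first by rewrite mul0r; exact: dense_range0.
  rewrite -natr1 mulrDl; apply: dense_range_step => //.
  rewrite mul1r mulrC ler_pdivrMr//.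
  by rewrite mulrC ler_pdivlMr// mulrC ltW.
by have := H N; rewrite divff ?gt_eqF.
Qed.

End solvability.

(** * Variance bounds *)

Section gaussE_positive.
Context {R : realType} {n : nat}.

Lemma gaussE_gt0 (F : 'rV[R]_n -> R) : good F -> (forall x, 0 < F x) -> 0 < gaussE F.
Proof.
move=> gF F0; rewrite lt_neqAle gaussE_ge0 ?andbT => [|x]; last exact: ltW.
apply/eqP => E0; have := gaussE_fin gF; rewrite -E0.
have -> : (\int[gs_P (gauss_space n)]_w (F (gs_X w))%:E =
    \int[gs_P (gauss_space n)]_w `|(F (gs_X w))%:E|)%E.
  by apply: eq_integral => w _; rewrite gee0_abs// lee_fin ltW.
move/esym/(ae_eq_integral_abs _ measurableT (measurable_int _ (good_integrable gF))).1.
move=> [A [mA A0 sA]].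
have AT : A = setT.
  apply/seteqP; split=> // w _; apply: sA => /= /(_ I) [] h.
  by have := F0 (gs_X w); rewrite h ltxx.
have PT : gs_P (gauss_space n) A = 1%E by rewrite AT; exact: probability_setT.
by have /eqP := etrans (esym PT) A0; rewrite onee_eq0.
Qed.

End gaussE_positive.

Section variance_bound.
Context {R : realType} {n : nat}.
Local Notation pexp := (@pexp R n).
Variables (W : 'rV[R]_n -> R) (W1 : 'I_n -> 'rV[R]_n -> R)
  (W2 : 'I_n -> 'I_n -> 'rV[R]_n -> R).
Hypothesis pot : potential W W1 W2.
Variables (I : finType) (q : I -> 'rV[R]_n -> R).
Hypothesis q_nice : forall j, nice (q j).
Hypothesis dr : dense_range W W1 q 1.

Local Notation avg := (avg W 1).
Local Notation Lop := (Lop W1 1).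

Let pe_nice := @nice_pe R n.
Let nL p : nice (Lop p) := nice_Lop pot 1 p.
Let ler_young (a b t : R) : 0 < t -> a * b <= t / 2 * a ^+ 2 + (2 * t)^-1 * b ^+ 2.
Proof.
move=> t0; have h := sqr_ge0 (t * a - b); rewrite -subr_ge0.
have -> : t / 2 * a ^+ 2 + (2 * t)^-1 * b ^+ 2 - a * b =
  (2 * t)^-1 * (t * a - b) ^+ 2 by field; rewrite gt_eqF.
by rewrite mulr_ge0 ?sqr_ge0// invr_ge0 mulr_ge0// ltW.
Qed.

Let avg_young (t : R) F G : 0 < t -> nice F -> nice G ->
  avg (fun x => F x * G x) <=
  t / 2 * avg (fun x => F x ^+ 2) + (2 * t)^-1 * avg (fun x => G x ^+ 2).
Proof.
move=> t0 nF nG.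
have nF2 : nice (fun x => F x ^+ 2) by exact: niceX.
have nG2 : nice (fun x => G x ^+ 2) by exact: niceX.
rewrite -!(avgZ pot)// -(avgD pot)//; try by apply: niceM => //; exact: nice_cst.
apply: (avg_le pot) => //.
- exact: niceM.
- by apply: niceD; apply: niceM => //; exact: nice_cst.
- by move=> x; exact: ler_young.
Qed.

(* Brascamp-Lieb by duality: solve L u = g approximately, integrate by parts, and bound
   the gradient of u by the Bochner formula. *)
Lemma poincare (p : pexp) : avg (pe p) = 0 ->
  avg (fun x => pe p x ^+ 2) <= avg (grad2 p).
Proof.
move=> p0.
set A := avg _; set B := avg _.
have A0 : 0 <= A by apply: avg_ge0 => x; exact: sqr_ge0.
suff key (t : R) : 0 < t -> t <= 1 -> A <= B + t * (2 * A + 3).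
  apply/ler_addgt0Pr => e e0.
  have C0 : 0 < 2 * A + 3 by rewrite ltr_wpDl// mulr_ge0.
  pose t := Num.min 1 (e / (2 * A + 3)).
  have t0 : 0 < t by rewrite lt_min ltr01 divr_gt0.
  apply: le_trans (key t t0 _) _; first by rewrite ge_min lexx.
  by rewrite lerD2l -ler_pdivlMr// ge_min lexx orbT.
move=> t0 t1.
(* With a residual of size t^2 in mean square, Young's inequality with parameter t leaves an error
   of order t. *)
have e0 : 0 < t ^+ 2 by rewrite exprn_gt0.
have [u [k h]] := dr (pbarrier_pe q p) e0.
pose er x := pe p x - k - Lop u x.
have ner : nice er by apply: niceB => //; apply: niceB => //; exact: nice_cst.
have ng := nice_grad2 u; have ngp := nice_grad2 p.
have npL : nice (fun x => pe p x * Lop u x) by exact: niceM.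
have npe : nice (fun x => pe p x * er x) by exact: niceM.
have nL2 : nice (fun x => Lop u x ^+ 2) by exact: niceX.
have np2 : nice (fun x => pe p x ^+ 2) by exact: niceX.
have ner2 : nice (fun x => er x ^+ 2) by exact: niceX.
pose y := avg (fun x => Lop u x ^+ 2).
pose E := avg (fun x => er x ^+ 2).
pose X := avg (fun x => pe p x * er x).
have AE : A = avg (fun x => pe p x * Lop u x) + X.
  transitivity (avg (fun x => k * pe p x + (pe p x * Lop u x + pe p x * er x))).
    by congr avg; apply/funext => x; rewrite /er; ring.
  rewrite !(avgD pot)//; last 2 first.
  - by apply: niceM => //; exact: nice_cst.
  - exact: niceD.
  by rewrite (avgZ pot)// p0 mulr0 add0r.
have h1 : avg (fun x => pe p x * Lop u x) <= 2^-1 * B + 2^-1 * y.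
  rewrite (avg_Lop pot ler01 u (pe_nice p) (fun i => pe_nice (pd i p))
    (fun i => partial_pe i p)).
  have ns : nice (fun x => \sum_i pe (pd i p) x * pe (pd i u) x).
    by apply: nice_sum => i; exact: niceM.
  rewrite -(avgN pot)//.
  apply: (@le_trans _ _ (2^-1 * B + 2^-1 * avg (grad2 u))); last first.
    by rewrite lerD2l ler_wpM2l ?invr_ge0// (grad2_le pot).
  rewrite -!(avgZ pot)// -(avgD pot)//; try by apply: niceM => //; exact: nice_cst.
  apply: (avg_le pot) => //.
  - exact: niceN.
  - by apply: niceD; apply: niceM => //; exact: nice_cst.
  move=> x; rewrite /grad2 !mulr_sumr -big_split -sumrN /=; apply: ler_sum => i _.
  have := sqr_ge0 (pe (pd i p) x + pe (pd i u) x).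
  by rewrite sqrrD -mulr_natr; lra.
have h2 : y <= A - 2 * X + E.
  have -> : A - 2 * X + E = avg (fun x => (pe p x - er x) ^+ 2).
    transitivity (avg (fun x => pe p x ^+ 2 + ((- 2) * (pe p x * er x) + er x ^+ 2))).
      rewrite !(avgD pot)// ?(avgZ pot)//; last 2 first.
      - by apply: niceM => //; exact: nice_cst.
      - by apply: niceD => //; apply: niceM => //; exact: nice_cst.
      by rewrite -/A -/X -/E; ring.
    by congr avg; apply/funext => x; ring.
  have -> : avg (fun x => (pe p x - er x) ^+ 2) =
      avg (fun x => k ^+ 2 + ((2 * k) * Lop u x + Lop u x ^+ 2)).
    by congr avg; apply/funext => x; rewrite /er; ring.
  have nk := nice_cst (k ^+ 2 : R).
  rewrite !(avgD pot)//; [|exact: niceM (nice_cst _) (nL u)|].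
    rewrite (avgZ pot)// (avg_Lop0 pot)// mulr0 add0r lerDr.
    by apply: avg_ge0 => x; exact: sqr_ge0.
  by apply: niceD => //; exact: niceM (nice_cst _) (nL u).
have h3 : `|X| <= t / 2 * A + (2 * t)^-1 * E.
  rewrite ler_norml lerNl -(avgN pot)// avg_young// andbT.
  have := @avg_young t (pe p) (fun x => - er x) t0 (pe_nice p) (niceN ner).
  have E1 : (fun x => pe p x * - er x) = (fun x => - (pe p x * er x)).
    by apply/funext => x; rewrite mulrN.
  have E2 : (fun x => (- er x) ^+ 2) = (fun x => er x ^+ 2).
    by apply/funext => x; rewrite sqrrN.
  by rewrite E1 E2.
have hE : E <= t ^+ 2 by exact: h.
have E2 : (2 * t)^-1 * E <= t / 2.
  rewrite mulrC ler_pdivrMr ?mulr_gt0//; apply: le_trans hE _.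
  by rewrite le_eqVlt; apply/orP; left; apply/eqP; field.
have X2 := le_trans h3 (lerD (lexx _) E2).
have Xb : - X <= `|X| by rewrite -normrN ler_norm.
have Xc : X <= `|X| by rewrite ler_norm.
have tt : t ^+ 2 <= t by rewrite expr2 ger_pMr.
have tA : 0 <= t * A by rewrite mulr_ge0// ltW.
lra.
Qed.

Hypothesis W_even : forall x, W (- x) = W x.

Lemma avg_neg F : nice F -> avg (fun x => F (- x)) = avg F.
Proof.
move=> nF; rewrite /avg -[RHS]gaussEN; last first.
  by apply/nice_good/niceM => //; exact: (nice_wt pot).
by congr gaussE; apply/funext => x; rewrite /wt W_even.
Qed.

Lemma avg_odd F : nice F -> (forall x, F (- x) = - F x) -> avg F = 0.
Proof.
move=> nF oF; have := avg_neg nF; under eq_fun do rewrite oF.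
by rewrite (avgN pot)// => h; lra.
Qed.

Lemma W1_odd i x : W1 i (- x) = - W1 i x.
Proof.
have d1 := pot_d1 pot i (- x); have d2 := pot_d1 pot i x.
have dN : is_derive (0 : R) 1 (fun s : R => - s) (-1) by apply: is_derive_eq.
have d2' : is_derive (- 0 : R) 1 (fun s : R => W (x + s *: delta_mx ord0 i)) (W1 i x).
  by rewrite oppr0.
have := @is_derive1_comp _ _ (fun s : R => - s) (0 : R) _ _ d2' dN.
have -> : (fun s : R => W (x + s *: delta_mx ord0 i)) \o (fun s : R => - s) =
    (fun s : R => W (- x + s *: delta_mx ord0 i)).
  by apply/funext => s /=; rewrite -W_even opprD scaleNr opprK.
move=> d3.
by rewrite -(@derive_val _ _ _ _ _ _ _ d1) (@derive_val _ _ _ _ _ _ _ d3) mulrN1.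
Qed.

Lemma Lop_neg (u : pexp) x : Lop (pneg u) x = Lop u (- x).
Proof.
apply: eq_bigr => i _.
have h : pe (pd i (pneg u)) =1 pe (PM (PC (-1)) (pneg (pd i u))).
  by move=> y; rewrite pd_neg /= pe_neg mulN1r.
rewrite (pe_ext h) /= !pd_neg !pe_neg W1_odd mxE; ring.
Qed.

Definition rad2 (x : 'rV[R]_n) : R := \sum_i x ord0 i ^+ 2.

Lemma nice_rad2 : nice rad2.
Proof. by apply: nice_sum => i; apply: niceX; exact: nice_coord. Qed.

Lemma even_grad_odd (u : pexp) : (forall x, pe u (- x) = pe u x) ->
  forall i x, pe (pd i u) (- x) = - pe (pd i u) x.
Proof.
move=> ue i x.
have h : pe (pneg u) =1 pe u by move=> y; rewrite pe_neg ue.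
by have := pe_ext h i x; rewrite pd_neg => <-; rewrite opprK.
Qed.

(* The subtraction of c x from the gradient is where evenness is used: the components of
   grad u - c x are odd, hence centred, and the Poincare inequality applies to them. *)
Lemma hess2_lower (u : pexp) (c : R) : (forall x, pe u (- x) = pe u x) ->
  2 * c * avg (fun x => \sum_i W1 i x * pe (pd i u) x) +
  c ^+ 2 * (avg rad2 - n%:R * avg (fun=> 1)) <= avg (hess2 u).
Proof.
move=> ue.
have n1 := nice_cst (1 : R) : nice (fun _ : 'rV[R]_n => 1).
have nS1 : nice (fun x => \sum_i W1 i x * pe (pd i u) x).
  by apply: nice_sum => i; apply: niceM => //; exact: (pot1_nice pot).
have nD : nice (fun x => \sum_i pe (pd i (pd i u)) x) by exact: nice_sum.
have nX : nice (fun x => \sum_i x ord0 i * pe (pd i u) x).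
  by apply: nice_sum => i; apply: niceM => //; exact: nice_coord.
pose g i : pexp := PA (pd i u) (PM (PC (- c)) (PX i)).
have avg_g i : avg (pe (g i)) = 0.
  apply: avg_odd => // x; rewrite /= even_grad_odd// mxE; ring.
have P : avg (fun x => \sum_i pe (g i) x ^+ 2) <= avg (fun x => \sum_i grad2 (g i) x).
  rewrite !(avg_sum pot)//; last 2 first.
  - by move=> i; exact: niceX.
  - by move=> i; exact: nice_grad2.
  by apply: ler_sum => i _; exact: poincare.
have e1 : avg (fun x => \sum_i pe (g i) x ^+ 2) =
    avg (grad2 u) + ((- (2 * c)) * avg (fun x => \sum_i x ord0 i * pe (pd i u) x) +
    c ^+ 2 * avg rad2).
  have n3 := nice_rad2; have n4 := nice_grad2 u.
  rewrite -!(avgZ pot)// -!(avgD pot)//; try by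
    do ?[apply: niceD => // | apply: niceM => // | exact: nice_cst].
  congr avg; apply/funext => x; rewrite /grad2 /rad2 !mulr_sumr -!big_split /=.
  by apply: eq_bigr => i _; ring.
have e2 : avg (fun x => \sum_i grad2 (g i) x) =
    avg (hess2 u) + ((- (2 * c)) * avg (fun x => \sum_i pe (pd i (pd i u)) x) +
    c ^+ 2 * n%:R * avg (fun=> 1)).
  have n4 := nice_hess2 u.
  rewrite -!(avgZ pot)// -!(avgD pot)//; try by
    do ?[apply: niceD => // | apply: niceM => // | exact: nice_cst].
  congr avg; apply/funext => x; rewrite /grad2 /hess2.
  have -> : c ^+ 2 * n%:R * 1 = \sum_(i < n) c ^+ 2.
    by rewrite sumr_const card_ord mulr1 mulr_natr.
  rewrite mulr_sumr -!big_split /=; apply: eq_bigr => i _.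
  transitivity (\sum_k (pe (pd k (pd i u)) x ^+ 2 +
      (i == k)%:R * (- (2 * c) * pe (pd k (pd i u)) x + c ^+ 2))).
    apply: eq_bigr => k _ /=; case: (i == k) => /=; ring.
  rewrite big_split /=; congr (_ + _).
  rewrite (bigD1 i)//= eqxx mul1r big1 ?addr0// => k.
  by rewrite eq_sym => /negbTE ->; rewrite mul0r.
(* The mean of L u vanishes, which exchanges the Laplacian and the radial derivative for the drift
   along [W1]. *)
have e3 : avg (fun x => \sum_i pe (pd i (pd i u)) x) -
    avg (fun x => \sum_i x ord0 i * pe (pd i u) x) =
    avg (fun x => \sum_i W1 i x * pe (pd i u) x).
  transitivity (avg (fun x => \sum_i W1 i x * pe (pd i u) x + Lop u x)).
    rewrite -(avgB pot)//; congr avg; apply/funext => x; rewrite /Lop -!sumrB -big_split /=.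
    by apply: eq_bigr => i _; ring.
  by rewrite (avgD pot)// (avg_Lop0 pot)// addr0.
move: P; rewrite e1 e2 -e3.
have : 0 <= avg (grad2 u).
  by apply: avg_ge0 => x; apply: sumr_ge0 => i _; exact: sqr_ge0.
set a := avg (grad2 u); set b := avg (hess2 u).
set d := avg (fun x => \sum_i pe (pd i (pd i u)) x).
set e := avg (fun x => \sum_i x ord0 i * pe (pd i u) x).
set r := avg rad2; set z := avg (fun=> 1) => a0 P; rewrite -subr_ge0.
have -> : b - (2 * c * (d - e) + c ^+ 2 * (r - n%:R * z)) =
  a + (b + (- (2 * c) * d + c ^+ 2 * n%:R * z) - (a + (- (2 * c) * e + c ^+ 2 * r))).
  ring.
by rewrite addr_ge0// subr_ge0.
Qed.

(** Start from (F - k)^2 = 2 (F - k) L u - (L u)^2 + er^2, integrate the first term by parts, and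
    expand the second by Bochner, with [hess2_lower] for the Hessian. The function u is kept in the
    bound so that its gradient can be eliminated by completing a square pointwise once the Hessian
    of [W] is explicit. *)
Lemma variance_le (F : 'rV[R]_n -> R) (F' : 'I_n -> 'rV[R]_n -> R) (c e : R) :
  pbarrier q F -> (forall x, F (- x) = F x) -> (forall i, nice (F' i)) ->
  (forall i, partial i F (F' i)) -> 0 < e ->
  exists u : pexp,
    avg (fun x => F x ^+ 2) - avg F ^+ 2 / avg (fun=> 1) <=
    avg (fun x => - (hessW W2 u x + 2 * \sum_i (F' i x + c * W1 i x) * pe (pd i u) x))
    + c ^+ 2 * (n%:R * avg (fun=> 1) - avg rad2) + e.
Proof.
move=> cF Fe nF' dF e0.
have nF := nice_pbarrier q_nice cF.
have n1 := nice_cst (1 : R) : nice (fun _ : 'rV[R]_n => 1).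
have [u0 [k h0]] := dr cF e0.
(* [hess2_lower] needs u even; as F and W are even, averaging u0 with its reflection does not
   increase the error. *)
pose u : pexp := PM (PC 2^-1) (PA u0 (pneg u0)).
have ue x : pe u (- x) = pe u x by rewrite /= !pe_neg opprK addrC.
pose er0 x := F x - k - Lop u0 x.
have ner0 : nice er0 by apply: niceB => //; apply: niceB => //; exact: nice_cst.
have nN (G : 'rV[R]_n -> R) : nice G -> nice (fun x => G (- x)).
  move=> [gG cG]; split; first exact: goodNx.
  move=> x v s; have := cG (- x) (- v) s.
  by under eq_fun do rewrite scalerN -opprD.
pose er x := F x - k - Lop u x.
have ner : nice er by apply: niceB => //; apply: niceB => //; exact: nice_cst.
have erE x : er x = 2^-1 * (er0 x + er0 (- x)).
  by rewrite /er /er0 /u Lop_scale Lop_add Lop_neg Fe; field.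
have her : avg (fun x => er x ^+ 2) <= e.
  apply: le_trans h0.
  have n2 : nice (fun x => er0 x ^+ 2) by exact: niceX.
  have n2' : nice (fun x => er0 (- x) ^+ 2) by exact: (nN (fun x => er0 x ^+ 2) n2).
  have -> : avg (fun x => er0 x ^+ 2) =
      avg (fun x => 2^-1 * er0 x ^+ 2 + 2^-1 * er0 (- x) ^+ 2).
    rewrite (avgD pot) ?(avgZ pot)//; try by apply: niceM => //; exact: nice_cst.
    by rewrite (@avg_neg (fun x => er0 x ^+ 2))//; field.
  apply: (avg_le pot) => //.
  - exact: niceX.
  - by apply: niceD; apply: niceM => //; exact: nice_cst.
  move=> x; rewrite erE -subr_ge0.
  have -> : 2^-1 * er0 x ^+ 2 + 2^-1 * er0 (- x) ^+ 2 -
    (2^-1 * (er0 x + er0 (- x))) ^+ 2 = 4^-1 * (er0 x - er0 (- x)) ^+ 2 by field.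
  by rewrite mulr_ge0 ?invr_ge0 ?sqr_ge0.
exists u.
pose Z := avg (fun=> 1).
have Z0 : 0 < Z.
  apply: gaussE_gt0; first by apply/nice_good/niceM => //; exact: (nice_wt pot).
  by move=> x; rewrite mulr1; exact: wt_gt0.
have nF2 : nice (fun x => F x ^+ 2) by exact: niceX.
have nFk : nice (fun x => F x - k) by apply: niceB => //; exact: nice_cst.
have nL2 : nice (fun x => Lop u x ^+ 2) by exact: niceX.
have ner2 : nice (fun x => er x ^+ 2) by exact: niceX.
have nFL : nice (fun x => (F x - k) * Lop u x) by exact: niceM.
have nFu : nice (fun x => \sum_i F' i x * pe (pd i u) x).
  by apply: nice_sum => i; exact: niceM.
have nWu : nice (fun x => \sum_i W1 i x * pe (pd i u) x).
  by apply: nice_sum => i; apply: niceM => //; exact: (pot1_nice pot).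
have nH := nice_hessW pot u.
have var_le : avg (fun x => F x ^+ 2) - avg F ^+ 2 / Z <= avg (fun x => (F x - k) ^+ 2).
  have -> : avg (fun x => (F x - k) ^+ 2) =
      avg (fun x => F x ^+ 2) + (- (2 * k) * avg F + k ^+ 2 * Z).
    rewrite -!(avgZ pot)// -!(avgD pot)//; try by
      do ?[apply: niceD => // | apply: niceM => // | exact: nice_cst].
    by congr avg; apply/funext => x; ring.
  rewrite lerD2l -subr_ge0.
  have -> : - (2 * k) * avg F + k ^+ 2 * Z - - (avg F ^+ 2 / Z) =
      Z^-1 * (avg F - k * Z) ^+ 2 by field; rewrite gt_eqF.
  by rewrite mulr_ge0 ?sqr_ge0// invr_ge0 ltW.
apply: le_trans var_le _.
have -> : avg (fun x => (F x - k) ^+ 2) =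
    2 * avg (fun x => (F x - k) * Lop u x) + (- avg (fun x => Lop u x ^+ 2) +
    avg (fun x => er x ^+ 2)).
  rewrite -!(avgZ pot)// -(avgN pot)// -!(avgD pot)//; try by
    do ?[apply: niceD => // | apply: niceN => // | apply: niceM => // | exact: nice_cst].
  by congr avg; apply/funext => x; rewrite /er; ring.
have dFk i : partial i (fun x => F x - k) (F' i).
  have := partialB (dF i) (@partial_cst R n i k).
  by under [X in partial _ _ X -> _]eq_fun do rewrite subr0.
rewrite (avg_Lop pot ler01 u nFk nF' dFk) (bochner pot)// mul1r.
have -> : avg (fun x => - (hessW W2 u x +
      2 * \sum_i (F' i x + c * W1 i x) * pe (pd i u) x)) =
    - avg (hessW W2 u) - 2 * avg (fun x => \sum_i F' i x * pe (pd i u) x) -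
    2 * c * avg (fun x => \sum_i W1 i x * pe (pd i u) x).
  rewrite -!(avgZ pot)// -!(avgN pot)// -?(avgD pot)//; try by
    do ?[apply: niceD => // | apply: niceN => // | apply: niceM => // | exact: nice_cst].
  congr avg; apply/funext => x.
  have -> : \sum_i (F' i x + c * W1 i x) * pe (pd i u) x =
    \sum_i F' i x * pe (pd i u) x + c * \sum_i W1 i x * pe (pd i u) x.
    by rewrite mulr_sumr -big_split /=; apply: eq_bigr => i _; ring.
  ring.
have := hess2_lower c ue.
have g0 : 0 <= avg (grad2 u).
  by apply: avg_ge0 => x; apply: sumr_ge0 => i _; exact: sqr_ge0.
move: her g0; rewrite -/Z.
set a := avg (hess2 u); set b := avg (grad2 u); set d := avg (hessW W2 u).
set g := avg (fun x => \sum_i F' i x * _); set h := avg (fun x => \sum_i W1 i x * _).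
set r := avg rad2; set er2 := avg _ => he b0 ha.
have : 0 <= a - (2 * c * h + c ^+ 2 * (r - n%:R * Z)) by rewrite subr_ge0.
move=> h1; rewrite -subr_ge0.
have -> : - d - 2 * g - 2 * c * h + c ^+ 2 * (n%:R * Z - r) + e -
    (2 * - g + (- (a + b + d) + er2)) =
    (a - (2 * c * h + c ^+ 2 * (r - n%:R * Z))) + b + (e - er2) by ring.
by apply: addr_ge0; [exact: addr_ge0 | rewrite subr_ge0].
Qed.

End variance_bound.

(** * Polynomial approximation of logistic functions *)

Section polynomial_density.
Context {R : realType} {n : nat}.
Local Notation pexp := (@pexp R n).
Implicit Types (f g : 'rV[R]_n -> R).

(** Decreasing from 1 at minus infinity to 0 at plus infinity; the weight of a half-space is
    therefore the complement 1 - logistic. *)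
Definition logistic (y : R) : R := (1 + expR y)^-1.

Lemma continuous_logistic : continuous logistic.
Proof.
move=> y; apply: cvgV; first by rewrite gt_eqF// ltr_wpDl// expR_gt0.
by apply: cvgD; [exact: cvg_cst|exact: continuous_expR].
Qed.

Lemma measurable_logistic : measurable_fun [set: R] logistic.
Proof. exact: continuous_measurable_fun continuous_logistic. Qed.

(** The polynomial factor [a] is part of the property so that it passes to products with bounded
    factors. *)
Definition poly_dense f := forall (a : pexp) (e : R), 0 < e ->
  exists r : pexp, gaussE (fun x => (f x * pe a x - pe r x) ^+ 2) <= e.

Let good_pe (p : pexp) : good (pe p) := nice_good (nice_pe p).

Lemma gaussE_sqrD_le f g : good f -> good g ->
  gaussE (fun x => (f x + g x) ^+ 2) <=
  2 * gaussE (fun x => f x ^+ 2) + 2 * gaussE (fun x => g x ^+ 2).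
Proof.
move=> gf gg; have gf2 := goodX 2 gf; have gg2 := goodX 2 gg.
rewrite -!gaussEZ// -gaussED; [|exact: goodZ|exact: goodZ].
apply: gaussE_le; first exact/goodX/goodD.
  by apply: goodD; exact: goodZ.
move=> x; rewrite -subr_ge0.
have -> : 2 * f x ^+ 2 + 2 * g x ^+ 2 - (f x + g x) ^+ 2 = (f x - g x) ^+ 2 by ring.
exact: sqr_ge0.
Qed.

Lemma poly_dense_pe (p : pexp) : poly_dense (pe p).
Proof.
move=> a e e0; exists (PM p a).
rewrite (_ : (fun x => _) = fun=> 0) ?gaussE_cst ?ltW//.
by apply/funext => x /=; rewrite subrr expr0n.
Qed.

Lemma poly_denseD f g : good f -> good g -> poly_dense f -> poly_dense g ->
  poly_dense (fun x => f x + g x).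
Proof.
move=> gf gg df dg a e e0.
have e4 : 0 < e / 4 by rewrite divr_gt0.
have [r1 h1] := df a _ e4; have [r2 h2] := dg a _ e4.
exists (PA r1 r2).
apply: (@le_trans _ _ (gaussE (fun x =>
    ((f x * pe a x - pe r1 x) + (g x * pe a x - pe r2 x)) ^+ 2))).
  rewrite le_eqVlt; apply/orP; left; apply/eqP; congr gaussE; apply/funext => x /=; ring.
apply: le_trans (gaussE_sqrD_le _ _) _.
- by apply: goodB => //; exact: goodM.
- by apply: goodB => //; exact: goodM.
lra.
Qed.

Lemma poly_denseM f g (C : R) : good f -> mfun g -> (forall x, `|g x| <= C) ->
  poly_dense f -> poly_dense g -> poly_dense (fun x => g x * f x).
Proof.
move=> gf mg gC df dg a e e0.
have gg := good_bounded mg gC.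
have C0 : 0 <= C by rewrite (le_trans _ (gC 0)).
have e4 : 0 < e / 4 by rewrite divr_gt0.
have D0 : 0 < e / 4 / (C ^+ 2 + 1) by rewrite divr_gt0// ltr_wpDl// sqr_ge0.
have [r1 h1] := df a _ D0; have [r2 h2] := dg r1 _ e4.
exists r2.
have g1 : good (fun x => f x * pe a x - pe r1 x) by apply: goodB => //; exact: goodM.
apply: (@le_trans _ _ (gaussE (fun x =>
    (g x * (f x * pe a x - pe r1 x) + (g x * pe r1 x - pe r2 x)) ^+ 2))).
  rewrite le_eqVlt; apply/orP; left; apply/eqP; congr gaussE; apply/funext => x /=; ring.
apply: le_trans (gaussE_sqrD_le _ _) _.
- exact: goodM.
- by apply: goodB => //; exact: goodM.
have : gaussE (fun x => (g x * (f x * pe a x - pe r1 x)) ^+ 2) <= e / 4.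
  apply: (@le_trans _ _ (C ^+ 2 * gaussE (fun x => (f x * pe a x - pe r1 x) ^+ 2))).
    rewrite -gaussEZ; last exact: goodX.
    apply: gaussE_le; first exact/goodX/goodM.
      exact/goodZ/goodX.
    move=> x; rewrite exprMn ler_wpM2r ?sqr_ge0//.
    by rewrite -[leLHS]real_normK ?num_real// lerXn2r// nnegrE.
  apply: (@le_trans _ _ (C ^+ 2 * (e / 4 / (C ^+ 2 + 1)))); first by rewrite ler_wpM2l ?sqr_ge0.
  rewrite mulrCA ger_pMr// ler_pdivrMr ?mul1r ?lerDl//.
  by rewrite ltr_wpDl// sqr_ge0.
lra.
Qed.

Lemma poly_dense_lim (f_ : nat -> 'rV[R]_n -> R) f g :
  (forall m, mfun (f_ m)) -> mfun f -> good g -> (forall m x, `|f_ m x| <= g x) ->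
  (forall x, f_ ^~ x @ \oo --> f x) -> (forall m, poly_dense (f_ m)) -> poly_dense f.
Proof.
move=> mf_ mf gg f_g f_f df_ a e e0.
have f_le x : `|f x| <= g x.
  have h : (fun m => `|f_ m x|) @ \oo --> `|f x| by apply: cvg_norm; exact: f_f.
  rewrite -(cvg_lim (@Rhausdorff R) h); apply: limr_le; first by apply/cvgP: h.
  by near=> m; exact: f_g.
have gf_ m : good (f_ m).
  split=> //; apply: (growth_le gg.2) => x.
  by rewrite [leRHS]ger0_norm// (le_trans _ (f_g 0%N x)).
have gf : good f.
  split=> //; apply: (growth_le gg.2) => x.
  by rewrite [leRHS]ger0_norm// (le_trans _ (f_le x)).
have e4 : 0 < e / 4 by rewrite divr_gt0.
have gd m : good (fun x => (f x - f_ m x) * pe a x) by apply: goodM => //; exact: goodB.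
have cv : (fun m => gaussE (fun x => ((f x - f_ m x) * pe a x) ^+ 2)) @ \oo -->
    gaussE (fun _ : 'rV[R]_n => 0 : R).
  apply: (@gaussE_dct _ _ (fun m x => ((f x - f_ m x) * pe a x) ^+ 2) (fun=> 0)
    (fun x => (2 * g x * pe a x) ^+ 2)).
  - by move=> m; exact: (goodX 2 (gd m)).1.
  - exact: mfun_cst.
  - by apply: goodX; apply: goodM => //; exact: goodZ.
  - move=> m x; rewrite ger0_norm ?sqr_ge0// !exprMn ler_wpM2r ?sqr_ge0//.
    rewrite -exprMn -[leLHS]real_normK ?num_real//.
    have := le_trans (ler_normB (f x) (f_ m x)) (lerD (f_le x) (f_g m x)).
    have := normr_ge0 (f x - f_ m x).
    by move=> h1 h2; rewrite lerXn2r ?nnegrE//; lra.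
  move=> x; rewrite -[X in _ --> X](_ : ((f x - f x) * pe a x) * ((f x - f x) * pe a x) = 0).
    by apply: cvgM; (apply: cvgM; last exact: cvg_cst);
      (apply: cvgB; [exact: cvg_cst|exact: f_f]).
  by rewrite subrr !mul0r.
rewrite gaussE_cst in cv.
have [m hm] : exists m, gaussE (fun x => ((f x - f_ m x) * pe a x) ^+ 2) <= e / 4.
  have /cvgrPdist_le/(_ _ e4)[m _ /(_ m (leqnn m)) /=] := cv.
  by rewrite sub0r normrN => h; exists m; rewrite (le_trans (ler_norm _) h).
have [r hr] := df_ m a _ e4.
exists r.
apply: (@le_trans _ _ (gaussE (fun x =>
    ((f x - f_ m x) * pe a x + (f_ m x * pe a x - pe r x)) ^+ 2))).
  rewrite le_eqVlt; apply/orP; left; apply/eqP; congr gaussE; apply/funext => x /=; ring.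
apply: le_trans (gaussE_sqrD_le (gd m) _) _.
  by apply: goodB => //; exact: goodM.
lra.
Unshelve. all: by end_near. Qed.

Lemma poly_dense_cst (c : R) : poly_dense (fun=> c).
Proof. exact: (poly_dense_pe (PC c)). Qed.

Lemma poly_denseX f (C : R) k : mfun f -> (forall x, `|f x| <= C) -> poly_dense f ->
  poly_dense (fun x => f x ^+ k).
Proof.
move=> mf fC df; elim: k => [|k IH].
  by under eq_fun do rewrite expr0; exact: poly_dense_cst.
under eq_fun do rewrite exprS.
exact: (poly_denseM (goodX k (good_bounded mf fC)) mf fC IH df).
Qed.

Lemma poly_dense_series f (c : nat -> R) (F : R -> R) g :
  good f -> measurable_fun [set: R] F -> good g ->
  (forall k, poly_dense (fun x => f x ^+ k)) ->
  (forall N x, `|series (fun k => c k * f x ^+ k) N| <= g x) ->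
  (forall x, series (fun k => c k * f x ^+ k) @ \oo --> F (f x)) ->
  poly_dense (fun x => F (f x)).
Proof.
move=> gf mF gg df h1 h2.
have gs N : good (fun x => series (fun k => c k * f x ^+ k) N).
  rewrite /series /=; apply: good_sum => k; apply: goodZ; exact: goodX.
apply: (@poly_dense_lim (fun N x => series (fun k => c k * f x ^+ k) N) _ g) => //.
- by move=> N; exact: (gs N).1.
- by apply: mfun_comp => //; exact: gf.1.
elim=> [|N IH].
  by under eq_fun do rewrite /series /= big_geq//; exact: poly_dense_cst.
under eq_fun do rewrite seriesSr; apply: poly_denseD => //.
  exact/goodZ/goodX.
apply: (@poly_denseM _ (fun=> c N) `|c N|) => //; first exact: goodX.
exact: poly_dense_cst.
Qed.

Lemma series_exp_coeff_le (y : R) N : 0 <= y -> series (exp_coeff y) N <= expR y.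
Proof.
move=> y0; apply: nondecreasing_cvgn_le; last exact: is_cvg_series_exp_coeff.
apply/nondecreasing_seqP => k; rewrite seriesSr lerDl exp_coeff_ge0//.
Qed.

Lemma poly_dense_expR f (C : R) : mfun f -> (forall x, `|f x| <= C) -> poly_dense f ->
  poly_dense (fun x => expR (f x)).
Proof.
move=> mf fC df; have gf := good_bounded mf fC.
apply: (@poly_dense_series f (fun k => (k`!%:R)^-1) (@expR R) (fun=> expR C)) => //.
- exact: good_cst.
- by move=> k; exact: (poly_denseX _ mf fC).
- move=> N x; apply: (@le_trans _ _ (series (exp_coeff `|f x|) N)).
    apply: le_trans (ler_norm_sum _ _ _) _; apply: ler_sum => k _.
    by rewrite /exp_coeff /= normrM normrX normfV normr_nat mulrC.
  by rewrite (le_trans (series_exp_coeff_le _ _))// ler_expR.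
move=> x; rewrite (_ : (fun k => _) = exp_coeff (f x)).
  exact: is_cvg_series_exp_coeff.
by apply/funext => k; rewrite /exp_coeff /= mulrC.
Qed.

Lemma poly_dense_inv f (C : R) : mfun f -> (forall x, 1 <= f x <= C) -> poly_dense f ->
  poly_dense (fun x => (f x)^-1).
Proof.
move=> mf f1C df.
have C1 : 1 <= C by have /andP[h1 h2] := f1C 0; exact: le_trans h2.
have C0 : 0 < C by exact: lt_le_trans C1.
(* 1 / f is C^-1 times the geometric series in g, whose values lie in [0, 1[. *)
pose g x := 1 - C^-1 * f x.
have g01 x : 0 <= g x < 1.
  have /andP[h1 h2] := f1C x.
  rewrite subr_ge0 mulrC ler_pdivrMr// mul1r h2/= ltrBlDr ltrDl.
  by rewrite mulr_gt0 ?invr_gt0// (lt_le_trans _ h1).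
have fC x : `|f x| <= C.
  by have /andP[h1 h2] := f1C x; rewrite ger0_norm// (le_trans _ h1).
have mg : mfun g.
  apply: mfunD; first exact: mfun_cst.
  by apply: (mfun_comp (g := fun y => - (C^-1 * y))) => //; apply: measurableT_comp => //;
    exact: measurable_funM.
have gg x : `|g x| <= 1 by have /andP[h1 h2] := g01 x; rewrite ger0_norm// ltW.
have dg : poly_dense g.
  have -> : g = fun x => 1 + (- C^-1) * f x by apply/funext => x; rewrite /g mulNr.
  apply: poly_denseD; first exact: good_cst.
  - exact/goodZ/(good_bounded mf fC).
  - exact: poly_dense_cst.
  apply: (@poly_denseM _ (fun=> - C^-1) `|- C^-1|) => //.
  - exact: good_bounded fC.
  - exact: poly_dense_cst.
have ge_ x : series (fun k => C^-1 * g x ^+ k) @ \oo --> (C * (1 - g x))^-1.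
  have /andP[h1 h2] := g01 x; rewrite invfM.
  by apply: (@cvg_geometric_series R C^-1 (g x)); rewrite ger0_norm.
have E x : C * (1 - g x) = f x by rewrite /g opprB addrC subrK mulrA mulfV ?mul1r// gt_eqF.
(* The absolute value keeps the denominator positive, so that [F] is continuous on the whole line;
   on the range of [g] it is 1 / f. *)
pose F (y : R) := (1 + `|C * (1 - y) - 1|)^-1.
have FE x : F (g x) = (f x)^-1.
  have /andP[h _] := f1C x; rewrite /F E ger0_norm ?subr_ge0// addrC subrK//.
have -> : (fun x => (f x)^-1) = (fun x => F (g x)) by apply/funext => x; rewrite FE.
apply: (@poly_dense_series g (fun=> C^-1) F (fun=> 1)) => //.
- exact: good_bounded gg.
- apply: continuous_measurable_fun => y; apply: cvgV; first by rewrite gt_eqF// ltr_wpDr.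
  apply: cvgD; first exact: cvg_cst.
  apply: cvg_norm; apply: cvgB; last exact: cvg_cst.
  by apply: cvgM; [exact: cvg_cst|apply: cvgB; [exact: cvg_cst|exact: cvg_id]].
- exact: good_cst.
- by move=> k; exact: (poly_denseX _ mg gg).
- move=> N x; have /andP[h1 h2] := g01 x; rewrite ger0_norm; last first.
  by apply: sumr_ge0 => k _; rewrite mulr_ge0 ?invr_ge0 ?(ltW C0)// exprn_ge0.
apply: (@le_trans _ _ (C * (1 - g x))^-1); last first.
  by rewrite E; have /andP[h3 _] := f1C x; rewrite invf_le1// (lt_le_trans _ h3).
have := ge_ x; move/cvgP: (ge_ x) => cv /(cvg_lim (@Rhausdorff R)) <-.
apply: nondecreasing_cvgn_le => //.
apply/nondecreasing_seqP => k; rewrite seriesSr lerDl.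
by rewrite mulr_ge0 ?invr_ge0 ?(ltW C0)// exprn_ge0.
- by move=> x; rewrite FE -E; exact: ge_.
Qed.

(** The partial sums are bounded by exp |p|, which has exponential growth because p grows linearly.
    The powers of p are polynomials, so p itself may be unbounded. *)
Lemma poly_dense_sin (p : pexp) (K : nat) :
  (forall x, `|pe p x| <= K%:R * (1 + l1norm x)) -> poly_dense (fun x => sin (pe p x)).
Proof.
move=> pK.
pose c k : R := (odd k)%:R * (-1) ^+ k.-1./2 * (k`!%:R)^-1.
have cE (y : R) : (fun k => c k * y ^+ k) = sin_coeff y by rewrite sin_coeffE.
apply: (@poly_dense_series (pe p) c (@sin R) (fun x => expR (K%:R * (1 + l1norm x)))) => //.
- by apply: continuous_measurable_fun; exact: continuous_sin.
- exact: good_expl1.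
- move=> k; elim: k => [|k IH].
    by under eq_fun do rewrite expr0; exact: poly_dense_cst.
  have [q qE] : exists q : pexp, (fun x => pe p x ^+ k.+1) = pe q.
    elim: {IH}(k.+1) => [|m [q IH]].
      by exists (PC 1); apply/funext => x; rewrite expr0.
    by exists (PM p q); apply/funext => x; rewrite exprS /= -IH.
  by rewrite qE; exact: poly_dense_pe.
- move=> N x; apply: (@le_trans _ _ (series (exp_coeff `|pe p x|) N)).
    apply: le_trans (ler_norm_sum _ _ _) _; apply: ler_sum => k _.
    rewrite /c /exp_coeff /= !normrM normfV !normr_nat !normrX normrN normr1 expr1n mulr1.
    rewrite -mulrA [_^-1 * _]mulrC; case: odd; rewrite ?mul1r// mul0r.
    by rewrite mulr_ge0 ?invr_ge0.
  by rewrite (le_trans (series_exp_coeff_le _ _))// ler_expR.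
by move=> x; rewrite cE unlock; exact: is_cvg_series_sin_coeff.
Qed.

Lemma cvg_scaled_sin (y : R) : (fun m => m.+1%:R * sin (y / m.+1%:R)) @ \oo --> y.
Proof.
have [y0|y0] := eqVneq (y) 0.
  by rewrite y0; under eq_fun do rewrite mul0r sin0 mulr0; exact: cvg_cst.
have ds0 : is_derive (0 : R) 1 (@sin R) 1.
  by have := is_derive_sin (0 : R); rewrite cos0.
have hs : (fun h : R => h^-1 * sin h) @ 0^' --> (1 : R).
  have := @ex_derive _ _ _ _ _ _ _ ds0; rewrite /derivable => h.
  have := @derive_val _ _ _ _ _ _ _ ds0; rewrite /derive => <-.
  have -> : (fun h : R => h^-1 * sin h) =
      (fun h : R => h^-1 *: ((@sin R \o shift 0) (h *: 1) - sin 0)).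
    by apply/funext => z /=; rewrite sin0 subr0 addr0 /GRing.scale/= mulr1.
  exact: h.
have hu := (cvgr_dnbhsP _ _ _).1 hs (fun m => y / m.+1%:R) _.
have -> : (fun m => m.+1%:R * sin (y / m.+1%:R)) = fun m => y * ((y / m.+1%:R)^-1 * sin (y / m.+1%:R)).
  by apply/funext => m; rewrite invfM invrK !mulrA mulfV// mul1r.
rewrite -[X in _ --> X]mulr1; apply: cvgM; first exact: cvg_cst.
apply: hu; split; first by move=> m; rewrite mulf_neq0// invr_neq0// pnatr_eq0.
rewrite -[X in _ --> X](mulr0 (y)); apply: cvgM; first exact: cvg_cst.
exact: cvg_harmonic.
Qed.

(* 1 / (1 + exp z) is the limit of 1 / (1 + exp (m sin (z / m))), which is obtained from
   polynomials by convergent power series with integrable majorants. *)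
Lemma poly_dense_logistic (p : pexp) (K : nat) :
  (forall x, `|pe p x| <= K%:R * (1 + l1norm x)) -> poly_dense (fun x => logistic (pe p x)).
Proof.
move=> pK.
have mp : mfun (pe p) by exact: (good_pe p).1.
have csin : continuous (@sin R) by exact: continuous_sin.
pose s_ m x := m.+1%:R * sin (pe p x / m.+1%:R).
have ms m : mfun (s_ m).
  apply: (mfun_comp (g := fun y : R => m.+1%:R * sin (y / m.+1%:R))) => //.
  apply: measurable_funM => //; apply: measurableT_comp => //.
    exact: continuous_measurable_fun.
  exact: measurable_funM.
have sm m x : `|s_ m x| <= m.+1%:R.
  by rewrite normrM normr_nat ger_pMr// sin_max.
have ds m : poly_dense (s_ m).
  apply: (@poly_denseM _ (fun=> m.+1%:R) m.+1%:R) => //.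
  - apply: (@good_bounded _ _ 1); last by move=> x; exact: sin_max.
    apply: (mfun_comp (g := fun y : R => sin (y / m.+1%:R))) => //.
    apply: measurableT_comp => //; last exact: measurable_funM.
    exact: continuous_measurable_fun.
  - by move=> x; rewrite normr_nat.
  - apply: (@poly_dense_sin (PM p (PC m.+1%:R^-1)) K) => x /=.
    by rewrite normrM normfV normr_nat (le_trans _ (pK x))// ler_piMr// invf_le1// ler1n.
  - exact: poly_dense_cst.
have me m : mfun (fun x => expR (s_ m x)).
  by apply: (mfun_comp (g := @expR R)) => //; exact: measurable_expR.
have f1 m x : 1 <= 1 + expR (s_ m x) <= 1 + expR m.+1%:R.
  by rewrite lerDl expR_ge0 lerD2l ler_expR (le_trans (ler_norm _) (sm m x)).
have mf1 m : mfun (fun x => 1 + expR (s_ m x)).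
  by apply: mfunD => //; exact: mfun_cst.
apply: (@poly_dense_lim (fun m x => logistic (s_ m x)) _ (fun=> 1)) => //.
- by move=> m; apply: mfun_comp => //; exact: measurable_logistic.
- by apply: mfun_comp => //; exact: measurable_logistic.
- exact: good_cst.
- move=> m x; have /andP[h _] := f1 m x.
  by rewrite ger0_norm ?invr_ge0 ?invf_le1// (le_trans _ h)// (lt_le_trans _ h).
- move=> x; apply: cvgV; first by rewrite gt_eqF// ltr_wpDl// expR_gt0.
  apply: cvgD; first exact: cvg_cst.
  apply: (@cvg_comp _ _ _ (s_ ^~ x) (@expR R) \oo (nbhs (pe p x))); last exact: continuous_expR.
  exact: cvg_scaled_sin.
move=> m; apply: (@poly_dense_inv _ (1 + expR m.+1%:R)) => //.
apply: poly_denseD.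
- exact: good_cst.
- apply: (@good_bounded _ _ (expR m.+1%:R)) => // x.
  by rewrite ger0_norm ?expR_ge0// ler_expR (le_trans (ler_norm _) (sm m x)).
- exact: poly_dense_cst.
- exact: poly_dense_expR (ms m) (sm m) (ds m).
Qed.

End polynomial_density.

(** * Smoothed intersections of strips *)

Section logistic_calculus.
Context {R : realType}.
Implicit Types y : R.

Lemma logistic_gt0 y : 0 < logistic y.
Proof. by rewrite invr_gt0 ltr_wpDl// expR_gt0. Qed.

Lemma logistic_lt1 y : logistic y < 1.
Proof. by rewrite invf_lt1 ?ltrDl ?expR_gt0// ltr_wpDl// expR_gt0. Qed.

Lemma logistic_norm y : `|logistic y| <= 1.
Proof. by rewrite ger0_norm ltW// ?logistic_gt0// logistic_lt1. Qed.

Lemma logisticN y : logistic (- y) = 1 - logistic y.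
Proof.
have h := expR_gt0 y; rewrite /logistic expRN; field.
by rewrite !gt_eqF// ?addr_gt0// ltr_wpDl.
Qed.

Lemma is_derive_logistic y : is_derive y 1 logistic (- (logistic y * (1 - logistic y))).
Proof.
have y0 : 1 + expR y != 0 by rewrite gt_eqF// ltr_wpDl// expR_gt0.
have d1 : is_derive y 1 (fun y : R => 1 + expR y) (expR y).
  by apply: is_derive_eq; rewrite /GRing.scale/=; ring.
have d2 := @is_deriveV R (fun y => 1 + expR y) y (expR y) 1 y0 d1.
by apply: is_derive_eq; rewrite /GRing.scale/= /logistic; field.
Qed.

(** Chosen so that exp(- softplus y) is 1 - logistic y; its derivative is minus the logistic
    function, so a product of such weights has an explicit convex potential. *)
Definition softplus y : R := ln (1 + expR (- y)).

Lemma is_derive_softplus y : is_derive y 1 softplus (- logistic y).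
Proof.
have y0 : 0 < 1 + expR (- y) by rewrite ltr_wpDl// expR_gt0.
have d1 : is_derive y 1 (fun y : R => 1 + expR (- y)) (- expR (- y)).
  by apply: is_derive_eq; rewrite /GRing.scale/=; ring.
have d2 : is_derive (1 + expR (- y)) 1 (@ln R) (1 + expR (- y))^-1 by exact: is_derive1_ln.
have d3 := @is_derive1_comp R (@ln R) (fun y => 1 + expR (- y)) y _ _ d2 d1.
have h := expR_gt0 y.
rewrite (_ : - logistic y = (1 + expR (- y))^-1 * (- expR (- y))) => [//|].
rewrite /logistic expRN; field; rewrite !gt_eqF// ltr_wpDl//.
Qed.

Lemma softplus_ge0 y : 0 <= softplus y.
Proof. by rewrite ln_ge0// lerDl expR_ge0. Qed.

Lemma continuous_softplus : continuous softplus.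
Proof.
move=> y; apply: differentiable_continuous; apply/derivable1_diffP.
by have := is_derive_softplus y; case.
Qed.

Lemma expR_softplusN y : expR (- softplus y) = 1 - logistic y.
Proof.
by rewrite -logisticN expRN lnK// posrE ltr_wpDl// expR_gt0.
Qed.

(** Clear for |y| <= 1 / d; beyond that, p (1 - p) decays like exp(- |y|). It makes the terms p z in
    the second derivative of the potential negligible, since the mean of p (1 - p) is O(1 / lam). *)
Lemma logistic_tail d y : 0 < d -> `|y| * (logistic y * (1 - logistic y)) <=
  2 * d + d^-1 * (logistic y * (1 - logistic y)).
Proof.
move=> d0; set v := _ * (1 - _).
have v0 : 0 <= v by rewrite mulr_ge0 ?(ltW (logistic_gt0 _))// subr_ge0 ltW// logistic_lt1.
have [yd|yd] := leP `|y| d^-1.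
  apply: (@le_trans _ _ (d^-1 * v)); first by rewrite ler_wpM2r.
  by rewrite lerDr mulr_ge0// ltW.
have y0 : 0 < `|y| by rewrite (lt_trans _ yd)// invr_gt0.
have hv : v <= expR (- `|y|).
  have aux (z : R) : logistic z * (1 - logistic z) <= expR (- z).
    rewrite -[leRHS]mulr1 ler_pM ?(ltW (logistic_gt0 _))//.
    - by rewrite subr_ge0 ltW// logistic_lt1.
    - by rewrite expRN lef_pV2 ?posrE ?expR_gt0 ?lerDr// ltr_wpDl// expR_gt0.
    - by rewrite gerBl ltW// logistic_gt0.
  have [y1|y1] := leP 0 y; first by rewrite ger0_norm// aux.
  by rewrite ltr0_norm//; have := aux (- y); rewrite logisticN subKr mulrC.
have h2 : `|y| * expR (- `|y|) <= 2 * d.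
  rewrite expRN ler_pdivrMr ?expR_gt0//.
  have h := @expR_ge1Dxn R `|y| 1 (ltW y0).
  have yd1 : 1 <= d * `|y| by rewrite -ler_pdivrMl// mulr1 ltW.
  apply: (@le_trans _ _ (d * `|y| ^+ 2)).
    by rewrite expr2 mulrA ler_peMl// ltW.
  rewrite -mulrA [2 * _]mulrC -mulrA ler_wpM2l ?(ltW d0)// mulrC.
  move: h; rewrite (_ : 2`! = 2%N)//.
  set Y := _ ^+ 2; set E := expR _; lra.
apply: le_trans (ler_wpM2l (ltW y0) hv) _; apply: le_trans h2 _.
by rewrite lerDl mulr_ge0// invr_ge0 ltW.
Qed.

End logistic_calculus.

Section strip_potential.
Context {R : realType} {n : nat} {I : finType}.
Local Notation pexp := (@pexp R n).
Variables (th : I -> 'I_n -> R) (b : I -> R) (lam : R).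

Definition dot (v : 'I_n -> R) (x : 'rV[R]_n) : R := \sum_i v i * x ord0 i.

Definition zeta j (x : 'rV[R]_n) : R := lam * (b j - dot (th j) x).

Definition zpe j : pexp := PM (PC lam) (PA (PC (b j))
  (PM (PC (-1)) (psum (enum 'I_n) (fun i => PM (PC (th j i)) (PX i))))).

Lemma pe_zpe j x : pe (zpe j) x = zeta j x.
Proof. by rewrite /zpe /= pe_sum /= big_enum/= mulN1r. Qed.

Lemma zpeE j : pe (zpe j) = zeta j.
Proof. by apply/funext => x; rewrite pe_zpe. Qed.

Lemma nice_zeta j : nice (zeta j).
Proof. by rewrite -zpeE; exact: nice_pe. Qed.

Lemma pd_zpe i j x : pe (pd i (zpe j)) x = - (lam * th j i).
Proof.
rewrite /zpe /= pd_sum big_enum/= (bigD1 i)//= eqxx big1 => [|k /negbTE ki].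
  by rewrite (_ : true%:R = 1 :> R)//; ring.
by rewrite ki mul0r mulr0 addr0.
Qed.

Lemma partial_zeta i j : partial i (zeta j) (fun=> - (lam * th j i)).
Proof.
have := partial_pe i (zpe j); rewrite zpeE; congr (partial _ _ _).
by apply/funext => x; exact: pd_zpe.
Qed.

Definition prob j (x : 'rV[R]_n) : R := logistic (zeta j x).

Lemma nice_prob j : nice (prob j).
Proof.
by apply: nice_comp (nice_zeta j); [exact: continuous_logistic | move=> x; exact: logistic_norm].
Qed.

Lemma partial_prob i j :
  partial i (prob j) (fun x => lam * th j i * (prob j x * (1 - prob j x))).
Proof.
have := partial_comp is_derive_logistic (partial_zeta i j).
by under [X in partial _ _ X -> _]eq_fun do rewrite mulrNN mulrC.
Qed.

Definition spot (x : 'rV[R]_n) : R := \sum_j softplus (zeta j x).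
Definition spot1 i (x : 'rV[R]_n) : R := \sum_j lam * th j i * prob j x.
Definition spot2 i k (x : 'rV[R]_n) : R :=
  \sum_j lam * th j i * (lam * th j k * (prob j x * (1 - prob j x))).

Lemma spot_wt x : wt spot 1 x = \prod_j (1 - prob j x).
Proof.
rewrite /wt mul1r /spot -sumrN expR_sum; apply: eq_bigr => j _.
exact: expR_softplusN.
Qed.

Lemma var_ge0 j x : 0 <= prob j x * (1 - prob j x).
Proof. by rewrite mulr_ge0 ?(ltW (logistic_gt0 _))// subr_ge0 ltW// logistic_lt1. Qed.

Lemma spot2_quad (x : 'rV[R]_n) (v : 'I_n -> R) :
  \sum_i \sum_k spot2 i k x * v i * v k =
  \sum_j prob j x * (1 - prob j x) * (lam * \sum_i th j i * v i) ^+ 2.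
Proof.
transitivity (\sum_j \sum_i \sum_k
    lam * th j i * (lam * th j k * (prob j x * (1 - prob j x))) * v i * v k).
  rewrite [RHS]exchange_big /=; apply: eq_bigr => i _.
  rewrite [RHS]exchange_big /=; apply: eq_bigr => k _.
  by rewrite /spot2 !mulr_suml.
apply: eq_bigr => j _; rewrite mulr_sumr expr2 big_distrlr /= mulr_sumr.
apply: eq_bigr => i _; rewrite mulr_sumr; apply: eq_bigr => k _; ring.
Qed.

Lemma strip_potential : potential spot spot1 spot2.
Proof.
split.
- by move=> x; apply: sumr_ge0 => j _; exact: softplus_ge0.
- apply: mfun_sum => j; apply: mfun_comp; last exact: (nice_good (nice_zeta j)).1.
  exact: continuous_measurable_fun continuous_softplus.
- move=> x v s; rewrite /spot; elim: (index_enum I) => [|j r IH].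
    rewrite (_ : (fun s : R => _) = fun=> 0); first exact: cst_continuous.
    by apply/funext => t; rewrite big_nil.
  rewrite (_ : (fun s : R => _) = fun s => softplus (zeta j (x + s *: v)) +
    \sum_(j <- r) softplus (zeta j (x + s *: v))); last first.
    by apply/funext => t; rewrite big_cons.
  apply: cvgD => //.
  apply: (@cvg_comp _ _ _ (fun s => zeta j (x + s *: v)) softplus).
    exact: (nice_zeta j).2.
  exact: continuous_softplus.
- by move=> i; apply: nice_sum => j; apply: niceM (nice_cst _) (nice_prob j).
- move=> i k; apply: nice_sum => j; apply: niceM (nice_cst _) _.
  apply: niceM (nice_cst _) _; apply: niceM (nice_prob j) _.
  exact: niceB (nice_cst _) (nice_prob j).
- move=> i; have h j := partial_comp is_derive_softplus (partial_zeta i j).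
  have := partial_sum (index_enum I) xpredT h; congr (partial _ _ _).
  by apply/funext => x; apply: eq_bigr => j _; rewrite mulrNN mulrC.
- by move=> i k; apply: partial_sum => j; apply: partialZ; exact: partial_prob.
- move=> x v; rewrite spot2_quad.
  by apply: sumr_ge0 => j _; rewrite mulr_ge0 ?sqr_ge0 ?var_ge0.
Qed.

Lemma zeta_growth j : exists K : nat, forall x, `|pe (zpe j) x| <= K%:R * (1 + l1norm x).
Proof.
pose C := `|lam| * (`|b j| + \sum_i `|th j i|).
have C0 : 0 <= C by rewrite mulr_ge0// addr_ge0// sumr_ge0.
exists (Num.bound C) => x; rewrite pe_zpe.
have l0 := l1norm_ge0 x.
apply: (@le_trans _ _ (C * (1 + l1norm x))); last first.
  by rewrite ler_wpM2r ?addr_ge0// ltW// archi_boundP.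
rewrite /zeta normrM -mulrA ler_wpM2l//.
apply: le_trans (ler_normB _ _) _; rewrite mulrDl lerD//.
  by rewrite ler_peMr// lerDl.
apply: le_trans (ler_norm_sum _ _ _) _; rewrite mulr_suml; apply: ler_sum => i _.
by rewrite normrM ler_wpM2l// (le_trans (l1norm_coord x i))// lerDr.
Qed.

Lemma strip_dense_range : dense_range spot spot1 prob 1.
Proof.
pose M := \sum_i \sum_j `|lam * th j i|.
apply: (@dense_range1 _ _ _ _ _ strip_potential _ _ (fun i j => lam * th j i) M) => //.
- exact: nice_prob.
- by apply: sumr_ge0 => i _; exact: sumr_ge0.
- move=> x; apply: (@le_trans _ _ (\sum_i M * \sum_j `|lam * th j i|)); last first.
    by rewrite -mulr_sumr expr2.
  apply: ler_sum => i _.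
  have h : `|spot1 i x| <= \sum_j `|lam * th j i|.
    apply: le_trans (ler_norm_sum _ _ _) _; apply: ler_sum => j _.
    by rewrite normrM ler_piMr// logistic_norm.
  have hM : \sum_j `|lam * th j i| <= M.
    by rewrite /M (bigD1 i)//= lerDl; apply: sumr_ge0 => k _; exact: sumr_ge0.
  rewrite -[leLHS]real_normK ?num_real// expr2 ler_pM//.
  exact: le_trans hM.
- move=> j a e e0; have [K hK] := zeta_growth j.
  have [r hr] := poly_dense_logistic hK a e0; exists r.
  by rewrite zpeE in hr.
Qed.

Variables (inv : I -> I).
Hypothesis invK : involutive inv.
Hypothesis th_inv : forall j i, th (inv j) i = - th j i.
Hypothesis b_inv : forall j, b (inv j) = b j.

Lemma dotN v x : dot v (- x) = - dot v x.
Proof. by rewrite /dot -sumrN; apply: eq_bigr => i _; rewrite mxE mulrN. Qed.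

Lemma zeta_inv j x : zeta (inv j) x = zeta j (- x).
Proof.
rewrite /zeta b_inv dotN; congr (_ * (_ - _)).
by rewrite /dot -sumrN; apply: eq_bigr => i _; rewrite th_inv mulNr.
Qed.

(** [inv] pairs each half-space with its reflection in the origin. *)
Lemma spot_even x : spot (- x) = spot x.
Proof.
rewrite /spot [RHS](reindex_inj (can_inj invK)) /=.
by apply: eq_bigr => j _; rewrite zeta_inv.
Qed.

Variables (c : R) (d : I -> R).
Hypothesis d_inv : forall j, d (inv j) = d j.

(* Derivatives in tau of zeta and of the potential along b(tau) = b + tau d and
   lam(tau) = lam exp(- c tau); this choice makes grad Wdot + c grad W quadratic. *)
Definition zdot j (x : 'rV[R]_n) : R := lam * d j - c * zeta j x.
Definition Wdot (x : 'rV[R]_n) : R := - \sum_j prob j x * zdot j x.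

Lemma nice_zdot j : nice (zdot j).
Proof. by apply: niceB (nice_cst _) _; apply: niceM (nice_cst _) (nice_zeta j). Qed.

Lemma nice_Wdot : nice Wdot.
Proof. by apply/niceN/nice_sum => j; exact: niceM (nice_prob j) (nice_zdot j). Qed.

Lemma pbarrier_Wdot : pbarrier prob Wdot.
Proof.
exists (PC 0), (fun j => PA (PC (- (lam * d j))) (PM (PC c) (zpe j))).
apply/funext => x; rewrite [pe (PC 0) x]/= add0r /Wdot -sumrN; apply: eq_bigr => j _.
transitivity (prob j x * (- (lam * d j) + c * pe (zpe j) x)) => [|//].
by rewrite pe_zpe /zdot; ring.
Qed.

Lemma Wdot_even x : Wdot (- x) = Wdot x.
Proof.
rewrite /Wdot; congr (- _); rewrite [RHS](reindex_inj (can_inj invK)) /=.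
by apply: eq_bigr => j _; rewrite /prob /zdot zeta_inv d_inv.
Qed.

Lemma partial_Wdot i : partial i Wdot
  (fun x => - c * spot1 i x - \sum_j lam * th j i * (prob j x * (1 - prob j x)) * zdot j x).
Proof.
have h j : partial i (fun x => prob j x * zdot j x) (fun x =>
    lam * th j i * (prob j x * (1 - prob j x)) * zdot j x + prob j x * (c * (lam * th j i))).
  apply: partialM; first exact: partial_prob.
  have := partialB (partial_cst i (lam * d j)) (partialZ c (partial_zeta i j)).
  by congr (partial _ _ _); apply/funext => x; ring.
have := partialN (partial_sum (index_enum I) xpredT h); congr (partial _ _ _).
apply/funext => x; rewrite /spot1 mulr_sumr -sumrN -sumrB /=.
by apply: eq_bigr => j _; ring.
Qed.

(** The part of the second tau-derivative of the potential that is quadratic in [zdot]. The variance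
    bound produces exactly this term, so it cancels in Z''. *)
Definition pinch (x : 'rV[R]_n) : R := \sum_j prob j x * (1 - prob j x) * zdot j x ^+ 2.

Lemma nice_pinch : nice pinch.
Proof.
apply: nice_sum => j; apply: niceM; last exact: niceX (nice_zdot j).
apply: niceM (nice_prob j) _; exact: niceB (nice_cst _) (nice_prob j).
Qed.

(** In [variance_le] the drift terms with [c] cancel, and each strip contributes p (1 - p) (2 g zdot
    - g^2), where g is the derivative of u along [lam * th j]; completing the square bounds this by
    [pinch], whatever u is. *)
Lemma strip_variance :
  avg spot 1 (fun x => Wdot x ^+ 2) - avg spot 1 Wdot ^+ 2 / avg spot 1 (fun=> 1) <=
  avg spot 1 pinch + c ^+ 2 * (n%:R * avg spot 1 (fun=> 1) - avg spot 1 rad2).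
Proof.
apply/ler_addgt0Pr => e e0.
have nF' i : nice (fun x => - c * spot1 i x -
    \sum_j lam * th j i * (prob j x * (1 - prob j x)) * zdot j x).
  apply: niceB; first by apply: niceM (nice_cst _) _; exact: (pot1_nice strip_potential).
  apply: nice_sum => j; apply: niceM; last exact: nice_zdot.
  apply: niceM (nice_cst _) _; apply: niceM (nice_prob j) _.
  exact: niceB (nice_cst _) (nice_prob j).
have [u hu] := variance_le strip_potential nice_prob strip_dense_range spot_even c
  pbarrier_Wdot Wdot_even nF' partial_Wdot e0.
apply: le_trans hu _; rewrite !lerD2r.
apply: (avg_le strip_potential) => //.
- apply: niceN; apply: niceD; first exact: (nice_hessW strip_potential).
  apply: niceM (nice_cst _) _; apply: nice_sum => i; apply: niceM; last exact: nice_pe.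
  apply: niceD (nF' i) _; apply: niceM (nice_cst _) _; exact: (pot1_nice strip_potential).
- exact: nice_pinch.
move=> x; rewrite -subr_ge0 opprK.
pose g j := lam * \sum_i th j i * pe (pd i u) x.
rewrite /hessW spot2_quad.
have -> : \sum_i (- c * spot1 i x -
      \sum_j lam * th j i * (prob j x * (1 - prob j x)) * zdot j x + c * spot1 i x) *
      pe (pd i u) x = \sum_j - (prob j x * (1 - prob j x) * g j * zdot j x).
  transitivity (\sum_i \sum_j - (lam * th j i * (prob j x * (1 - prob j x)) * zdot j x *
      pe (pd i u) x)).
    apply: eq_bigr => i _; rewrite [X in X * _](_ : _ =
      - \sum_j lam * th j i * (prob j x * (1 - prob j x)) * zdot j x); last by ring.
    by rewrite -sumrN mulr_suml; apply: eq_bigr => j _; rewrite mulNr.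
  rewrite exchange_big /=; apply: eq_bigr => j _; rewrite sumrN; congr (- _).
  rewrite /g !mulr_sumr !mulr_suml; apply: eq_bigr => i _; ring.
rewrite mulr_sumr -!big_split /=; apply: sumr_ge0 => j _; rewrite -/(g j).
rewrite [leRHS](_ : _ = prob j x * (1 - prob j x) * (zdot j x - g j) ^+ 2); last by ring.
by rewrite mulr_ge0 ?sqr_ge0 ?var_ge0.
Qed.

End strip_potential.

(** * From smoothed strips to sharp strips *)

Section pinching_bounds.
Context {R : realType} {n : nat} {I : finType}.
Variable th : I -> 'I_n -> R.

Definition sind (b : I -> R) (x : 'rV[R]_n) : R := [forall j, (dot (th j) x <= b j)%R]%:R.

Lemma nice_var b (lam : R) j : nice (fun x => prob th b lam j x * (1 - prob th b lam j x)).
Proof. apply: niceM (nice_prob _ _ _ j) _; exact: niceB (nice_cst _) (nice_prob _ _ _ j). Qed.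

Lemma good_dot v : good (@dot R n v).
Proof. by apply: good_sum => i; apply: goodM; [exact: good_cst|exact: good_coord]. Qed.

Lemma sindE b x : sind b x = \prod_j (dot (th j) x <= b j)%R%:R.
Proof.
rewrite /sind; case: (boolP [forall j, _]) => [/forallP h|]; last first.
  by rewrite negb_forall => /existsP[j /negbTE h]; rewrite (bigD1 j)//= h mul0r.
by rewrite big1// => j _; rewrite h.
Qed.

Lemma sind_itv b x : 0 <= sind b x <= 1.
Proof. by rewrite /sind; case: [forall j, _]; rewrite ?lexx ?ler01. Qed.

Lemma good_sind b : good (sind b).
Proof.
apply: (@good_bounded _ _ 1); last first.
  by move=> x; have /andP[h1 h2] := sind_itv b x; rewrite ger0_norm.
have -> : sind b = fun x => \prod_j (dot (th j) x <= b j)%R%:R.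
  by apply/funext => x; exact: sindE.
elim: (index_enum I) => [|j r IH].
  by under eq_fun do rewrite big_nil; exact: mfun_cst.
rewrite (_ : (fun x => _) = fun x => (dot (th j) x <= b j)%R%:R *
  \prod_(j <- r) (dot (th j) x <= b j)%R%:R); last first.
  by apply/funext => x; rewrite big_cons.
apply: mfunM; last exact: IH.
exact: (good_sublevel _ (good_dot _).1).1.
Qed.

(* The derivative of prob j along e_i is lam (th j i) p (1 - p), so integrate it by parts for
   some i with th j i <> 0. *)
Lemma gaussE_var_le : (forall j, exists i, th j i != 0) ->
  exists2 C : R, 0 <= C & forall b (lam : R) j, 0 < lam ->
    gaussE (fun x => prob th b lam j x * (1 - prob th b lam j x)) <= C / lam.
Proof.
move=> thN0.
have gx i : good (fun x : 'rV[R]_n => `|x ord0 i|) by exact/good_norm/good_coord.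
have E0 i : 0 <= gaussE (fun x : 'rV[R]_n => `|x ord0 i|) by exact: gaussE_ge0.
pose C := \sum_j \sum_i gaussE (fun x : 'rV[R]_n => `|x ord0 i|) / `|th j i|.
have C0 j i : 0 <= gaussE (fun x : 'rV[R]_n => `|x ord0 i|) / `|th j i|.
  by rewrite divr_ge0.
exists C; first by apply: sumr_ge0 => j _; apply: sumr_ge0.
move=> b lam j lam0; have [i hi] := thN0 j.
apply: (@le_trans _ _ (gaussE (fun x : 'rV[R]_n => `|x ord0 i|) / `|th j i| / lam)); last first.
  rewrite ler_wpM2r ?invr_ge0 ?(ltW lam0)//.
  rewrite {}/C [leRHS](bigD1 j)//= [X in _ <= X + _](bigD1 i)//= -addrA lerDl.
  by apply: addr_ge0; do ?[apply: sumr_ge0 => ? _].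
have np := nice_prob th b lam j; have nv := nice_var b lam j.
have := gaussE_ibp np (niceM (nice_cst (lam * th j i)) nv) (partial_prob th b lam i j).
rewrite gaussEZ; last exact: nice_good.
set v := gaussE _ => h.
have v0 : 0 <= v by apply: gaussE_ge0 => x; exact: var_ge0.
have : `|lam * th j i * v| <= gaussE (fun x : 'rV[R]_n => `|x ord0 i|).
  have gp : good (fun x => x ord0 i * prob th b lam j x).
    by apply: goodM; [exact: good_coord|exact: nice_good].
  have px (x : 'rV[R]_n) : `|x ord0 i * prob th b lam j x| <= `|x ord0 i|.
    by rewrite normrM ler_piMr// logistic_norm.
  rewrite h ler_norml; apply/andP; split.
    rewrite lerNl -mulN1r -gaussEZ//; apply: gaussE_le => //; first exact: goodZ.
    by move=> x; rewrite mulN1r (le_trans _ (px x))// -normrN ler_norm.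
  by apply: gaussE_le => // x; rewrite (le_trans _ (px x))// ler_norm.
rewrite !normrM (gtr0_norm lam0) (ger0_norm v0) => h2.
rewrite !ler_pdivlMr ?normr_gt0//; apply: le_trans h2; rewrite le_eqVlt; apply/orP; left.
by apply/eqP; ring.
Qed.

(** Serves to replace w p by p (1 - p), which is small in mean. *)
Lemma wt_spot_le b (lam : R) j x : wt (spot th b lam) 1 x <= 1 - prob th b lam j x.
Proof.
have p1 k : 0 <= 1 - prob th b lam k x by rewrite subr_ge0 ltW// logistic_lt1.
rewrite spot_wt (bigD1 j)//= ler_piMr// prodr_ile1// => k _; rewrite p1/=.
by rewrite gerBl ltW// logistic_gt0.
Qed.

Lemma prod_dist_le (J : Type) (r : seq J) (u v : J -> R) :
  (forall j, 0 <= u j <= 1) -> (forall j, 0 <= v j <= 1) ->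
  `|\prod_(j <- r) u j - \prod_(j <- r) v j| <= \sum_(j <- r) `|u j - v j|.
Proof.
move=> u01 v01; elim: r => [|j r IH]; first by rewrite !big_nil subrr normr0.
rewrite !big_cons.
have -> : u j * \prod_(j <- r) u j - v j * \prod_(j <- r) v j =
    (u j - v j) * \prod_(j <- r) u j + v j * (\prod_(j <- r) u j - \prod_(j <- r) v j).
  ring.
apply: le_trans (ler_normD _ _) _; rewrite !normrM; apply: lerD.
  rewrite ler_piMr// ger0_norm; first by apply: prodr_ile1 => k _; exact: u01.
  by apply: prodr_ge0 => k _; have /andP[] := u01 k.
have /andP[v0 v1] := v01 j; rewrite (ger0_norm v0).
by apply: le_trans IH; rewrite ler_piMl.
Qed.

(** Inside a half-space p <= 1/2 and outside 1 - p <= 1/2, so each factor errs by at most 2 p (1 -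
    p). *)
Lemma wt_sind_dist b (lam : R) x : 0 < lam ->
  `|wt (spot th b lam) 1 x - sind b x| <=
  2 * \sum_j prob th b lam j x * (1 - prob th b lam j x).
Proof.
move=> lam0; rewrite spot_wt sindE.
apply: le_trans (prod_dist_le _ _ _) _.
- move=> j; rewrite subr_ge0 ltW ?logistic_lt1//= gerBl ltW// logistic_gt0//.
- by move=> j; case: (dot (th j) x <= b j)%R; rewrite ?lexx ?ler01.
rewrite mulr_sumr; apply: ler_sum => j _.
have p0 := logistic_gt0 (zeta th b lam j x); have p1 := logistic_lt1 (zeta th b lam j x).
rewrite -/(prob th b lam j x) in p0 p1.
have v0 := var_ge0 th b lam j x.
have [h|h] := leP (dot (th j) x) (b j).
  have p2 : prob th b lam j x <= 2^-1.
    rewrite lef_pV2 ?posrE ?ltr_wpDl ?expR_gt0// -[2]/(1 + 1) lerD2l -expR0 ler_expR.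
    by rewrite mulr_ge0 ?(ltW lam0)// subr_ge0.
  rewrite addrAC subrr sub0r normrN ger0_norm ?(ltW p0)//.
  rewrite mulrCA -[leLHS]mulr1 ler_wpM2l ?(ltW p0)//; lra.
have p2 : 2^-1 <= prob th b lam j x.
  rewrite lef_pV2 ?posrE ?ltr_wpDl ?expR_gt0// -[X in _ <= X]/(1 + 1) lerD2l -expR0 ler_expR.
  by rewrite mulr_ge0_le0 ?(ltW lam0)// subr_le0 ltW.
rewrite subr0 ger0_norm ?subr_ge0 ?(ltW p1)// mulrA -[leLHS]mul1r.
rewrite ler_wpM2r ?subr_ge0 ?(ltW p1)//.
lra.
Qed.

Lemma wt_sind_gaussE b (lam : R) : 0 < lam ->
  `|gaussE (wt (spot th b lam) 1) - gaussE (sind b)| <=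
  2 * \sum_j gaussE (fun x => prob th b lam j x * (1 - prob th b lam j x)).
Proof.
move=> lam0; have gs := good_sind b; have gv j := nice_good (nice_var b lam j).
have gw : good (wt (spot th b lam) 1) := nice_good (nice_wt (strip_potential th b lam) ler01).
pose V (x : 'rV[R]_n) := \sum_j prob th b lam j x * (1 - prob th b lam j x).
have gV : good V by exact: good_sum.
have gd := goodB gw gs; have gd' := goodB gs gw.
rewrite -gaussE_sum// -gaussEZ// -gaussEB// ler_norml; apply/andP; split.
  rewrite lerNl -mulN1r -gaussEZ//; apply: gaussE_le; [exact: goodZ|exact: goodZ|] => x.
  by rewrite mulN1r (le_trans (ler_norm _))// normrN; exact: wt_sind_dist.
apply: gaussE_le => //; first exact: goodZ.
by move=> x; rewrite (le_trans (ler_norm _))//; exact: wt_sind_dist.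
Qed.

End pinching_bounds.

(** * The moving strips and the second derivative of their mass *)

Section strip_flow.
Context {R : realType} {n : nat} {I : finType}.
Variables (th : I -> 'I_n -> R) (h d : I -> R) (inv : I -> I).
Hypothesis invK : involutive inv.
Hypothesis th_inv : forall j i, th (inv j) i = - th j i.
Hypothesis h_inv : forall j, h (inv j) = h j.
Hypothesis d_inv : forall j, d (inv j) = d j.
Hypothesis thN0 : forall j, exists i, th j i != 0.
Variables (c lam0 : R).
Hypothesis lam0_gt0 : 0 < lam0.

Let lam t : R := lam0 * expR (- (c * t)).
Let b t j : R := h j + t * d j.
Let z t j x := zeta th (b t) (lam t) j x.
Let p t j x := prob th (b t) (lam t) j x.
Let zd t j x := zdot th (b t) (lam t) c d j x.
Let W t x := spot th (b t) (lam t) x.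
Let Wd t x := Wdot th (b t) (lam t) c d x.
Let pin t x := pinch th (b t) (lam t) c d x.
Let w t x := wt (W t) 1 x.
Let Wdd t x : R := pin t x - 2 * c * Wd t x + c ^+ 2 * \sum_j p t j x * z t j x.

Lemma b_inv (t : R) j : b t (inv j) = b t j.
Proof. by rewrite /b h_inv d_inv. Qed.

Lemma lam_gt0 (t : R) : 0 < lam t.
Proof. by rewrite mulr_gt0// expR_gt0. Qed.

Lemma is_derive_lam (t : R) : is_derive t 1 lam (- c * lam t).
Proof. by apply: is_derive_eq; rewrite /GRing.scale/= /lam; ring. Qed.

Lemma is_derive_zeta (t : R) j x : is_derive t 1 (fun t => z t j x) (zd t j x).
Proof.
have dl := is_derive_lam t.
have db : is_derive t 1 (fun t => h j + t * d j - dot (th j) x) (d j).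
  by apply: is_derive_eq; rewrite /GRing.scale/=; ring.
have dm := is_deriveM dl db.
rewrite (_ : zd t j x = lam t *: d j + (h j + t * d j - dot (th j) x) *: (- c * lam t)).
  exact: dm.
by rewrite /GRing.scale/= /zd /zdot /zeta /b; ring.
Qed.

(** As [z] is exp(- c t) times an affine function of t, it solves (d/dt + c)^2 z = 0. This is where
    the law of [lam] enters the second derivative of the potential. *)
Lemma is_derive_zdot (t : R) j x :
  is_derive t 1 (fun t => zd t j x) (- (2 * c) * zd t j x - c ^+ 2 * z t j x).
Proof.
have dl := is_derive_lam t; have dz := is_derive_zeta t j x.
apply: is_derive_eq; rewrite /GRing.scale/= /zd /zdot /z; ring.
Qed.

Lemma is_derive_prob (t : R) j x :
  is_derive t 1 (fun t => p t j x) (- (p t j x * (1 - p t j x)) * zd t j x).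
Proof.
exact: (@is_derive1_comp R (@logistic R) (fun t => z t j x) _ _ _
  (is_derive_logistic _) (is_derive_zeta t j x)).
Qed.

Lemma is_derive_spot (t : R) x : is_derive t 1 (fun t => W t x) (Wd t x).
Proof.
rewrite /W /Wd /spot /Wdot -sumrN; elim: (index_enum I) => [|j r IH].
  rewrite big_nil (_ : (fun t => _) = fun=> 0); first exact: is_derive_cst.
  by apply/funext => s; rewrite big_nil.
rewrite big_cons (_ : (fun t => _) = fun t => softplus (z t j x) +
    \sum_(j <- r) softplus (zeta th (b t) (lam t) j x)); last first.
  by apply/funext => s; rewrite big_cons.
apply: is_deriveD; rewrite -mulNr.
exact: (@is_derive1_comp R (@softplus R) (fun t => z t j x) _ _ _
  (is_derive_softplus _) (is_derive_zeta t j x)).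
Qed.

Lemma is_derive_Wdot (t : R) x : is_derive t 1 (fun t => Wd t x) (Wdd t x).
Proof.
rewrite (_ : Wdd t x = \sum_j (p t j x * (1 - p t j x) * zd t j x ^+ 2 +
    2 * c * p t j x * zd t j x + c ^+ 2 * (p t j x * z t j x))); last first.
  rewrite /Wdd /pin /pinch /Wd /Wdot -/(p t) !big_split /= mulr_sumr; congr (_ + _ + _).
  by rewrite mulrN opprK mulr_sumr; apply: eq_bigr => j _; rewrite mulrA.
rewrite (_ : (fun t => Wd t x) = fun t => \sum_j - (p t j x * zd t j x)); last first.
  by apply/funext => s; rewrite sumrN.
elim: (index_enum I) => [|j r IH].
  rewrite big_nil (_ : (fun t => _) = fun=> 0); first exact: is_derive_cst.
  by apply/funext => s; rewrite big_nil.
rewrite big_cons (_ : (fun t => _) = fun t => - (p t j x * zd t j x) +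
    \sum_(j <- r) - (p t j x * zd t j x)); last first.
  by apply/funext => s; rewrite big_cons.
apply: is_deriveD.
have dp := is_derive_prob t j x; have dz := is_derive_zdot t j x.
apply: is_derive_eq; rewrite /GRing.scale/=; ring.
Qed.

Lemma is_derive_w (t : R) x : is_derive t 1 (fun t => w t x) (- Wd t x * w t x).
Proof.
have dW := is_derive_spot t x.
have dN : is_derive t 1 (fun t => - (1 * W t x)) (- Wd t x).
  by apply: is_derive_eq; rewrite /GRing.scale/=; ring.
have := @is_derive1_comp R (@expR R) (fun t => - (1 * W t x)) _ _ _ (is_derive_expR _) dN.
by rewrite mulrC.
Qed.

Lemma is_derive_w2 (t : R) x :
  is_derive t 1 (fun t => - Wd t x * w t x) ((Wd t x ^+ 2 - Wdd t x) * w t x).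
Proof.
have dW := is_derive_Wdot t x; have dw := is_derive_w t x.
apply: is_derive_eq; rewrite /GRing.scale/=; ring.
Qed.

(** Majorants of [z] and [zd], uniform for -1 < t < 2: differentiating under the expectation at the
    end points of [0, 1] takes a neighbourhood, and there |c t| <= 2 |c|. *)
Let A j (x : 'rV[R]_n) : R := lam0 * expR (2 * `|c|) *
  (`|h j| + 2 * `|d j| + \sum_i `|th j i| * `|x ord0 i|).
Let B (x : 'rV[R]_n) : R := \sum_j (lam0 * expR (2 * `|c|) * `|d j| + (`|c| + 1) * A j x).

Let A_ge0 j x : 0 <= A j x.
Proof.
rewrite mulr_ge0 ?(mulr_ge0 (ltW lam0_gt0)) ?expR_ge0// !addr_ge0// ?mulr_ge0//.
by apply: sumr_ge0 => i _; exact: mulr_ge0.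
Qed.

Let Bj_ge0 j x : 0 <= lam0 * expR (2 * `|c|) * `|d j| + (`|c| + 1) * A j x.
Proof.
rewrite addr_ge0// mulr_ge0 ?A_ge0 ?addr_ge0//.
by rewrite (mulr_ge0 (ltW lam0_gt0)) ?expR_ge0.
Qed.

Let le_B j x : lam0 * expR (2 * `|c|) * `|d j| + (`|c| + 1) * A j x <= B x.
Proof. by rewrite /B [leRHS](bigD1 j)//= lerDl sumr_ge0// => k _; exact: Bj_ge0. Qed.

Let good_B : good B.
Proof.
apply: good_sum => j; apply: goodD; first exact: good_cst.
apply: goodZ; apply: goodZ; apply: goodD; first exact: good_cst.
by apply: good_sum => i; apply: goodZ; apply/good_norm/good_coord.
Qed.

Let lam_le (t : R) : -1 < t < 2 -> lam t <= lam0 * expR (2 * `|c|).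
Proof.
move=> /andP[t1 t2]; rewrite ler_wpM2l ?(ltW lam0_gt0)// ler_expR.
rewrite (le_trans (ler_norm _))// normrN normrM mulrC ler_wpM2r// ler_norml; lra.
Qed.

Let z_le (t : R) j x : -1 < t < 2 -> `|z t j x| <= A j x.
Proof.
move=> t12; rewrite /z /zeta normrM ler_pM//.
  by rewrite gtr0_norm ?lam_gt0// lam_le.
apply: le_trans (ler_normB _ _) _; apply: lerD.
  apply: le_trans (ler_normD _ _) _; rewrite lerD2l normrM ler_wpM2r//.
  by move: t12 => /andP[t1 t2]; rewrite ler_norml; lra.
by apply: le_trans (ler_norm_sum _ _ _) _; apply: ler_sum => i _; rewrite normrM.
Qed.

Let z_leB (t : R) j x : -1 < t < 2 -> `|z t j x| <= B x.
Proof.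
move=> t12; apply: le_trans (z_le j x t12) _; apply: le_trans (le_B j x).
rewrite -[leLHS]add0r lerD//.
  by rewrite mulr_ge0// (mulr_ge0 (ltW lam0_gt0)) ?expR_ge0.
by rewrite -[leLHS]mul1r ler_wpM2r ?A_ge0// lerDr.
Qed.

Let zd_leB (t : R) j x : -1 < t < 2 -> `|zd t j x| <= B x.
Proof.
move=> t12; apply: le_trans (le_B j x).
rewrite /zd /zdot; apply: le_trans (ler_normB _ _) _; rewrite (normrM (lam t)) (normrM c); apply: lerD.
  by rewrite ler_wpM2r// gtr0_norm ?lam_gt0// lam_le.
rewrite ler_pM// ?lerDl//; exact: (z_le j x t12).
Qed.

Let B_ge0 x : 0 <= B x. Proof. by apply: sumr_ge0 => j _; exact: Bj_ge0. Qed.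

Let N : R := #|I|%:R.

Let sum_le (f : I -> R) C : (forall j, `|f j| <= C) -> `|\sum_j f j| <= N * C.
Proof.
move=> fC; apply: le_trans (ler_norm_sum _ _ _) _.
by rewrite /N mulr_natl -sumr_const; exact: ler_sum.
Qed.

Let Wd_le (t : R) x : -1 < t < 2 -> `|Wd t x| <= N * B x.
Proof.
move=> t12; rewrite /Wd /Wdot normrN; apply: sum_le => j.
by rewrite normrM -[leRHS]mul1r ler_pM// ?logistic_norm//; exact: zd_leB.
Qed.

Let Wdd_le (t : R) x : -1 < t < 2 ->
  `|Wdd t x| <= N * B x ^+ 2 + 2 * `|c| * (N * B x) + c ^+ 2 * (N * B x).
Proof.
move=> t12; rewrite /Wdd; apply: le_trans (ler_normD _ _) _; apply: lerD.
  apply: le_trans (ler_normB _ _) _; apply: lerD.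
    apply: sum_le => j; rewrite normrM -[leRHS]mul1r ler_pM//.
      rewrite ger0_norm ?var_ge0// -[leRHS]mul1r ler_pM ?(ltW (logistic_gt0 _))//.
      - by rewrite subr_ge0 ltW// logistic_lt1.
      - by rewrite ltW// logistic_lt1.
      - by rewrite gerBl ltW// logistic_gt0.
    by rewrite normrX lerXn2r ?nnegrE//; exact: zd_leB.
  by rewrite !normrM normr_nat ler_wpM2l ?mulr_ge0//; exact: Wd_le.
rewrite normrM ger0_norm ?sqr_ge0// ler_wpM2l ?sqr_ge0//; apply: sum_le => j.
by rewrite normrM -[leRHS]mul1r ler_pM// ?logistic_norm//; exact: z_leB.
Qed.

Let spt t := strip_potential th (b t) (lam t).
Let nice_w t : nice (w t) := nice_wt (spt t) ler01.
Let w_gt0 t x : 0 < w t x. Proof. exact: wt_gt0. Qed.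
Let w_le1 t x : w t x <= 1. Proof. exact: (wt_le1 (spt t) ler01). Qed.
Let nWd t : nice (Wd t) := nice_Wdot th (b t) (lam t) c d.

Let nice_pz t : nice (fun x => \sum_j p t j x * z t j x).
Proof. by apply: nice_sum => j; apply: niceM (nice_prob _ _ _ j) (nice_zeta _ _ _ j). Qed.

Let nice_Wdd t : nice (Wdd t).
Proof.
apply: niceD; last exact: niceM (nice_cst _) (nice_pz t).
by apply: niceB (nice_pinch _ _ _ _ _) _; exact: niceM (nice_cst _) (nWd t).
Qed.

Lemma is_derive_Z (t : R) : -1 < t < 2 ->
  is_derive t 1 (fun t => gaussE (w t)) (gaussE (fun x => - Wd t x * w t x)).
Proof.
move=> t12; apply: (@gaussE_derive _ _ w (fun t x => - Wd t x * w t x)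
  (fun x => N * B x) (-1) 2) => //.
- by move=> s _; exact: nice_good.
- by move=> s x _; exact: is_derive_w.
- exact: goodZ.
- move=> s x s12; rewrite normrM normrN (ger0_norm (ltW (w_gt0 _ _))) -[leRHS]mulr1.
  by rewrite ler_pM// ?(ltW (w_gt0 _ _))//; exact: Wd_le.
Qed.

Lemma is_derive_Z1 (t : R) : -1 < t < 2 ->
  is_derive t 1 (fun t => gaussE (fun x => - Wd t x * w t x))
    (gaussE (fun x => (Wd t x ^+ 2 - Wdd t x) * w t x)).
Proof.
move=> t12; apply: (@gaussE_derive _ _ (fun t x => - Wd t x * w t x)
  (fun t x => (Wd t x ^+ 2 - Wdd t x) * w t x)
  (fun x => (N * B x) ^+ 2 + (N * B x ^+ 2 + 2 * `|c| * (N * B x) + c ^+ 2 * (N * B x)))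
  (-1) 2) => //.
- by move=> s _; apply/nice_good/niceM => //; exact: niceN.
- by move=> s x _; exact: is_derive_w2.
- apply: goodD; first exact/goodX/goodZ.
  apply: goodD; first by apply: goodD; [exact/goodZ/goodX|exact/goodZ/goodZ].
  exact/goodZ/goodZ.
- move=> s x s12; rewrite normrM (ger0_norm (ltW (w_gt0 _ _))) -[leRHS]mulr1.
  rewrite ler_pM// ?(ltW (w_gt0 _ _))//; apply: le_trans (ler_normB _ _) _.
  apply: lerD; last exact: Wdd_le.
  by rewrite normrX lerXn2r ?nnegrE// ?mulr_ge0//; exact: Wd_le.
Qed.

(** Z'' is the mean of Wd^2 - Wdd. The variance bound controls Wd^2, its [pinch] cancels that of
    Wdd, the term 2 c Wd gives - 2 c Z', and the remaining sum of p z is the error estimated by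
    [logistic_tail]. *)
Lemma Z2_le (t : R) dl : 0 < dl ->
  gaussE (fun x => (Wd t x ^+ 2 - Wdd t x) * w t x) <=
  gaussE (fun x => - Wd t x * w t x) ^+ 2 / gaussE (w t) -
  2 * c * gaussE (fun x => - Wd t x * w t x) +
  c ^+ 2 * (n%:R * gaussE (w t) - gaussE (fun x => w t x * rad2 x)) +
  c ^+ 2 * \sum_j (2 * dl + dl^-1 * gaussE (fun x => p t j x * (1 - p t j x))).
Proof.
move=> dl0; have pot := spt t.
have hv := @strip_variance R n I th (b t) (lam t) inv invK th_inv (b_inv t) c d d_inv.
rewrite -/(W t) -/(Wd t) -/(pin t) in hv.
have E F : gaussE (fun x => F x * w t x) = avg (W t) 1 F.
  by congr gaussE; apply/funext => x; rewrite mulrC.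
have ZE : gaussE (w t) = avg (W t) 1 (fun=> 1).
  by congr gaussE; apply/funext => x; rewrite mulr1.
have nW2 : nice (fun x => Wd t x ^+ 2) by exact: niceX.
have npin : nice (pin t) by exact: nice_pinch.
have nWc : nice (fun x => 2 * c * Wd t x) by exact: niceM (nice_cst _) (nWd t).
have npz := nice_pz t.
have npz2 : nice (fun x => c ^+ 2 * \sum_j p t j x * z t j x).
  exact: niceM (nice_cst _) npz.
rewrite (E (fun x => - Wd t x)) (E (fun x => Wd t x ^+ 2 - Wdd t x)) ZE.
rewrite (avgN pot)// (avgB pot)// /Wdd (avgD pot)//; last exact: niceB.
rewrite (avgB pot)// (avgZ pot)// (avgZ pot)//.
have herr : - avg (W t) 1 (fun x => \sum_j p t j x * z t j x) <=
    \sum_j (2 * dl + dl^-1 * gaussE (fun x => p t j x * (1 - p t j x))).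
  have npj j : nice (fun x => p t j x * z t j x).
    exact: niceM (nice_prob _ _ _ j) (nice_zeta _ _ _ j).
  rewrite (avg_sum pot)// -sumrN; apply: ler_sum => j _.
  have nv := nice_var th (b t) (lam t) j.
  rewrite -(avgN pot)// -[X in X + _](@gaussE_cst _ n) -gaussEZ; last exact: nice_good.
  rewrite -gaussED; [|exact: good_cst|exact/goodZ/nice_good].
  apply: gaussE_le.
  - by apply/nice_good/niceM; [exact: nice_w | exact: (niceN (npj j))].
  - by apply: goodD; [exact: good_cst|exact/goodZ/nice_good].
  move=> x; apply: le_trans (logistic_tail (z t j x) dl0).
  apply: le_trans (ler_norm _) _.
  rewrite normrM normrN normrM (ger0_norm (ltW (w_gt0 _ _))).
  rewrite (ger0_norm (ltW (logistic_gt0 _))) mulrA [leRHS]mulrC ler_wpM2r//.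
  by rewrite mulrC ler_wpM2l ?(ltW (logistic_gt0 _))// wt_spot_le.
rewrite -/(avg (W t) 1 rad2).
move: hv herr; set a := avg _ _ (fun x => Wd t x ^+ 2); set m := avg _ _ (Wd t).
set Z := avg _ _ (fun=> 1); set pi' := avg _ _ (pin t); set r := avg _ _ rad2.
set s := avg _ _ (fun x => \sum_j _); set er := \sum_j _ => hv herr.
have h3 : c ^+ 2 * - s <= c ^+ 2 * er by rewrite ler_wpM2l// sqr_ge0.
move: hv h3; rewrite sqrrN mulrN; set u := m ^+ 2 / Z; set v := c ^+ 2 * er.
set v' := c ^+ 2 * s; set k := c ^+ 2 * (_ - r) => hv h3.
rewrite -subr_ge0 (_ : _ - _ = (pi' + k - (a - u)) + (v - - v')); last by ring.
by rewrite addr_ge0// subr_ge0.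
Qed.

End strip_flow.

Section strip_approximation.
Context {R : realType} {n : nat} {I : finType}.
Variables (th : I -> 'I_n -> R) (h d : I -> R) (inv : I -> I).
Hypothesis invK : involutive inv.
Hypothesis th_inv : forall j i, th (inv j) i = - th j i.
Hypothesis h_inv : forall j, h (inv j) = h j.
Hypothesis d_inv : forall j, d (inv j) = d j.
Hypothesis thN0 : forall j, exists i, th j i != 0.

Lemma strip_approx (c e : R) : 0 < e ->
  exists (w : R -> 'rV[R]_n -> R) (Z1 Z2 : R -> R), forall t : R, 0 <= t <= 1 ->
  [/\ good (w t), (forall x, 0 < w t x <= 1),
      is_derive t 1 (fun s => gaussE (w s)) (Z1 t),
      is_derive t 1 Z1 (Z2 t) &
      `|gaussE (w t) - gaussE (sind th (fun j => h j + t * d j))| <= e] /\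
  Z2 t <= Z1 t ^+ 2 / gaussE (w t) - 2 * c * Z1 t +
    c ^+ 2 * (n%:R * gaussE (w t) - gaussE (fun x => w t x * rad2 x)) + c ^+ 2 * e.
Proof.
move=> e0; have [C C0 hC] := gaussE_var_le thN0.
pose N : R := #|I|.+1%:R.
have N0 : 0 < N by rewrite ltr0n.
have NI : #|I|%:R <= N by rewrite ler_nat.
(* With this [dl] the terms [2 * dl] add up to at most e / 2; the two fractions in [L] make N (C /
   L) and N (dl^-1 (C / L)) at most e / 2. *)
pose dl := e / (4 * N).
have dl0 : 0 < dl by rewrite divr_gt0// mulr_gt0.
pose L := 1 + 2 * (N * C) / e + 2 * (N * (dl^-1 * C)) / e.
have p1 : 0 <= 2 * (N * C) / e by rewrite !mulr_ge0// ?invr_ge0 ltW.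
have p2 : 0 <= 2 * (N * (dl^-1 * C)) / e.
  by rewrite !mulr_ge0// ?invr_ge0 ltW// mulr_gt0.
have L0 : 0 < L by rewrite /L; lra.
(* This initial slope keeps [lam] at least [L] on all of [0, 1]. *)
pose lam0 := L * expR `|c|.
have lam0_gt0 : 0 < lam0 by rewrite mulr_gt0// expR_gt0.
pose lam (t : R) := lam0 * expR (- (c * t)).
pose b (t : R) j := h j + t * d j.
have L_le t : 0 <= t <= 1 -> L <= lam t.
  move=> /andP[t0 t1]; rewrite /lam /lam0 -mulrA -expRD ler_peMr ?(ltW L0)//.
  rewrite -expR0 ler_expR subr_ge0 (le_trans (ler_norm _))// normrM (ger0_norm t0).
  by rewrite ler_piMr.
have hv t j : 0 <= t <= 1 ->
    gaussE (fun x => prob th (b t) (lam t) j x * (1 - prob th (b t) (lam t) j x)) <= C / L.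
  move=> t01; have l0 := lt_le_trans L0 (L_le t t01).
  by apply: le_trans (hC (b t) _ j l0) _; rewrite ler_wpM2l// lef_pV2 ?posrE// L_le.
have sumC (f : I -> R) (D : R) : 0 <= D -> (forall j, f j <= D) -> \sum_j f j <= N * D.
  move=> D0 fD; apply: (@le_trans _ _ (\sum_(j : I) D)); first exact: ler_sum.
  by rewrite sumr_const -mulr_natl ler_wpM2r.
have CL : N * (C / L) <= e / 2.
  rewrite mulrA ler_pdivrMr// -[leLHS]mul1r.
  have -> : 1 * (N * C) = e / 2 * (2 * (N * C) / e) by field; rewrite gt_eqF.
  by rewrite ler_wpM2l ?divr_ge0 ?(ltW e0)// /L; lra.
have CL2 : N * (dl^-1 * (C / L)) <= e / 2.
  rewrite !mulrA -(mulrA N) ler_pdivrMr// -[leLHS]mul1r.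
  have -> : 1 * (N * (dl^-1 * C)) = e / 2 * (2 * (N * (dl^-1 * C)) / e).
    by field; rewrite !gt_eqF.
  by rewrite ler_wpM2l ?divr_ge0 ?(ltW e0)// /L; lra.
have CL0 : 0 <= C / L by rewrite divr_ge0// ltW.
pose w t := wt (spot th (b t) (lam t)) 1.
exists w, (fun t => gaussE (fun x => - Wdot th (b t) (lam t) c d x * w t x)).
pose Wdd t x := pinch th (b t) (lam t) c d x - 2 * c * Wdot th (b t) (lam t) c d x +
  c ^+ 2 * \sum_j prob th (b t) (lam t) j x * zeta th (b t) (lam t) j x.
exists (fun t => gaussE (fun x =>
  (Wdot th (b t) (lam t) c d x ^+ 2 - Wdd t x) * w t x)) => t t01.
have t12 : -1 < t < 2 by move: t01 => /andP[? ?]; lra.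
have pot := strip_potential th (b t) (lam t).
have nw : nice (w t) := nice_wt pot ler01.
split; first split.
- exact: nice_good.
- by move=> x; rewrite wt_gt0 (wt_le1 pot).
- exact: (is_derive_Z th h d c lam0_gt0 t12).
- exact: (is_derive_Z1 th h d c lam0_gt0 t12).
- have l0 := lt_le_trans L0 (L_le t t01); apply: le_trans (wt_sind_gaussE th (b t) l0) _.
  rewrite mulrC -ler_pdivlMr//; apply: le_trans CL; apply: sumC => // j; exact: hv.
apply: le_trans (Z2_le invK th_inv h_inv d_inv c lam0 t dl0) _.
rewrite lerD2l ler_wpM2l ?sqr_ge0//.
rewrite big_split /=.
have h1 : \sum_(j : I) 2 * dl <= N * (2 * dl) by apply: sumC => //; rewrite mulr_ge0// ltW.
have h2 : \sum_j dl^-1 * gaussE (fun x =>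
    prob th (b t) (lam t) j x * (1 - prob th (b t) (lam t) j x)) <= N * (dl^-1 * (C / L)).
  apply: sumC => [|j]; first by rewrite mulr_ge0 ?invr_ge0// ltW.
  by rewrite ler_wpM2l ?hv// invr_ge0 ltW.
have h3 : N * (2 * dl) = e / 2 by rewrite /dl; field; rewrite gt_eqF.
apply: le_trans (lerD h1 h2) _; rewrite h3; lra.
Qed.

End strip_approximation.

(** * Gaussian measure of balls and the bathtub principle *)

Section positive_part.
Context {R : realType}.
Implicit Types y : R.

Lemma is_derive_quad (f : R -> R) (a d C : R) :
  (forall h : R, `|h| <= 1 -> `|f (a + h) - f a - h * d| <= C * h ^+ 2) -> is_derive a 1 f d.
Proof.
move=> fq.
have lim_d : (fun h : R => h^-1 *: ((f \o shift a) (h *: 1) - f a)) @ 0^' --> d.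
  apply/cvgrPdist_le => e e0; near=> h.
  have h0 : h != 0 by near: h; exact: nbhs_dnbhs_neq.
  have h1 : `|h| <= 1 by near: h; exact: dnbhs0_le.
  have C1 : 0 < `|C| + 1 by rewrite ltr_wpDl.
  have h2 : `|h| <= e / (`|C| + 1) by near: h; apply: dnbhs0_le; rewrite divr_gt0.
  rewrite /= distrC /GRing.scale/= mulr1 (addrC h a).
  have -> : h^-1 * (f (a + h) - f a) - d = h^-1 * (f (a + h) - f a - h * d) by field.
  rewrite normrM normfV mulrC ler_pdivrMr ?normr_gt0//.
  apply: le_trans (fq h h1) _; apply: le_trans (ler_norm _) _.
  rewrite normrM normrX expr2 mulrA ler_wpM2r//.
  apply: (@le_trans _ _ ((`|C| + 1) * `|h|)); first by rewrite ler_wpM2r// lerDl.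
  by rewrite mulrC -ler_pdivlMr.
split; first by apply/cvg_ex; exists d.
exact: cvg_lim.
Unshelve. all: by end_near. Qed.

Definition pos y : R := Num.max 0 y.

Lemma pos_ge0 y : 0 <= pos y.
Proof. by rewrite /pos le_max lexx. Qed.

Lemma le_pos y : y <= pos y.
Proof. by rewrite /pos le_max lexx orbT. Qed.

Lemma pos_eq0 y : y <= 0 -> pos y = 0.
Proof. by move=> y0; apply/max_idPl. Qed.

Lemma pos_id y : 0 <= y -> pos y = y.
Proof. by move=> y0; apply/max_idPr. Qed.

Lemma pos_mul y : y * pos y = pos y ^+ 2.
Proof.
by have [y0|/ltW y0] := leP y 0; [rewrite pos_eq0// mulr0 expr0n|rewrite pos_id].
Qed.

Lemma pos_le y z : y <= z -> 0 <= z -> pos y <= z.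
Proof. by move=> yz z0; rewrite /pos ge_max z0. Qed.

Lemma continuous_pos : continuous pos.
Proof.
move=> y; apply/cvgrPdist_le => e e0; near=> z.
have h : `|y - z| <= e by near: z; apply: cvgr_dist_le => //; exact: cvg_id.
apply: le_trans h; rewrite ler_norml.
have h1 := ler_norm (y - z); have h2 : - (y - z) <= `|y - z| by rewrite -normrN ler_norm.
have [y0|/ltW y0] := leP y 0; have [z0|/ltW z0] := leP z 0.
- by rewrite !pos_eq0// subrr; apply/andP; lra.
- by rewrite (pos_eq0 y0) (pos_id z0); apply/andP; lra.
- by rewrite (pos_id y0) (pos_eq0 z0); apply/andP; lra.
- by rewrite !pos_id//; apply/andP; lra.
Unshelve. all: by end_near. Qed.

Lemma is_derive_pos2 y : is_derive y 1 (fun y => pos y ^+ 2) (2 * pos y).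
Proof.
apply: (@is_derive_quad _ _ _ 1) => h _.
have [y0|/ltW y0] := leP y 0; have [z0|/ltW z0] := leP (y + h) 0.
- by rewrite !pos_eq0// expr0n /= !(mulr0, subr0) normr0 mul1r sqr_ge0.
- rewrite (pos_eq0 y0) (pos_id z0) expr0n /= !(mulr0, subr0) ger0_norm ?sqr_ge0// mul1r.
  by rewrite lerXn2r ?nnegrE//; lra.
- rewrite (pos_id y0) (pos_eq0 z0) expr0n /= sub0r mul1r.
  have -> : - y ^+ 2 - h * (2 * y) = h ^+ 2 - (y + h) ^+ 2 by ring.
  have hh : (y + h) ^+ 2 <= h ^+ 2.
    by rewrite -[leLHS]sqrrN -[leRHS]sqrrN lerXn2r ?nnegrE//; lra.
  by rewrite ger0_norm ?subr_ge0// gerBl sqr_ge0.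
- rewrite !pos_id// (_ : _ - _ - _ = h ^+ 2); last by ring.
  by rewrite ger0_norm ?sqr_ge0// mul1r.
Qed.

Lemma is_derive_pos3 y : is_derive y 1 (fun y => pos y ^+ 3) (3 * pos y ^+ 2).
Proof.
rewrite (_ : (fun y => _) = fun y => y * pos y ^+ 2); last first.
  by apply/funext => z; rewrite exprS !expr2 !mulrA -expr2 -[z * _]/(z * _) pos_mul.
have d2 := is_derive_pos2 y.
apply: is_derive_eq; rewrite /GRing.scale/= mulr1.
by rewrite [2 * _]mulrC mulrA pos_mul; ring.
Qed.

End positive_part.

Section ball_measure.
Context {R : realType} {n : nat}.
Local Notation rad2 := (@rad2 R n).

(** Here r is the squared radius. [radP] is the mean of an indicator and cannot be differentiated
    under the expectation, so the computation starts from its repeated primitives E (r - |x|^2)_+^k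
    / k!, which are regular enough for integration by parts. *)
Definition radH1 (r : R) : R := gaussE (fun x => pos (r - rad2 x)).
Definition radH2 (r : R) : R := gaussE (fun x => pos (r - rad2 x) ^+ 2 / 2).
Definition radH3 (r : R) : R := gaussE (fun x => pos (r - rad2 x) ^+ 3 / 6).
Definition radP (r : R) : R := gaussE (fun x => (rad2 x <= r)%R%:R).

Lemma rad2_ge0 x : 0 <= rad2 x.
Proof. by apply: sumr_ge0 => i _; exact: sqr_ge0. Qed.

Lemma good_rad2 : good rad2. Proof. exact: nice_good nice_rad2. Qed.

Let pos_rad (r : R) x : pos (r - rad2 x) <= `|r|.
Proof.
by apply: pos_le => //; have := rad2_ge0 x; have := ler_norm r; lra.
Qed.

Let nice_pos (r : R) : nice (fun x => pos (r - rad2 x)).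
Proof.
apply: (@nice_comp _ _ (fun y => pos (r - y)) rad2 `|r|) nice_rad2.
  move=> y; apply: (@cvg_comp _ _ _ (fun y => r - y) (@pos R)); last exact: continuous_pos.
  by apply: cvgB; [exact: cvg_cst|exact: cvg_id].
by move=> x; rewrite ger0_norm ?pos_ge0.
Qed.

Let good_pos k (c r : R) : good (fun x => pos (r - rad2 x) ^+ k / c).
Proof. by apply: goodM; [exact/goodX/nice_good|exact: good_cst]. Qed.

Lemma good_ball (r : R) : good (fun x => (rad2 x <= r)%R%:R : R).
Proof. exact: good_sublevel good_rad2.1. Qed.

Let shift_derive (f f' : R -> R) (rho t : R) : (forall y : R, is_derive y 1 f (f' y)) ->
  is_derive t 1 (fun t => f (t - rho)) (f' (t - rho)).
Proof.
move=> df; have dg : is_derive t 1 (fun t : R => t - rho) 1.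
  by apply: is_derive_eq; rewrite subr0.
by have := @is_derive1_comp R f (fun t => t - rho) _ _ _ (df _) dg; rewrite mulr1.
Qed.

Let normt_le (r t : R) : r - 1 < t < r + 1 -> `|t| <= `|r| + 1.
Proof.
move=> /andP[t1 t2]; have := ler_norm r; have : - r <= `|r| by rewrite -normrN ler_norm.
by rewrite ler_norml => h1 h2; apply/andP; lra.
Qed.

Lemma is_derive_radH2 (r : R) : is_derive r 1 radH2 (radH1 r).
Proof.
apply: (@gaussE_derive _ _ (fun r x => pos (r - rad2 x) ^+ 2 / 2)
  (fun r x => pos (r - rad2 x)) (fun=> `|r| + 1) (r - 1) (r + 1)).
- by apply/andP; lra.
- by move=> t _; exact: good_pos.
- move=> t x _; have d2 := shift_derive (rad2 x) t (@is_derive_pos2 R).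
  by apply: is_derive_eq; rewrite /GRing.scale/=; field.
- exact: good_cst.
- move=> t x tr; rewrite ger0_norm ?pos_ge0// (le_trans (pos_rad t x))//.
  exact: normt_le.
Qed.

Lemma is_derive_radH3 (r : R) : is_derive r 1 radH3 (radH2 r).
Proof.
apply: (@gaussE_derive _ _ (fun r x => pos (r - rad2 x) ^+ 3 / 6)
  (fun r x => pos (r - rad2 x) ^+ 2 / 2) (fun=> (`|r| + 1) ^+ 2 / 2) (r - 1) (r + 1)).
- by apply/andP; lra.
- by move=> t _; exact: good_pos.
- move=> t x _; have d2 := shift_derive (rad2 x) t (@is_derive_pos3 R).
  by apply: is_derive_eq; rewrite /GRing.scale/=; field.
- exact: good_cst.
- move=> t x tr; rewrite ger0_norm ?divr_ge0 ?sqr_ge0// ler_wpM2r ?invr_ge0//.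
  rewrite lerXn2r ?nnegrE ?pos_ge0 ?addr_ge0//.
  by rewrite (le_trans (pos_rad t x))// normt_le.
Qed.

(** Integrate by parts with the functions x_i phi, where phi = (r - |x|^2)_+^2 / 2, sum over i, and
    write |x|^2 as r - (r - |x|^2). *)
Lemma radH_ibp (r : R) :
  (n%:R - r) * radH2 r + 3 * radH3 r = 2 * r * radH1 r - 4 * radH2 r.
Proof.
pose phi x : R := pos (r - rad2 x) ^+ 2 / 2.
have nphi : nice phi by apply: niceM (nice_cst _); exact: niceX.
have dphi i : partial i phi (fun x => - (2 * x ord0 i) * pos (r - rad2 x)).
  have dr : partial i (fun x => r - rad2 x) (fun x => - (2 * x ord0 i)).
    have h j : partial i (fun x : 'rV[R]_n => x ord0 j ^+ 2)
        (fun x => (j == i)%:R * (2 * x ord0 j)).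
      rewrite (_ : (fun x => _ ^+ 2) = fun x : 'rV[R]_n => x ord0 j * x ord0 j)//.
      rewrite (_ : (fun x => _ * (2 * _)) = fun x : 'rV[R]_n =>
          (j == i)%:R * x ord0 j + x ord0 j * (j == i)%:R).
        exact: partialM (partial_coord i j) (partial_coord i j).
      by apply/funext => x; ring.
    have := partialB (partial_cst i r) (partial_sum (index_enum 'I_n) xpredT h).
    congr (partial _ _ _); apply/funext => x.
    rewrite (bigD1 i)//= eqxx big1 => [|k /negbTE ->]; last by rewrite mul0r.
    by rewrite sub0r mul1r addr0.
  rewrite (_ : phi = fun x => 2^-1 * pos (r - rad2 x) ^+ 2); last first.
    by apply/funext => x; rewrite mulrC.
  have := partialZ 2^-1 (partial_comp (@is_derive_pos2 R) dr); congr (partial _ _ _).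
  by apply/funext => x; field.
have nc i : nice (fun x : 'rV[R]_n => x ord0 i) by exact: nice_coord.
have np := nice_pos r.
have ibp i : gaussE (fun x => phi x - 2 * x ord0 i ^+ 2 * pos (r - rad2 x)) =
    gaussE (fun x => x ord0 i ^+ 2 * phi x).
  have nx : nice (fun x => x ord0 i * phi x) by exact: niceM.
  rewrite (_ : (fun x : 'rV[R]_n => x ord0 i ^+ 2 * phi x) =
      fun x => x ord0 i * (x ord0 i * phi x)).
    apply: gaussE_ibp => //.
      apply: niceB => //; apply: niceM => //; apply: niceM (nice_cst _) _; exact: niceX.
    rewrite (_ : (fun x => phi x - _) = fun x : 'rV[R]_n =>
        (i == i)%:R * phi x + x ord0 i * (- (2 * x ord0 i) * pos (r - rad2 x))).
      exact: partialM (partial_coord i i) (dphi i).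
    by apply/funext => x; rewrite eqxx mul1r; ring.
  by apply/funext => x; ring.
have g1 i : good (fun x => phi x - 2 * x ord0 i ^+ 2 * pos (r - rad2 x)).
  apply/nice_good/niceB => //; apply: niceM => //; apply: niceM (nice_cst _) _; exact: niceX.
have g2 i : good (fun x => x ord0 i ^+ 2 * phi x).
  by apply/nice_good/niceM => //; exact: niceX.
have h : gaussE (fun x => n%:R * phi x - 2 * rad2 x * pos (r - rad2 x)) =
    gaussE (fun x => rad2 x * phi x).
  transitivity (\sum_i gaussE (fun x => phi x - 2 * x ord0 i ^+ 2 * pos (r - rad2 x))).
    rewrite -gaussE_sum//; congr gaussE; apply/funext => x.
    rewrite sumrB sumr_const card_ord mulr_natl; congr (_ - _).
    by rewrite /rad2 mulr_sumr mulr_suml.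
  under eq_bigr do rewrite ibp.
  rewrite -gaussE_sum//; congr gaussE; apply/funext => x.
  by rewrite /rad2 mulr_suml.
have gp k (c : R) := good_pos k c r; have gp1 := nice_good np.
have e1 : gaussE (fun x => n%:R * phi x - 2 * rad2 x * pos (r - rad2 x)) =
    n%:R * radH2 r - (2 * r * radH1 r - 4 * radH2 r).
  rewrite -!gaussEZ// -!gaussEB; try by do ?[apply: goodB|apply: goodZ].
  congr gaussE; apply/funext => x; congr (_ - _).
  rewrite (_ : 4 * _ = 2 * ((r - rad2 x) * pos (r - rad2 x))); first by ring.
  by rewrite pos_mul; field.
have e2 : gaussE (fun x => rad2 x * phi x) = r * radH2 r - 3 * radH3 r.
  rewrite -!gaussEZ// -!gaussEB; try by do ?[apply: goodB|apply: goodZ].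
  congr gaussE; apply/funext => x.
  rewrite (_ : pos (r - rad2 x) ^+ 3 = (r - rad2 x) * pos (r - rad2 x) ^+ 2).
    by rewrite /phi; field.
  by rewrite [in RHS]expr2 mulrA pos_mul; ring.
by move: h; rewrite e1 e2 => h; lra.
Qed.

(* Since radH3' = radH2 and radH2' = radH1, differentiating the identity radH_ibp yields two
   further derivatives of radH1, in closed form. *)
Definition radD (r : R) : R := (2 * radH2 r + (n%:R + 2 - r) * radH1 r) / (2 * r).

Definition radE (r : R) : R := (radH1 r + (n%:R - r) * radD r) / (2 * r).

Lemma is_derive_radH1 (r : R) : 0 < r -> is_derive r 1 radH1 (radD r).
Proof.
move=> r0.
pose f (s : R) := ((n%:R + 4 - s) * radH2 s + 3 * radH3 s) * (2 * s)^-1.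
have d2 := is_derive_radH2 r; have d3 := is_derive_radH3 r.
have s0 : 2 * r != 0 by rewrite gt_eqF// mulr_gt0.
have d1 : is_derive r 1 (fun s : R => 2 * s) 2.
  by apply: is_derive_eq; rewrite /GRing.scale/=; ring.
have dV := @is_deriveV R (fun s => 2 * s) r 2 1 s0 d1.
have h := radH_ibp r.
have hE s : 0 < s -> f s = radH1 s.
  move=> s1; have hs := radH_ibp s.
  have e : (n%:R + 4 - s) * radH2 s + 3 * radH3 s = 2 * s * radH1 s by lra.
  by rewrite /f e mulrAC mulfV ?mul1r// gt_eqF// mulr_gt0.
apply: (@near_eq_is_derive _ _ _ f); first by near=> s; apply: hE; near: s; exact: lt_nbhsr.
have df : is_derive r 1 f (- radH2 r * (2 * r)^-1 + (n%:R + 4 - r) * radH1 r * (2 * r)^-1 +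
    3 * radH2 r * (2 * r)^-1 - f r / r).
  apply: is_derive_eq; rewrite /GRing.scale/= /f; field.
  by rewrite gt_eqF.
rewrite hE// in df.
rewrite (_ : radD r = - radH2 r * (2 * r)^-1 + (n%:R + 4 - r) * radH1 r * (2 * r)^-1 +
    3 * radH2 r * (2 * r)^-1 - radH1 r / r) => [//|].
by rewrite /radD; field; rewrite gt_eqF.
Unshelve. all: by end_near. Qed.

Lemma is_derive_radD (r : R) : 0 < r -> is_derive r 1 radD (radE r).
Proof.
move=> r0; have d2 := is_derive_radH2 r; have dH1 := is_derive_radH1 r0.
have s0 : 2 * r != 0 by rewrite gt_eqF// mulr_gt0.
have d1 : is_derive r 1 (fun s : R => 2 * s) 2.
  by apply: is_derive_eq; rewrite /GRing.scale/=; ring.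
have dV := @is_deriveV R (fun s => 2 * s) r 2 1 s0 d1.
have df : is_derive r 1 radD ((2 * radH1 r - radH1 r + (n%:R + 2 - r) * radD r) * (2 * r)^-1 -
    radD r / r).
  apply: is_derive_eq; rewrite /GRing.scale/= [X in _ = _ - X / r]/radD; field.
  by rewrite gt_eqF.
rewrite (_ : radE r = (2 * radH1 r - radH1 r + (n%:R + 2 - r) * radD r) * (2 * r)^-1 -
  radD r / r) => [//|].
by rewrite /radE; field; rewrite gt_eqF.
Qed.

Lemma is_derive_radE (r : R) : 0 < r ->
  is_derive r 1 radE ((n%:R - 2 - r) * radE r / (2 * r)).
Proof.
move=> r0; have dD := is_derive_radD r0; have dH1 := is_derive_radH1 r0.
have s0 : 2 * r != 0 by rewrite gt_eqF// mulr_gt0.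
have d1 : is_derive r 1 (fun s : R => 2 * s) 2.
  by apply: is_derive_eq; rewrite /GRing.scale/=; ring.
have dV := @is_deriveV R (fun s => 2 * s) r 2 1 s0 d1.
have df : is_derive r 1 radE ((radD r - radD r + (n%:R - r) * radE r) * (2 * r)^-1 -
    radE r / r).
  apply: is_derive_eq; rewrite /GRing.scale/= [X in _ = _ - X / r]/radE; field.
  by rewrite gt_eqF.
rewrite (_ : (n%:R - 2 - r) * radE r / (2 * r) =
  (radD r - radD r + (n%:R - r) * radE r) * (2 * r)^-1 - radE r / r) => [//|].
by field; rewrite gt_eqF.
Qed.

Let good_pos1 (r : R) : good (fun x => pos (r - rad2 x)).
Proof. exact: nice_good. Qed.

(* radP r is a subgradient at r of the function radH1, which is differentiable. *)
Lemma radPE (r : R) : 0 < r -> radP r = radD r.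
Proof.
move=> r0.
have sub (s : R) : radH1 r + (s - r) * radP r <= radH1 s.
  have gb := good_ball r.
  rewrite -gaussEZ// -gaussED//; last exact: goodZ.
  apply: gaussE_le => //; first by apply: goodD => //; exact: goodZ.
  move=> x; have [h|h] := leP (rad2 x) r.
    rewrite (_ : true%:R = 1 :> R)// mulr1 pos_id ?subr_ge0//.
    by apply: le_trans (le_pos _); lra.
  by rewrite mulr0 addr0 pos_eq0 ?pos_ge0// subr_le0 ltW.
pose f (s : R) := radH1 s - s * radP r.
have df (s : R) : 0 < s -> is_derive s 1 f (radD s - radP r).
  move=> s0; have d1 := is_derive_radH1 s0.
  by apply: is_derive_eq; rewrite /GRing.scale/=; ring.
have h : is_derive r 1 f 0.
  apply: (@derive1_at_min R f 0 (r + 1)); first lra.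
  - by move=> t; rewrite in_itv/= => /andP[t0 _]; case: (df t t0).
  - by rewrite in_itv/= r0 ltrDl ltr01.
  - by move=> t _; have := sub t; rewrite /f; lra.
have h' := df r r0.
have := @derive_val _ _ _ _ _ _ _ h; rewrite (@derive_val _ _ _ _ _ _ _ h').
by move/eqP; rewrite subr_eq0 => /eqP ->.
Qed.

Lemma is_derive_radP (r : R) : 0 < r -> is_derive r 1 radP (radE r).
Proof.
move=> r0; apply: (@near_eq_is_derive _ _ _ radD); last exact: is_derive_radD.
by near=> s; rewrite radPE//; near: s; exact: lt_nbhsr.
Unshelve. all: by end_near. Qed.

(** [radE] solves a linear first-order equation. The substitution r = exp y moves it to the whole
    line, where a function with zero derivative is constant. *)
Lemma radE_eq : exists k : R, forall r : R, 0 < r ->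
  radE r = k * r `^ (n%:R / 2 - 1) * expR (- (r / 2)).
Proof.
pose s : R := n%:R / 2 - 1.
pose f (y : R) := radE (expR y) * expR (expR y / 2 - s * y).
have df (y : R) : is_derive y 1 f 0.
  have e0 := expR_gt0 y.
  have dE := is_derive_radE e0.
  have d1 := @is_derive1_comp R radE (@expR R) y _ _ dE (is_derive_expR y).
  have d2 : is_derive y 1 (fun y : R => expR y / 2 - s * y) (expR y / 2 - s).
    by apply: is_derive_eq; rewrite /GRing.scale/=; ring.
  have d3 := @is_derive1_comp R (@expR R) (fun y : R => expR y / 2 - s * y) y _ _
    (is_derive_expR _) d2.
  have d4 := is_deriveM d1 d3; apply: is_derive_eq; rewrite /GRing.scale/= /s; field.
  by rewrite gt_eqF.
exists (f 0) => r r0.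
have -> : f 0 = f (ln r) by exact: is_derive_0_is_cst.
rewrite /f lnK// /powR (gt_eqF r0); move: (radE r) => e; rewrite -!mulrA -!expRD.
by rewrite (_ : _ + _ = 0) ?expR0 ?mulr1// /s; ring.
Qed.

Hypothesis n_gt0 : (0 < n)%N.

Lemma radP_mono (r s : R) : r <= s -> radP r <= radP s.
Proof.
move=> rs; apply: gaussE_le; [exact: good_ball|exact: good_ball|move=> x].
by rewrite ler_nat; case: leP => // h; rewrite (le_trans h rs).
Qed.

Lemma radP_le1 (r : R) : radP r <= 1.
Proof.
rewrite -(@gaussE_cst R n 1); apply: gaussE_le; [exact: good_ball|exact: good_cst|move=> x].
by rewrite lern1; case: leP.
Qed.

Lemma radP_seq (u : nat -> R) (l : 'rV[R]_n -> R) : mfun l ->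
  (forall x, (fun m => (rad2 x <= u m)%R%:R : R) @ \oo --> l x) ->
  (fun m => radP (u m)) @ \oo --> gaussE l.
Proof.
move=> ml ul; apply: (@gaussE_dct _ _ (fun m x => (rad2 x <= u m)%R%:R) l (fun=> 1)) => //.
- by move=> m; exact: (good_ball (u m)).1.
- exact: good_cst.
- by move=> m x; case: (rad2 x <= u m)%R; rewrite ?normr1 ?normr0.
Qed.

(** The limit is the mass q of the origin. As [radH1 r] is at least r q, the formula for [radP]
    gives (n + 2 - r) / 2 q <= [radP r]; letting r tend to 0 yields (n + 2) / 2 q <= q, hence q = 0
    for n >= 1. *)
Lemma radP_0 : (fun m => radP m.+1%:R^-1) @ \oo --> (0 : R).
Proof.
pose q : R := gaussE (fun x => (rad2 x <= 0)%R%:R).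
have cq : (fun m => radP m.+1%:R^-1) @ \oo --> q.
  apply: radP_seq; first exact: (good_ball 0).1.
  move=> x; have [h|h] := leP (rad2 x) 0.
    apply: cvg_near_cst; near=> m.
    by rewrite (le_trans h)// invr_ge0.
  apply: cvg_near_cst; near=> m.
  rewrite (_ : (rad2 x <= m.+1%:R^-1) = false)//; apply/negbTE; rewrite -ltNge.
  by near: m; exact: near_infty_natSinv_lt (PosNum h).
suff q0 : q = 0 by rewrite q0 in cq.
have q_ge0 : 0 <= q by exact: gaussE_ge0.
have key (r : R) : 0 < r -> r <= 1 -> (n%:R + 2 - r) / 2 * q <= radP r.
  move=> r0 r1; rewrite radPE// /radD ler_pdivlMr ?mulr_gt0//.
  have H2 : 0 <= radH2 r by apply: gaussE_ge0 => x; rewrite divr_ge0// exprn_ge0// pos_ge0.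
  have H1 : r * q <= radH1 r.
    rewrite -gaussEZ; last exact: good_ball.
    apply: gaussE_le => //; first exact/goodZ/good_ball.
    move=> x; have [h|h] := leP (rad2 x) 0; last by rewrite mulr0 pos_ge0.
    by rewrite mulr1; apply: le_trans (le_pos _); lra.
  have N0 : 0 <= n%:R :> R by [].
  have : (n%:R + 2 - r) * (r * q) <= (n%:R + 2 - r) * radH1 r.
    by rewrite ler_wpM2l//; lra.
  rewrite (_ : (n%:R + 2 - r) / 2 * q * (2 * r) = (n%:R + 2 - r) * (r * q)); last by field.
  lra.
have : (n%:R + 2) / 2 * q <= q.
  have c1 : (fun m => (n%:R + 2 - m.+1%:R^-1) / 2 * q) @ \oo --> (n%:R + 2 - 0) / 2 * q.
    apply: cvgM; last exact: cvg_cst.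
    apply: cvgM; last exact: cvg_cst.
    by apply: cvgB; [exact: cvg_cst|exact: cvg_harmonic].
  rewrite subr0 in c1.
  apply: (ler_cvg_to c1 cq); near=> m; apply: key => //.
  by rewrite invf_le1// ler1n.
have : 1 <= n%:R :> R by rewrite ler1n.
nra.
Unshelve. all: by end_near. Qed.

Lemma radP_infty (e : R) : 0 < e -> exists2 r0 : R, 0 < r0 & forall r : R, r0 <= r -> 1 - e <= radP r.
Proof.
move=> e0.
have c1 : (fun m => radP m%:R) @ \oo --> gaussE (fun _ : 'rV[R]_n => 1 : R).
  apply: radP_seq; first exact: mfun_cst.
  move=> x; apply: cvg_near_cst; near=> m.
  rewrite (_ : (rad2 x <= m%:R) = true)//; near: m; exact: nbhs_infty_ger.
rewrite gaussE_cst in c1.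
have /cvgrPdist_le/(_ _ e0)[m _ /(_ m.+1 (leqnSn m)) /=] := c1.
move=> h; exists m.+1%:R => // r mr; apply: le_trans (radP_mono mr).
have := le_trans (ler_norm _) h; lra.
Unshelve. all: by end_near. Qed.

End ball_measure.

(** * The constant [c_const] and the bathtub bound *)

Section gamma_constant.
Context {R : realType} {n : nat}.
Hypothesis n_gt0 : (0 < n)%N.
Local Notation radP := (@radP R n).
Local Notation radE := (@radE R n).

Let s : R := n%:R / 2 - 1.

(** The unknown factor is determined by total mass one: with r = 2 u the density of |x|^2 becomes a
    multiple of the Gamma integrand. *)
Lemma radE_const : forall r : R, 0 < r ->
  radE r = c_const n / 2 * r `^ s * expR (- (r / 2)).
Proof.
have [k kE] := @radE_eq R n.
have pow2 : 2 `^ (n%:R / 2 : R) = 2 * 2 `^ s :> R.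
  rewrite (_ : n%:R / 2 = s + 1 :> R); last by rewrite /s subrK.
  by rewrite powRD ?powRr1 1?mulrC//; apply/implyP => _; rewrite pnatr_eq0.
(* A negative factor would make [radP] decrease between 1 and 2. The sign puts the integrals below
   under the theory of nonnegative functions. *)
have k0 : 0 <= k.
  rewrite leNgt; apply/negP => k0.
  have [| |c c12 h] := @MVT_segment R radP radE 1 2 (ltW (ltr1n _ 2)).
  - move=> x; rewrite in_itv/= => /andP[x1 _]; apply: is_derive_radP; exact: lt_trans x1.
  - apply: derivable_within_continuous => x; rewrite in_itv/= => /andP[x1 _].
    by case: (@is_derive_radP R n x (lt_le_trans ltr01 x1)).
  have c0 : 0 < c by move: c12; rewrite in_itv/= => /andP[c1 _]; exact: lt_le_trans c1.
  have : radE c < 0 by rewrite kE// pmulr_llt0 ?expR_gt0// pmulr_llt0// powR_gt0.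
  have := @radP_mono R n 1 2 (ltW (ltr1n _ 2)).
  rewrite -subr_ge0 h; lra.
pose k' := k * 2 `^ (n%:R / 2).
pose g (u : R) := u `^ s * expR (- u).
have g0 u : 0 <= g u by rewrite mulr_ge0 ?powR_ge0 ?expR_ge0.
have dg (u : R) : 0 < u -> derivable g u 1.
  move=> u0; have d1 := is_derive1_powR s u0; rewrite /g; exact: ex_derive.
pose Phi (u : R) := radP (2 * u).
have dPhi (u : R) : 0 < u -> is_derive u 1 Phi (k' * g u).
  move=> u0; have u2 : 0 < 2 * u by rewrite mulr_gt0.
  have d1 : is_derive u 1 (fun u : R => 2 * u) 2.
    by apply: is_derive_eq; rewrite /GRing.scale/=; ring.
  have d2 := @is_derive1_comp R radP (fun u : R => 2 * u) u _ _ (@is_derive_radP R n _ u2) d1.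
  rewrite (_ : k' * g u = radE (2 * u) * 2) => [//|].
  rewrite kE// powRM// ?(ltW u0)// /k' /g pow2 (_ : 2 * u / 2 = u); last by field.
  rewrite -/s; ring.
have Phi1 : Phi u @[u --> +oo] --> (1 : R).
  apply/cvgrPdist_le => e e0; have [r0 r00 h] := @radP_infty R n e e0.
  near=> u; have ur : r0 <= 2 * u.
    rewrite -ler_pdivrMl// mulrC; near: u; exact: nbhs_pinfty_ge.
  have := h _ ur; have := @radP_le1 R n (2 * u); rewrite -/(Phi u) => h1 h2.
  by rewrite ger0_norm; lra.
have FTC (a : R) : 0 < a ->
    (\int[lebesgue_measure]_(x in `[a, +oo[) (k' * g x)%:E = (1 - Phi a)%:E)%E.
  move=> a0; have := @ge0_continuous_FTC2y R (fun x => k' * g x) Phi a 1.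
  rewrite EFinB; apply.
  - by move=> x _; rewrite mulr_ge0// mulr_ge0// powR_ge0.
  - apply: derivable_within_continuous => x; rewrite in_itv/= andbT => ax.
    apply: derivableM; first exact: derivable_cst.
    by apply: dg; exact: lt_le_trans ax.
  - exact: Phi1.
  - by move=> x ax; case: (dPhi x (lt_trans a0 ax)).
  - apply: cvg_at_right_filter; apply: differentiable_continuous.
    by apply/derivable1_diffP; case: (dPhi a a0).
  - move=> x; rewrite in_itv/= andbT => ax.
    by rewrite derive1E; have h := dPhi x (lt_trans a0 ax); rewrite derive_val.
(* The integrand may be singular at 0, so the half-line is exhausted by closed ones; the factor 2
   turns the end point into that of [radP_0] under u -> 2 u. *)
pose F (m : nat) : set R := `[(2 * m.+1%:R)^-1, +oo[%classic.
have mf : measurable_fun `](0 : R), +oo[ g.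
  apply: open_continuous_measurable_fun => //.
  move=> x; rewrite inE/= in_itv/= andbT => x0.
  by apply: differentiable_continuous; apply/derivable1_diffP; exact: dg.
have bigF : \bigcup_m F m = `]0%R, +oo[%classic.
  apply/seteqP; split=> x /=; rewrite in_itv/= andbT.
    move=> [m _]; rewrite /F /= in_itv/= andbT; apply: lt_le_trans.
    by rewrite invr_gt0 mulr_gt0.
  move=> x0; exists (Num.bound x^-1) => //; rewrite /F /= in_itv/= andbT.
  rewrite -[leRHS]invrK lef_pV2 ?posrE ?invr_gt0 ?mulr_gt0//.
  have := archi_boundP (ltW (_ : 0 < x^-1)); rewrite invr_gt0 => /(_ x0) h.
  apply: le_trans (ltW h) _; rewrite -natrM ler_nat.
  by rewrite mul2n -addnn (leq_trans (leqnSn _))// leq_addr.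
have subF m : F m `<=` `]0%R, +oo[%classic by rewrite -bigF; exact: bigcup_sup.
have cv : (\int[lebesgue_measure]_(x in F i) (k' * g x)%:E @[i --> \oo] -->
    \int[lebesgue_measure]_(x in `]0%R, +oo[) (k' * g x)%:E)%E.
  rewrite -bigF; apply: ge0_nondecreasing_set_cvg_integral.
  - apply/nondecreasing_seqP => m; apply/subsetPset => x; rewrite /F /= !in_itv/= !andbT.
    by apply: le_trans; rewrite lef_pV2 ?posrE ?mulr_gt0// ler_pM2l// ler_nat.
  - by move=> m; exact: measurable_itv.
  - move=> m; apply/measurable_EFinP; apply: measurable_funM => //.
    by apply: measurable_funS mf => //; exact: subF.
  - by move=> m x _; rewrite lee_fin mulr_ge0// mulr_ge0// powR_ge0.
have cv1 : (\int[lebesgue_measure]_(x in F i) (k' * g x)%:E @[i --> \oo] --> (1 : R)%:E)%E.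
  rewrite (_ : (fun i => _) = fun m => (1 - radP m.+1%:R^-1)%:E).
    apply: cvg_EFin; first by near=> m.
    rewrite [X in _ --> X](_ : _ = 1 - 0); last by rewrite subr0.
    by apply: cvgB; [exact: cvg_cst|exact: radP_0].
  apply/funext => m; rewrite FTC ?invr_gt0 ?mulr_gt0// /Phi.
  by rewrite (_ : 2 * (2 * m.+1%:R)^-1 = m.+1%:R^-1)// invfM mulrA mulfV ?mul1r.
have I1 := cvg_unique (@ereal_hausdorff R) cv cv1.
have k'0 : 0 <= k' by rewrite mulr_ge0 ?powR_ge0.
have I2 : (k'%:E * \int[lebesgue_measure]_(x in `]0%R, +oo[) (g x)%:E = 1%:E)%E.
  rewrite -ge0_integralZl//=.
  - exact: I1.
  - by apply/measurable_EFinP.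
  - by move=> x _; rewrite lee_fin.
have kG : k' * Gamma (n%:R / 2) = 1.
  rewrite /Gamma -/s -/g.
  have : (0 <= \int[lebesgue_measure]_(x in `]0%R, +oo[) (g x)%:E)%E.
    by apply: integral_ge0 => x _; rewrite lee_fin.
  (* [Gamma] takes the finite part of the integral; an infinite value is excluded because the
     product with k' is 1. *)
  move: I2; case: (\int[_]_(_ in _) _)%E => [r| |] /=.
  - by rewrite -EFinM => h _; exact: EFin_inj h.
  - have [->|kn] := eqVneq k' 0; first by rewrite mul0e => h; have := EFin_inj h; lra.
    by rewrite gt0_muley// lte_fin lt_neqAle eq_sym kn.
  - by rewrite leeNy_eq.
move=> r r0; rewrite kE//; congr (_ * _ * _).
have G0 : Gamma (n%:R / 2) != 0 :> R.
  by apply/eqP => G0; move: kG; rewrite G0 mulr0 => /eqP; rewrite eq_sym oner_eq0.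
have p0 : 2 `^ s != 0 :> R by rewrite gt_eqF// powR_gt0.
rewrite /c_const -/s; apply: (mulIf (mulf_neq0 G0 p0)).
transitivity (2^-1 * (k' * Gamma (n%:R / 2))).
  by rewrite /k' pow2; field.
by rewrite kG; field; rewrite G0 p0.
Unshelve. all: by end_near. Qed.

Lemma PsiE (r : R) : Psi n r = radP (r ^+ 2).
Proof.
rewrite /Psi /gamma_n.
have := leb_int_gaussE (good_ball (n := n) (r ^+ 2)) (fun x => ler0n _ _).
rewrite (_ : (fun x : 'rV[R]_n => (\1_(ball2 r) x * gauss_density x)%:E) =
  fun x => ((rad2 x <= r ^+ 2)%R%:R * gauss_density x)%:E) => [->//|].
apply/funext => x; rewrite indicE; congr ((_%:R * _)%:E).
by congr nat_of_bool; apply/idP/idP; rewrite inE.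
Qed.

(* The upper bound is the value of the left-hand side when g is the indicator of the ball of
   radius r. *)
Lemma bathtub (v : R) : 0 < v < 1 -> exists2 r : R, 0 < r & Psi n r = v /\
  forall g : 'rV[R]_n -> R, good g -> (forall x, 0 <= g x <= 1) -> gaussE g = v ->
    n%:R * v - gaussE (fun x => g x * rad2 x) <= c_const n * r ^+ n * expR (- (r ^+ 2 / 2)).
Proof.
move=> /andP[v0 v1].
have [a a0 ha] : exists2 a : R, 0 < a & radP a <= v.
  have /cvgrPdist_le/(_ _ v0)[m _ /(_ m (leqnn m)) /=] := @radP_0 R n n_gt0.
  rewrite sub0r normrN => h; exists m.+1%:R^-1; first by rewrite invr_gt0.
  by rewrite (le_trans (ler_norm _)).
have [b0 b00 hb] := @radP_infty R n (1 - v) (ltac:(by rewrite subr_gt0)).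
pose b := Num.max a b0.
have ab : a <= b by rewrite le_max lexx.
have hb' : v <= radP b.
  by have := hb b (ltac:(by rewrite le_max lexx orbT)); rewrite opprB addrC subrK.
have cP : {within `[a, b], continuous radP}.
  apply: derivable_within_continuous => x; rewrite in_itv/= => /andP[x1 _].
  by case: (@is_derive_radP R n x (lt_le_trans a0 x1)).
have [|rho rab hr] := @IVT R radP a b v ab cP.
  by rewrite ge_min le_max ha hb' orbT.
have rho0 : 0 < rho by move: rab; rewrite in_itv/= => /andP[h _]; exact: lt_le_trans h.
have rE : Num.sqrt rho ^+ 2 = rho by rewrite sqr_sqrtr// ltW.
exists (Num.sqrt rho); first by rewrite sqrtr_gt0.
rewrite PsiE rE; split=> // g gg g01 gv.
have gr := @good_rad2 R n.
have gpos : good (fun x : 'rV[R]_n => pos (rho - rad2 x)).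
  split; last first.
    apply: (growth_bounded (c := `|rho|)) => x; rewrite ger0_norm ?pos_ge0//.
    by apply: pos_le => //; have := rad2_ge0 x; have := ler_norm rho; lra.
  apply: (mfun_comp (g := fun y => pos (rho - y))); last exact: gr.1.
  apply: continuous_measurable_fun => y.
  apply: (@cvg_comp _ _ _ (fun y => rho - y) (@pos R)); last exact: continuous_pos.
  by apply: cvgB; [exact: cvg_cst|exact: cvg_id].
have -> : c_const n * Num.sqrt rho ^+ n * expR (- (rho / 2)) = 2 * rho * radE rho.
  rewrite radE_const// -powR_mulrn ?sqrtr_ge0// -powR12_sqrt ?(ltW rho0)// -powRrM.
  rewrite (_ : 2^-1 * n%:R = 1 + s); last by rewrite /s; field.
  rewrite powRD ?powRr1 ?(ltW rho0)//; last by apply/implyP => _; rewrite gt_eqF.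
  by field.
(* The definition of [radE] with [radD rho = radP rho = v]. The right-hand side is the dual form of
   the bathtub problem, with multiplier rho. *)
have E1 : 2 * rho * radE rho = (n%:R - rho) * v + @radH1 R n rho.
  rewrite /radE -hr radPE//; field; rewrite gt_eqF//.
have gV : good (fun x => (n%:R - rho) * g x + pos (rho - rad2 x)).
  by apply: goodD => //; exact: goodZ.
rewrite E1 -gv -!gaussEZ// -gaussEB//; [|exact: goodZ|exact: goodM].
rewrite -gaussED//; last exact: goodZ.
apply: gaussE_le => //; first by apply: goodB; [exact: goodZ|exact: goodM].
move=> x; have /andP[g0 g1] := g01 x.
have h : (rho - rad2 x) * g x <= pos (rho - rad2 x).
  apply: (@le_trans _ _ (pos (rho - rad2 x) * g x)); first by rewrite ler_wpM2r// le_pos.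
  by rewrite ler_piMr// pos_ge0.
have -> : n%:R * g x - g x * rad2 x = (n%:R - rho) * g x + (rho - rad2 x) * g x by ring.
by rewrite lerD2l.
Qed.

End gamma_constant.

(** * Concavity by touching parabolas *)

Section second_order.
Context {R : realType}.

Lemma second_order_min (f f1 : R -> R) (u v c f2 : R) : u < c < v ->
  (forall t : R, u < t < v -> is_derive t 1 f (f1 t)) -> is_derive c 1 f1 f2 ->
  (forall t, u < t < v -> f c <= f t) -> f1 c = 0 /\ 0 <= f2.
Proof.
move=> /andP[uc cv] df df1 fc.
have uv : u <= v by rewrite ltW// (lt_trans uc).
have h0 : is_derive c 1 f 0.
  apply: (@derive1_at_min R f u v) => //.
  - by move=> t; rewrite in_itv/= => tuv; case: (df t tuv).
  - by rewrite in_itv/= uc cv.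
have c0 : f1 c = 0.
  have h1 := df c (introT andP (conj uc cv)).
  by rewrite -(@derive_val _ _ _ _ _ _ _ h1) (@derive_val _ _ _ _ _ _ _ h0).
split=> //; rewrite leNgt; apply/negP => f20.
have lim : (fun h : R => h^-1 *: ((f1 \o shift c) (h *: 1) - f1 c)) @ 0^' --> f2.
  have := @derive_val _ _ _ _ _ _ _ df1; rewrite /derive => <-.
  by case: df1.
have f2h : 0 < - f2 / 2 by rewrite divr_gt0// oppr_gt0.
have /cvgrPdist_lt /(_ _ f2h) := lim.
rewrite /= /dnbhs /within /= => -[d /= d0 hd].
pose e := Num.min d (v - c) / 2.
have m0 : 0 < Num.min d (v - c) by rewrite lt_min d0 subr_gt0.
have e0 : 0 < e by rewrite divr_gt0.
have [ed ev] : e < d /\ c + e < v.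
  have e1 : e < Num.min d (v - c) by rewrite /e; lra.
  have := lt_le_trans e1 (_ : _ <= d); rewrite ge_min lexx => /(_ isT) h1.
  have := lt_le_trans e1 (_ : _ <= v - c); rewrite ge_min lexx orbT => /(_ isT) h2.
  by split=> //; lra.
have neg (t : R) : c < t < c + e -> f1 t < 0.
  move=> /andP[t1 t2]; have tc0 : 0 < t - c by rewrite subr_gt0.
  have := hd (t - c); rewrite /ball/= sub0r normrN gtr0_norm//.
  move=> /(_ (ltac:(lra)) (ltac:(by rewrite gt_eqF))).
  rewrite /GRing.scale/= mulr1 subrK c0 subr0 => h.
  have h1 := le_lt_trans (ler_norm _) (ltac:(by rewrite distrC in h; exact: h)).
  have : (t - c)^-1 * f1 t < 0 by lra.
  by rewrite pmulr_rlt0// invr_gt0.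
have ce : c < c + e by rewrite ltrDl.
have [||x xI hx] := @MVT R f f1 c (c + e) ce.
- move=> x; rewrite in_itv/= => /andP[x1 x2]; apply: df.
  by rewrite (lt_trans uc)//= (lt_trans x2).
- apply: derivable_within_continuous => x; rewrite in_itv/= => /andP[x1 x2].
  by case: (df x (ltac:(by rewrite (lt_le_trans uc)//= (le_lt_trans x2)))).
have := fc (c + e); rewrite ev (lt_trans uc ce) => /(_ isT).
rewrite -subr_ge0 hx addrC addKr pmulr_lge0// leNgt.
by move: xI; rewrite in_itv/= => xI; rewrite neg.
Qed.

End second_order.

Section concavity.
Context {R : realType} {n : nat}.
Variables (sigma : R -> R) (B : R -> R) (Bb : R) (a : R -> R).
Hypothesis n_gt0 : (0 < n)%N.
Hypothesis sigma_d : forall x, 0 < x < 1 ->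
  [/\ derivable sigma x 1, derivable (derive1 sigma) x 1 & 0 < (derive1 sigma) x].
Hypothesis B_le : forall v, 0 < v < 1 -> `|B v| <= Bb.
Hypothesis ode : forall v, 0 < v < 1 ->
  1 + (derive1 (derive1 sigma)) v * v / (derive1 sigma) v = 2 / n%:R - B v / (n%:R ^+ 2 * v).
Hypothesis a01 : forall t, 0 <= t <= 1 -> 0 < a t < 1.
Hypothesis approx : forall c e : R, 0 < e ->
  exists Z Z1 Z2 : R -> R, forall t : R, 0 <= t <= 1 ->
  [/\ is_derive t 1 Z (Z1 t), is_derive t 1 Z1 (Z2 t), `|Z t - a t| <= e &
    0 < Z t < 1 -> Z2 t <= Z1 t ^+ 2 / Z t - 2 * c * Z1 t + c ^+ 2 * B (Z t) + c ^+ 2 * e].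

Local Notation s1 := (derive1 sigma).
Local Notation s2 := (derive1 (derive1 sigma)).

Let ds v : 0 < v < 1 -> is_derive (v : R) 1 sigma (s1 v).
Proof. by move=> /sigma_d[h _ _]; rewrite derive1E; exact: derivableP. Qed.

Let ds1 v : 0 < v < 1 -> is_derive (v : R) 1 s1 (s2 v).
Proof. by move=> /sigma_d[_ h _]; rewrite derive1E; exact: derivableP. Qed.

Let s1_gt0 v : 0 < v < 1 -> 0 < s1 v. Proof. by move=> /sigma_d[]. Qed.

(** [a] is known only through uniform approximants and inherits continuity from them; the drift 0 is
    an arbitrary choice. *)
Let a_cont : {within `[0, 1], continuous a}.
Proof.
apply/subspace_continuousP => t /=; rewrite in_itv/= => t01.
apply/cvgrPdist_le => e e0.
have e4 : 0 < e / 4 by rewrite divr_gt0.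
have [Z [Z1 [Z2 hZ]]] := approx 0 e4.
have [dZ _ at_ _] := hZ t t01.
have cZ : {for t, continuous Z}.
  by apply: differentiable_continuous; apply/derivable1_diffP; case: dZ.
have /cvgrPdist_le/(_ _ e4) nZ := cZ.
rewrite near_withinE; near=> s => /=; rewrite in_itv/= => s01.
have [_ _ as_ _] := hZ s s01.
have h : `|Z t - Z s| <= e / 4 by near: s; exact: nZ.
rewrite (_ : a t - a s = (Z t - Z s) - (Z t - a t) + (Z s - a s)); last by ring.
apply: le_trans (ler_normD _ _) _; apply: le_trans (lerD (ler_normB _ _) (lexx _)) _.
lra.
Unshelve. all: by end_near. Qed.

Let S t := sigma (a t).

Let S_cont : {within `[0, 1], continuous S}.
Proof.
apply/subspace_continuousP => t /=; rewrite in_itv/= => t01.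
apply: (@cvg_comp _ _ _ a sigma _ (nbhs (a t))).
  have /subspace_continuousP := a_cont; apply => /=; first by rewrite in_itv.
have h : {for a t, continuous sigma}.
  by apply: differentiable_continuous; apply/derivable1_diffP; case: (ds (a01 t01)).
exact: h.
Qed.

Let sigma_lip (u v : R) : 0 < u -> u <= v -> v < 1 -> exists2 L : R, 0 < L &
  forall x y, u <= x <= v -> u <= y <= v -> `|sigma x - sigma y| <= L * `|x - y|.
Proof.
move=> u0 uv v1.
have in01 x : u <= x <= v -> 0 < x < 1.
  by move=> /andP[h1 h2]; rewrite (lt_le_trans u0)//= (le_lt_trans h2).
have cs1 : {within `[u, v], continuous s1}.
  apply: derivable_within_continuous => x; rewrite in_itv/= => /in01 h.
  by case: (ds1 h).
have [w wI wmax] := EVT_max uv cs1.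
have w0 : 0 < s1 w by apply/s1_gt0/in01; move: wI; rewrite in_itv.
exists (s1 w) => // x y; wlog xy : x y / x <= y.
  move=> hw xI yI; have [h|/ltW h] := leP x y; first exact: hw.
  by rewrite distrC (distrC x); exact: hw.
move=> /andP[x1 x2] /andP[y1 y2].
have [||z zI hz] := @MVT_segment R sigma s1 x y xy.
- move=> z; rewrite in_itv/= => /andP[z1 z2]; apply/ds/in01.
  by rewrite (le_trans x1 (ltW z1)) (le_trans (ltW z2) y2).
- apply: derivable_within_continuous => z; rewrite in_itv/= => /andP[z1 z2].
  by case: (ds (in01 z (ltac:(by rewrite (le_trans x1 z1) (le_trans z2 y2))))).
rewrite distrC (distrC x) hz normrM ler_wpM2r//.
have zuv : u <= z <= v.
  by move: zI; rewrite in_itv/= => /andP[z1 z2]; rewrite (le_trans x1 z1) (le_trans z2 y2).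
by rewrite gtr0_norm ?s1_gt0 ?in01// wmax// in_itv.
Qed.

(* The approximants satisfy the differential inequality with the given drift c, and the
   quadratic form in Z1 vanishes when c = Z1 / (n Z). *)
Let touching (P P1 : R -> R) (P2 t0 : R) (c : R) : 0 < P2 -> 0 < t0 < 1 ->
  (forall t : R, is_derive t 1 P (P1 t)) -> (forall t : R, is_derive t 1 P1 P2) ->
  (forall t, 0 <= t <= 1 -> S t0 - P t0 + P2 / 2 * (t - t0) ^+ 2 <= S t - P t) ->
  exists2 L : R, 0 < L & exists2 e0 : R, 0 < e0 & forall e, 0 < e < e0 ->
  exists t z : R, [/\ 0 < z < 1, 0 < t < 1, `|z - a t| <= e, (t - t0) ^+ 2 <= L * e &
    let g := P1 t / (n%:R * (s1 z * z)) in
    P2 <= s1 z * (`|g - c| * (2 * n%:R * `|z * g| + Bb * (`|g| + `|c|)) + c ^+ 2 * e)].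
Proof.
move=> P20 /andP[t00 t01] dP dP1 tch.
have [m mI mmin] := EVT_min ler01 a_cont.
have [M MI Mmax] := EVT_max ler01 a_cont.
rewrite in_itv/= in mI; rewrite in_itv/= in MI.
have /andP[m0 m1] := a01 mI; have /andP[M0 M1] := a01 MI.
have mM : a m <= a M by apply: Mmax; rewrite in_itv.
(* A compact interval inside ]0, 1[ that contains the values of [a] with room for the approximants,
   and on which [sigma] is Lipschitz. *)
pose u := a m / 2; pose v := (1 + a M) / 2.
have [||| L L0 hL] := @sigma_lip u v; rewrite /u /v; [lra..|].
exists (4 * L / P2); first by rewrite divr_gt0// mulr_gt0.
pose d0 := Num.min t0 (1 - t0).
have d00 : 0 < d0 by rewrite lt_min t00 subr_gt0.
(* The first two bounds keep Z in [u, v]; the third forces the minimum point into ]0, 1[. *)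
exists (Num.min (Num.min u (v - a M)) (d0 ^+ 2 * P2 / (4 * L))).
  have u0 : 0 < u by rewrite /u; lra.
  have v0 : 0 < v - a M by rewrite /v; lra.
  by rewrite !lt_min u0 v0 divr_gt0 ?mulr_gt0 ?exprn_gt0.
move=> e /andP[e0]; rewrite !lt_min => /andP[/andP[eu ev] ed].
have [Z [Z1 [Z2 hZ]]] := approx c e0.
have Zuv t : 0 <= t <= 1 -> u <= Z t <= v.
  move=> tI; have [_ _] := hZ t tI; rewrite ler_norml => /andP[h1 h2] _.
  have h3 := mmin t (ltac:(by rewrite in_itv)).
  have h4 := Mmax t (ltac:(by rewrite in_itv)).
  by rewrite /u /v in eu ev *; apply/andP; lra.
have auv t : 0 <= t <= 1 -> u <= a t <= v.
  move=> tI; have h3 := mmin t (ltac:(by rewrite in_itv)).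
  have h4 := Mmax t (ltac:(by rewrite in_itv)).
  by rewrite /u /v in eu ev *; apply/andP; lra.
have in01 z : u <= z <= v -> 0 < z < 1.
  by rewrite /u /v => /andP[h1 h2]; apply/andP; lra.
have SL t : 0 <= t <= 1 -> `|sigma (Z t) - S t| <= L * e.
  move=> tI; apply: le_trans (hL _ _ (Zuv t tI) (auv t tI)) _.
  by rewrite ler_wpM2l ?(ltW L0)//; case: (hZ t tI).
pose f t := sigma (Z t) - P t.
pose f1 t := s1 (Z t) * Z1 t - P1 t.
have df t : 0 <= t <= 1 -> is_derive (t : R) 1 f (f1 t).
  move=> tI; have [dZ _ _ _] := hZ t tI.
  have d1 := @is_derive1_comp R sigma Z t _ _ (ds (in01 _ (Zuv t tI))) dZ.
  have dPt := dP t.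
  exact: is_deriveB.
have [t tI tmin] : exists2 t : R, t \in `[0, 1] & forall s, s \in `[0, 1] -> f t <= f s.
  apply: EVT_min; first exact: ler01.
  apply: derivable_within_continuous => s; rewrite in_itv/= => sI.
  by case: (df s sI).
rewrite in_itv/= in tI.
(* Replacing S by sigma o Z costs at most L e at t and at t0, and the quadratic margin at t cannot
   exceed this cost. *)
have tt0 : (t - t0) ^+ 2 <= 4 * L / P2 * e.
  have h1 := tmin t0 (ltac:(by rewrite in_itv/= (ltW t00) (ltW t01))).
  have h2 := tch t tI.
  have := SL t tI; have := SL t0 (ltac:(by rewrite (ltW t00) (ltW t01))).
  rewrite !ler_norml => /andP[h3 h4] /andP[h5 h6]; rewrite /f in h1.
  rewrite -mulrA [_^-1 * e]mulrC mulrA ler_pdivlMr//.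
  move: h2; set q := (t - t0) ^+ 2 => h2.
  have -> : q * P2 = 2 * (P2 / 2 * q) by field.
  move: h2; set q' := P2 / 2 * q => h2; lra.
have tI' : 0 < t < 1.
  have hd : (t - t0) ^+ 2 < d0 ^+ 2.
    apply: le_lt_trans tt0 _; rewrite mulrC -ltr_pdivlMr ?divr_gt0 ?mulr_gt0//.
    by rewrite invf_div mulrA.
  have : `|t - t0| < d0.
    by rewrite -(ltr_pXn2r (ltn0Sn 1)) ?nnegrE ?(ltW d00)// real_normK ?num_real.
  rewrite ltr_norml /d0 !lt_min ltrNl !lt_min => /andP[/andP[h1 _] /andP[_ h2]].
  by apply/andP; lra.
have [dZ dZ1 Za hZ2] := hZ t tI.
have zin := in01 _ (Zuv t tI).
exists t, (Z t); split=> //=.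
have df1 : is_derive t 1 f1 (s2 (Z t) * Z1 t * Z1 t + s1 (Z t) * Z2 t - P2).
  have d1 := @is_derive1_comp R s1 Z t _ _ (ds1 zin) dZ.
  have d2 := is_deriveM d1 dZ1.
  have d3 := is_deriveB d2 (dP1 t).
  rewrite (_ : s2 (Z t) * Z1 t * Z1 t + s1 (Z t) * Z2 t - P2 =
    ((s1 \o Z) t *: Z2 t + Z1 t *: (s2 (Z t) * Z1 t)) - P2); first exact: d3.
  by rewrite /GRing.scale/=; ring.
have [f10 f20] : f1 t = 0 /\ 0 <= s2 (Z t) * Z1 t * Z1 t + s1 (Z t) * Z2 t - P2.
  apply: (@second_order_min R f f1 0 1 t) => //.
    by move=> s /andP[h1 h2]; apply: df; rewrite (ltW h1) (ltW h2).
  by move=> s /andP[h1 h2]; apply: tmin; rewrite in_itv/= (ltW h1) (ltW h2).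
move: (hZ2 zin) (s1_gt0 zin) (ode zin) (B_le zin) f10 f20 (zin); rewrite /f1.
set z := Z t; set y := Z1 t; set w := Z2 t; set s := s1 z; set s' := s2 z; set b := B z.
move=> hw s0 hode hb /eqP; rewrite subr_eq0 => /eqP hP f20 /andP[z0 z1].
rewrite subr_ge0 in f20; apply: le_trans f20 _.
have N0 : 0 < n%:R :> R by rewrite ltr0n.
set g := P1 t / _.
have gE : g = y / (n%:R * z) by rewrite /g -hP; field; rewrite !gt_eqF.
have yE : y = n%:R * z * g by rewrite gE; field; rewrite !gt_eqF.
have s'E : s' = s * (2 / n%:R - b / (n%:R ^+ 2 * z) - 1) / z.
  by rewrite -hode; field; rewrite !gt_eqF.
have -> : s' * y * y + s * w = s * (s' / s * y ^+ 2 + w) by field; rewrite gt_eqF.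
rewrite ler_wpM2l ?(ltW s0)//.
(* After inserting y = n z g and the differential equation, the main terms become 2 n z g (g - c) -
   b (g^2 - c^2). *)
apply: (@le_trans _ _ ((g - c) * (2 * n%:R * (z * g) - b * (g + c)) + c ^+ 2 * e)).
  rewrite [leRHS](_ : _ = s' / s * y ^+ 2 +
      (y ^+ 2 / z - 2 * c * y + c ^+ 2 * b + c ^+ 2 * e)).
    by rewrite lerD2l.
  by rewrite s'E yE; field; rewrite !gt_eqF.
rewrite lerD2r; apply: le_trans (ler_norm _) _; rewrite normrM ler_wpM2l//.
apply: le_trans (ler_normB _ _) _.
rewrite (normrM (2 * n%:R)) (normrM b) (normrM 2) !normr_nat lerD//.
by rewrite ler_pM// ler_normD.
Qed.

Lemma sigma_concave (t : R) : 0 <= t <= 1 ->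
  (1 - t) * sigma (a 0) + t * sigma (a 1) <= sigma (a t).
Proof.
move=> tI; rewrite leNgt; apply/negP => hlt.
pose A0 := sigma (a 0); pose A1 := sigma (a 1).
pose k := (1 - t) * A0 + t * A1 - sigma (a t).
have k0 : 0 < k by rewrite subr_gt0.
(* The chord plus a convex parabola vanishing at both ends. It is still above S at t because t - t^2
   < 1, so S - P has a negative interior minimum. *)
pose P (s : R) := A0 + s * (A1 - A0) + k * (s ^+ 2 - s).
pose f s := S s - P s.
have cP : continuous P.
  move=> s; apply: cvgD.
    by apply: cvgD; [exact: cvg_cst|apply: cvgM; [exact: cvg_id|exact: cvg_cst]].
  apply: cvgM; first exact: cvg_cst.
  by apply: cvgB; [apply: cvgM|]; exact: cvg_id.
have cf : {within `[0, 1], continuous f}.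
  by move=> s; apply: cvgB; [exact: S_cont|exact: continuous_subspaceT].
have [t0 t0I t0min] := EVT_min ler01 cf.
have ft : f t < 0.
  rewrite /f /P /S.
  have -> : sigma (a t) - (A0 + t * (A1 - A0) + k * (t ^+ 2 - t)) = - k + k * (t - t ^+ 2).
    by rewrite /k; ring.
  have : t - t ^+ 2 <= 1 / 2 by have := sqr_ge0 (t - 1 / 2); nra.
  move=> h'; have hk : k * (t - t ^+ 2) <= k * (1 / 2) by rewrite ler_wpM2l ?(ltW k0).
  by apply: le_lt_trans (lerD (lexx _) hk) _; lra.
have ft0 : f t0 < 0 by apply: le_lt_trans ft; apply: t0min; rewrite in_itv.
have t01 : 0 < t0 < 1.
  move: t0I; rewrite in_itv/= => /andP[h1 h2]; rewrite !lt_neqAle h1 h2 !andbT.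
  have f0 : f 0 = 0 by rewrite /f /P /S -/A0; ring.
  have f1 : f 1 = 0 by rewrite /f /P /S -/A1; ring.
  apply/andP; split; apply/eqP => h; move: ft0; first by rewrite -h f0 ltxx.
  by rewrite h f1 ltxx.
(* Half of the curvature of P is given up for a quadratic margin around t0; Q still has second
   derivative k. *)
pose Q (s : R) := P s - k / 2 * (s - t0) ^+ 2.
pose Q1 (s : R) := A1 - A0 + k * (2 * s - 1) - k * (s - t0).
have dQ (s : R) : is_derive s 1 Q (Q1 s).
  by apply: is_derive_eq; rewrite /GRing.scale/= /Q1; field.
have dQ1 (s : R) : is_derive s 1 Q1 k.
  by apply: is_derive_eq; rewrite /GRing.scale/=; ring.
have tch s : 0 <= s <= 1 -> S t0 - Q t0 + k / 2 * (s - t0) ^+ 2 <= S s - Q s.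
  move=> sI; have := t0min s (ltac:(by rewrite in_itv)); rewrite /f /Q subrr expr0n mulr0 subr0.
  by set q := k / 2 * _; lra.
have t0I' : 0 <= t0 <= 1 by move: t0I; rewrite in_itv.
(* The value of Z' / (n Z) at t0 that the parabola predicts, available before any approximant is
   chosen. The actual value g tends to it as e tends to 0, and the bound on k then tends to 0. *)
pose c := Q1 t0 / (n%:R * (s1 (a t0) * a t0)).
have [L L0 [e0 e00 hL]] := @touching Q Q1 k t0 c k0 t01 dQ dQ1 tch.
pose e_ (m : nat) := e0 / 2 * m.+1%:R^-1.
have e_0 m : 0 < e_ m < e0.
  rewrite mulr_gt0 ?divr_gt0//= (@le_lt_trans _ _ (e0 / 2))//; last lra.
  by rewrite ler_piMr ?invf_le1 ?ler1n// ltW// divr_gt0.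
have ce : e_ @ \oo --> (0 : R).
  rewrite -(mulr0 (e0 / 2)); apply: cvgM; first exact: cvg_cst.
  exact: cvg_harmonic.
have hL' m : exists tz : R * R, [/\ 0 < tz.2 < 1, 0 < tz.1 < 1, `|tz.2 - a tz.1| <= e_ m,
    (tz.1 - t0) ^+ 2 <= L * e_ m & let g := Q1 tz.1 / (n%:R * (s1 tz.2 * tz.2)) in
    k <= s1 tz.2 * (`|g - c| * (2 * n%:R * `|tz.2 * g| + Bb * (`|g| + `|c|)) + c ^+ 2 * e_ m)].
  by have [t' [z' h]] := hL _ (e_0 m); exists (t', z').
have [tz htz] := choice hL'.
pose t_ m := (tz m).1; pose z_ m := (tz m).2.
have ct : t_ @ \oo --> t0.
  apply/cvgrPdist_le => e e1; have e2 : 0 < e ^+ 2 / L by rewrite divr_gt0// exprn_gt0.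
  have /cvgrPdist_le/(_ _ e2) := ce; apply: filterS => m; rewrite sub0r normrN => h.
  have [_ _ _ h2 _] := htz m.
  rewrite distrC -(ler_pXn2r (ltn0Sn 1)) ?nnegrE ?(ltW e1)// real_normK ?num_real//.
  apply: le_trans h2 _; rewrite mulrC -ler_pdivlMr//.
  by rewrite (le_trans (ler_norm _)).
have ca : (fun m => a (t_ m)) @ \oo --> a t0.
  have /subspace_continuousP/(_ t0) := a_cont; rewrite /= in_itv/= => /(_ t0I') h.
  apply/cvgrPdist_le => e e1; have /cvgrPdist_le/(_ _ e1) := h.
  rewrite near_withinE => hn; have [N _ hN] := ct _ hn; exists N => // m /hN /=.
  have [_ /andP[h1 h2] _ _ _] := htz m.
  by rewrite in_itv/= (ltW h1) (ltW h2) => /(_ isT).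
have cz : z_ @ \oo --> a t0.
  have -> : z_ = fun m => a (t_ m) + (z_ m - a (t_ m)) by apply/funext => m; ring.
  rewrite -[X in _ --> X]addr0; apply: cvgD => //.
  apply/cvgrPdist_le => e e1; have /cvgrPdist_le/(_ _ e1) := ce; apply: filterS => m.
  rewrite !sub0r !normrN => h; have [_ _ h2 _ _] := htz m.
  by apply: le_trans h2 _; rewrite (le_trans (ler_norm _)).
have a0I := a01 t0I'.
have cs : (fun m => s1 (z_ m)) @ \oo --> s1 (a t0).
  apply: (@cvg_comp _ _ _ z_ s1 _ (nbhs (a t0))) => //.
  have h : {for a t0, continuous s1}.
    by apply: differentiable_continuous; apply/derivable1_diffP; case: (ds1 a0I).
  exact: h.
have cQ : (fun m => Q1 (t_ m)) @ \oo --> Q1 t0.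
  apply: (@cvg_comp _ _ _ t_ Q1 _ (nbhs t0)) => //.
  have h : {for t0, continuous Q1}.
    by apply: differentiable_continuous; apply/derivable1_diffP; case: (dQ1 t0).
  exact: h.
pose g_ m := Q1 (t_ m) / (n%:R * (s1 (z_ m) * z_ m)).
have cg : g_ @ \oo --> c.
  apply: cvgM => //; apply: cvgV.
    have /andP[a00 _] := a0I.
    by rewrite gt_eqF// mulr_gt0 ?ltr0n// mulr_gt0// s1_gt0.
  by apply: cvgM; [exact: cvg_cst|exact: cvgM].
have : k <= s1 (a t0) * (`|c - c| * (2 * n%:R * `|a t0 * c| + Bb * (`|c| + `|c|)) + c ^+ 2 * 0).
  have cu : (fun m => s1 (z_ m) * (`|g_ m - c| * (2 * n%:R * `|z_ m * g_ m| +
      Bb * (`|g_ m| + `|c|)) + c ^+ 2 * e_ m)) @ \oo --> s1 (a t0) * (`|c - c| *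
      (2 * n%:R * `|a t0 * c| + Bb * (`|c| + `|c|)) + c ^+ 2 * 0).
    apply: cvgM => //; apply: cvgD; last by apply: cvgM; [exact: cvg_cst|].
    apply: cvgM; first by apply: cvg_norm; apply: cvgB => //; exact: cvg_cst.
    apply: cvgD.
      by apply: cvgM; [exact: cvg_cst|apply: cvg_norm; exact: cvgM].
    apply: cvgM; first exact: cvg_cst.
    by apply: cvgD; [exact: cvg_norm|exact: cvg_cst].
  rewrite -(cvg_lim (@Rhausdorff R) cu); apply: limr_ge; first by apply/cvgP: cu.
  by near=> m; have [_ _ _ _] := htz m.
by rewrite subrr normr0 mul0r mulr0 addr0 mulr0 leNgt k0.
Unshelve. all: by end_near. Qed.

End concavity.

(** * Positivity and dilation *)

Lemma exp_growth (R : realType) (g g' : R -> R) (n : nat) :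
  (forall s : R, is_derive s 1 g (g' s)) -> (forall s, g' s <= n%:R * g s) ->
  forall t, 0 <= t -> g t <= expR t ^+ n * g 0.
Proof.
move=> dg g'_le t t0; pose F (s : R) := g s * expR (- (n%:R * s)).
pose F' (s : R) := (g' s - n%:R * g s) * expR (- (n%:R * s)).
have dF (s : R) : is_derive s 1 F (F' s).
  have d1 := dg s; apply: is_derive_eq; rewrite /GRing.scale/= /F'; ring.
have [|c _ h] := @MVT_segment R F F' 0 t t0.
  by apply: derivable_within_continuous => s _; case: (dF s).
have Ft : F t <= F 0.
  rewrite -subr_le0 h subr0 mulr_le0_ge0// mulr_le0_ge0 ?expR_ge0// subr_le0.
  exact: g'_le.
move: Ft; rewrite /F mulr0 oppr0 expR0 mulr1 expRN ler_pdivrMr ?expR_gt0//.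
by rewrite mulrC expRM_natl.
Qed.

Section strip_scaling.
Context {R : realType} {n : nat} {I : finType}.
Variable th : I -> 'I_n -> R.

Section dilation.
Variables (b : I -> R) (lam : R).
Hypothesis lam_gt0 : 0 < lam.

(** In [zeta] the product of slope and width is unchanged while the linear part is divided by exp t:
    this is the weight evaluated at exp(- t) x. *)
Let w (t : R) := wt (spot th (fun j => expR t * b j) (lam * expR (- t))) 1.
Let w' (t : R) (x : 'rV[R]_n) : R :=
  (\sum_i x ord0 i * spot1 th (fun j => expR t * b j) (lam * expR (- t)) i x) * w t x.
Let pot t := strip_potential th (fun j => expR t * b j) (lam * expR (- t)).

Let nice_w t : nice (w t) := nice_wt (pot t) ler01.

Lemma is_derive_dilation (t : R) (x : 'rV[R]_n) : is_derive t 1 (fun t => w t x) (w' t x).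
Proof.
pose z j (t : R) := zeta th (fun j => expR t * b j) (lam * expR (- t)) j x.
have zE j s : z j s = lam * b j - lam * expR (- s) * dot (th j) x.
  by rewrite /z /zeta mulrBr -!mulrA [expR (- s) * (_ * _)]mulrA -expRD addNr expR0 mul1r.
have dz j : is_derive t 1 (z j) (lam * expR (- t) * dot (th j) x).
  rewrite (_ : z j = fun s => lam * b j - lam * expR (- s) * dot (th j) x); last first.
    by apply/funext => s; exact: zE.
  by apply: is_derive_eq; rewrite /GRing.scale/=; ring.
pose S (s : R) := spot th (fun j => expR s * b j) (lam * expR (- s)) x.
have dS : is_derive t 1 S (- \sum_i x ord0 i *
    spot1 th (fun j => expR t * b j) (lam * expR (- t)) i x).
  have -> : \sum_i x ord0 i * spot1 th (fun j => expR t * b j) (lam * expR (- t)) i x =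
      \sum_j logistic (z j t) * (lam * expR (- t) * dot (th j) x).
    under eq_bigr do rewrite mulr_sumr.
    rewrite exchange_big /=; apply: eq_bigr => j _; rewrite /dot !mulr_sumr.
    by apply: eq_bigr => i _; rewrite /prob -/(z j t); ring.
  rewrite /S /spot -sumrN; elim: (index_enum I) => [|j r IH].
    rewrite big_nil (_ : (fun s => _) = fun=> 0); first exact: is_derive_cst.
    by apply/funext => s; rewrite big_nil.
  rewrite big_cons (_ : (fun s => _) = fun s => softplus (z j s) + \sum_(j <- r)
      softplus (zeta th (fun j => expR s * b j) (lam * expR (- s)) j x)); last first.
    by apply/funext => s; rewrite big_cons.
  apply: is_deriveD; rewrite -mulNr.
  exact: (@is_derive1_comp R (@softplus R) (z j) _ _ _ (is_derive_softplus _) (dz j)).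
have dN : is_derive t 1 (fun s => - (1 * S s)) (\sum_i x ord0 i *
    spot1 th (fun j => expR t * b j) (lam * expR (- t)) i x).
  by apply: is_derive_eq; rewrite /GRing.scale/=; ring.
have := @is_derive1_comp R (@expR R) (fun s => - (1 * S s)) _ _ _ (is_derive_expR _) dN.
by rewrite mulrC.
Qed.

Lemma is_derive_gaussE_dilation (t : R) :
  is_derive t 1 (fun t => gaussE (w t)) (gaussE (w' t)).
Proof.
pose G (x : 'rV[R]_n) := \sum_i `|x ord0 i| * \sum_j lam * expR (1 - t) * `|th j i|.
apply: (@gaussE_derive _ _ w w' G (t - 1) (t + 1)).
- by apply/andP; lra.
- by move=> s _; exact: nice_good.
- by move=> s x _; exact: is_derive_dilation.
- by apply: good_sum => i; apply: goodM; [exact/good_norm/good_coord|exact: good_cst].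
move=> s x /andP[ts st].
have p0 := pot s; rewrite normrM -[leRHS]mulr1 ler_pM//; last first.
  by rewrite ger0_norm ?(ltW (wt_gt0 _ _ _))// (wt_le1 p0).
apply: le_trans (ler_norm_sum _ _ _) _; apply: ler_sum => i _.
rewrite normrM ler_wpM2l//; apply: le_trans (ler_norm_sum _ _ _) _; apply: ler_sum => j _.
rewrite normrM; apply: le_trans (ler_piMr _ (logistic_norm _)) _ => //.
rewrite normrM ler_wpM2r//.
rewrite gtr0_norm ?mulr_gt0 ?expR_gt0// ler_wpM2l ?(ltW lam_gt0)// ler_expR; lra.
Qed.

(** Under the weight, integration by parts gives E [x_i^2 + x_i d_i W] = E [1] for each i; the
    squares are dropped. *)
Lemma gaussE_dilation_le (t : R) : gaussE (w' t) <= n%:R * gaussE (w t).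
Proof.
have p0 := pot t.
have nW i := pot1_nice p0 i.
pose W := spot th (fun j => expR t * b j) (lam * expR (- t)).
pose W1 := spot1 th (fun j => expR t * b j) (lam * expR (- t)).
have nxW i : nice (fun x => x ord0 i * W1 i x) := niceM (nice_coord i) (nW i).
have ibp i : avg W 1 (fun x => x ord0 i * W1 i x) <= gaussE (w t).
  have nx := @nice_coord R n i.
  have nx2 : nice (fun x : 'rV[R]_n => x ord0 i ^+ 2) by exact: niceX.
  have -> : gaussE (w t) = avg W 1 (fun=> (i == i)%:R).
    by congr gaussE; apply/funext => x; rewrite eqxx mulr1.
  rewrite (avg_ibp p0 ler01 nx (nice_cst _) (partial_coord i i)).
  have -> : avg W 1 (fun x => (x ord0 i + 1 * spot1 th (fun j => expR t * b j)
      (lam * expR (- t)) i x) * x ord0 i) =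
      avg W 1 (fun x => x ord0 i ^+ 2 + x ord0 i * W1 i x).
    by congr avg; apply/funext => x; rewrite /W1; ring.
  by rewrite (avgD p0)// lerDr; apply: avg_ge0 => x; exact: sqr_ge0.
have -> : gaussE (w' t) = \sum_i avg W 1 (fun x => x ord0 i * W1 i x).
  by rewrite -(avg_sum p0)//; congr gaussE; apply/funext => x; rewrite /w' mulrC.
apply: (@le_trans _ _ (\sum_(i < n) gaussE (w t))); first exact: ler_sum.
by rewrite sumr_const card_ord mulr_natl.
Qed.

Lemma gaussE_dilation (s : R) : 1 <= s ->
  gaussE (wt (spot th (fun j => s * b j) (lam * s^-1)) 1) <=
  s ^+ n * gaussE (wt (spot th b lam) 1).
Proof.
move=> s1; have s0 : 0 < s by exact: lt_le_trans s1.
have e1 : wt (spot th (fun j => s * b j) (lam * s^-1)) 1 = w (ln s).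
  by rewrite /w expRN lnK.
have e2 : wt (spot th b lam) 1 = w 0.
  rewrite /w oppr0 expR0 mulr1; congr (wt (spot th _ lam) 1).
  by apply/funext => j; rewrite mul1r.
rewrite e1 e2 -{2}(lnK s0).
exact: (exp_growth is_derive_gaussE_dilation gaussE_dilation_le (ln_ge0 s1)).
Qed.

End dilation.

Hypothesis thN0 : forall j, exists i, th j i != 0.

Lemma wt_sind_cvg b (lam_ : nat -> R) : (forall m, 0 < lam_ m) ->
  (fun m => (lam_ m)^-1) @ \oo --> (0 : R) ->
  (fun m => gaussE (wt (spot th b (lam_ m)) 1)) @ \oo --> gaussE (sind th b).
Proof.
move=> l0 cl; have [C C0 hC] := gaussE_var_le thN0.
have c1 : (fun m => 2 * (#|I|%:R * C) * (lam_ m)^-1) @ \oo --> 2 * (#|I|%:R * C) * 0.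
  by apply: cvgM => //; exact: cvg_cst.
rewrite mulr0 in c1.
apply/cvgrPdist_le => e e0; have /cvgrPdist_le/(_ _ e0) := c1; apply: filterS => m.
rewrite sub0r normrN => h; rewrite distrC; apply: le_trans (wt_sind_gaussE th b (l0 m)) _.
apply: le_trans (le_trans (ler_norm _) h); rewrite -!mulrA ler_wpM2l//.
rewrite mulr_natl -sumr_const; apply: ler_sum => j _; exact: hC.
Qed.

(** The limit of infinitely steep slopes in the smoothed bound. It stands in for a change of
    variables and serves both for positivity and for the approximation of convex sets from
    outside. *)
Lemma sind_dilation b (s : R) : 1 <= s ->
  gaussE (sind th (fun j => s * b j)) <= s ^+ n * gaussE (sind th b).
Proof.
move=> s1; have s0 : 0 < s by exact: lt_le_trans s1.
have cs : (fun m => gaussE (wt (spot th (fun j => s * b j) (m.+1%:R * s^-1)) 1)) @ \oo -->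
    gaussE (sind th (fun j => s * b j)).
  apply: wt_sind_cvg => [m|]; first by rewrite mulr_gt0 ?invr_gt0.
  rewrite (_ : (fun m => _) = fun m : nat => s * m.+1%:R^-1); last first.
    by apply/funext => m; rewrite invfM invrK mulrC.
  by rewrite -(mulr0 s); apply: cvgM; [exact: cvg_cst|exact: cvg_harmonic].
have c1 : (fun m => s ^+ n * gaussE (wt (spot th b m.+1%:R) 1)) @ \oo -->
    s ^+ n * gaussE (sind th b).
  apply: cvgM; first exact: cvg_cst.
  by apply: wt_sind_cvg => //; exact: cvg_harmonic.
apply: (ler_cvg_to cs c1); near=> m.
by apply: gaussE_dilation.
Unshelve. all: by end_near. Qed.

(** The dilates exhaust the space, so one of them has measure at least 1/2; the dilation bound then
    leaves positive measure for the set itself. *)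
Lemma sind_gt0 b : (forall j, 0 < b j) -> 0 < gaussE (sind th b).
Proof.
move=> b0.
have c1 : (fun m => gaussE (sind th (fun j => m.+1%:R * b j))) @ \oo -->
    gaussE (fun _ : 'rV[R]_n => 1 : R).
  apply: (@gaussE_dct _ _ (fun m => sind th (fun j => m.+1%:R * b j)) (fun=> 1) (fun=> 1)).
  - by move=> m; exact: (good_sind th _).1.
  - exact: mfun_cst.
  - exact: good_cst.
  - move=> m x; have /andP[h1 h2] := sind_itv th (fun j => m.+1%:R * b j) x.
    by rewrite ger0_norm.
  move=> x; apply: cvg_near_cst.
  have [r hr] : exists r : R, forall j, dot (th j) x <= r * b j.
    exists (\sum_j `|dot (th j) x / b j|) => j; rewrite -ler_pdivrMr//.
    rewrite (le_trans (ler_norm _))// (bigD1 j)//= lerDl; exact: sumr_ge0.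
  near=> m; rewrite /sind (_ : [forall j, _] = true)//; apply/forallP => j.
  apply: le_trans (hr j) _; rewrite ler_wpM2r ?(ltW (b0 j))//.
  apply: (@le_trans _ _ m%:R); last by rewrite ler_nat.
  by near: m; exact: nbhs_infty_ger.
rewrite gaussE_cst in c1.
have h2 : (0 : R) < 1 / 2 by [].
have /cvgrPdist_le/(_ _ h2)[m _ /(_ m (leqnn m)) /=] := c1.
move=> h; have h3 := le_trans (ler_norm _) h.
have m1 : 1 <= m.+1%:R :> R by rewrite ler1n.
have := sind_dilation b m1.
set a := gaussE (sind th b); set a' := gaussE _ in h3 *; move=> h4.
have : 0 < m.+1%:R ^+ n * a by apply: lt_le_trans h4; lra.
by rewrite pmulr_rgt0// exprn_gt0.
Unshelve. all: by end_near. Qed.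

End strip_scaling.

(** * Half-spaces have measure less than one *)

Section half_space.
Context {R : realType} {n : nat}.
Variable v : 'I_n -> R.
Hypothesis vN0 : exists i, v i != 0.

Let Y (x : 'rV[R]_n) : R := dot v x.
Let nY : nice Y.
Proof. by apply: nice_sum => i; apply: niceM (nice_cst _) (nice_coord i). Qed.

Let V : R := \sum_i v i ^+ 2.

Let partialY i : partial i Y (fun=> v i).
Proof.
have h k : partial i (fun x : 'rV[R]_n => v k * x ord0 k) (fun=> v k * (k == i)%:R).
  by apply: partialZ; exact: partial_coord.
have := partial_sum (index_enum 'I_n) xpredT h; congr (partial _ _ _).
apply/funext => x; rewrite (bigD1 i)//= eqxx mulr1 big1 ?addr0// => k /negbTE ->.
by rewrite mulr0.
Qed.

Let partialYX k i : partial i (fun x => Y x ^+ k.+1) (fun x => k.+1%:R * v i * Y x ^+ k).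
Proof.
elim: k => [|k IH].
  rewrite (_ : (fun x => Y x ^+ 1) = Y); last by apply/funext => x; rewrite expr1.
  rewrite (_ : (fun x => _ * Y x ^+ 0) = fun=> v i) => [//|].
  by apply/funext => x; rewrite expr0 mulr1 mul1r.
rewrite (_ : (fun x => Y x ^+ k.+2) = fun x => Y x * Y x ^+ k.+1); last first.
  by apply/funext => x; rewrite exprS.
rewrite (_ : (fun x => k.+2%:R * v i * Y x ^+ k.+1) =
    fun x => v i * Y x ^+ k.+1 + Y x * (k.+1%:R * v i * Y x ^+ k)).
  exact: partialM (partialY i) IH.
by apply/funext => x; move: (Y x) => y; rewrite -(natr1 k.+1) exprS; ring.
Qed.

Let moment k : gaussE (fun x => Y x ^+ k.+2) = k.+1%:R * V * gaussE (fun x => Y x ^+ k).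
Proof.
have dY i := partialYX k i.
have nYk m : nice (fun x => Y x ^+ m) by exact: niceX.
have ibp i : gaussE (fun x => k.+1%:R * v i * Y x ^+ k) =
    gaussE (fun x => x ord0 i * Y x ^+ k.+1).
  by apply: gaussE_ibp => //; exact: niceM (nice_cst _) (nYk k).
transitivity (\sum_i v i * gaussE (fun x => x ord0 i * Y x ^+ k.+1)).
  have g i : good (fun x => x ord0 i * Y x ^+ k.+1).
    by apply/nice_good/niceM => //; exact: nice_coord.
  under eq_bigr do rewrite -gaussEZ//.
  rewrite -gaussE_sum => [|i]; last exact: goodZ.
  congr gaussE; apply/funext => x; rewrite exprS /Y /dot mulr_suml.
  by apply: eq_bigr => i _; rewrite mulrA.
have gY : good (fun x => Y x ^+ k) := nice_good (nYk k).
rewrite mulr_sumr mulr_suml; apply: eq_bigr => i _.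
by rewrite -ibp gaussEZ//; ring.
Qed.

(* If Y <= h almost surely then |Y| <= |h| by symmetry, so the even moments would grow at
   most geometrically. *)
Lemma half_space_lt1 (h : R) : gaussE (fun x => (dot v x <= h)%R%:R) < 1.
Proof.
rewrite ltNge; apply/negP => hA.
pose A (x : 'rV[R]_n) : R := (Y x <= h)%R%:R.
have gY m : good (fun x => Y x ^+ m) by exact/nice_good/niceX.
have A01 x : 0 <= A x <= 1 by rewrite /A; case: (Y x <= h)%R; rewrite ?lexx ?ler01.
have gA : good A := good_sublevel h (nice_good nY).1.
pose A' x := 1 - A x.
have gA' : good A' by apply: goodB => //; exact: good_cst.
(* psi counts how many of Y <= h and - Y <= h fail; its mean is at most 0 by assumption and
   symmetry. *)
pose psi x := A' x + A' (- x).
have gpsi : good psi by apply: goodD => //; exact: goodNx.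
have psi02 x : 0 <= psi x <= 2.
  by have /andP[h1 h2] := A01 x; have /andP[h3 h4] := A01 (- x); rewrite /psi /A'; apply/andP; lra.
have Epsi : gaussE psi <= 0.
  rewrite gaussED//; last exact: goodNx.
  rewrite gaussEN// gaussEB//; last exact: good_cst.
  by rewrite gaussE_cst; move: hA; rewrite -/(gaussE A) => hA; lra.
(* A quantitative substitute for psi vanishing almost everywhere: G psi <= m psi + (2 / m) G^2, with
   m large. *)
have key (G : 'rV[R]_n -> R) : good G -> (forall x, 0 <= G x) ->
    gaussE (fun x => G x * psi x) <= 0.
  move=> gG G0; apply/ler_addgt0Pr => e e0; rewrite add0r.
  have gG2 : good (fun x => G x ^+ 2) by exact: goodX.
  have E0 : 0 <= gaussE (fun x => G x ^+ 2) by apply: gaussE_ge0 => x; exact: sqr_ge0.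
  set q := gaussE _ in E0; pose m := 2 * q / e + 1.
  have qe : 0 <= 2 * q / e by rewrite !mulr_ge0// invr_ge0 ltW.
  have m0 : 0 < m by rewrite ltr_wpDl.
  apply: (@le_trans _ _ (gaussE (fun x => m * psi x + 2 / m * G x ^+ 2))).
    apply: gaussE_le; first exact: goodM.
      by apply: goodD; exact: goodZ.
    move=> x; have /andP[p0 p2] := psi02 x; have g0 := G0 x.
    have h1 : G x <= m + m^-1 * G x ^+ 2.
      have [gm|/ltW gm] := leP (G x) m.
        by apply: le_trans gm _; rewrite lerDl mulr_ge0 ?sqr_ge0// invr_ge0 ltW.
      apply: (@le_trans _ _ (m^-1 * G x ^+ 2)); last by rewrite lerDr ltW.
      by rewrite mulrC ler_pdivlMr// expr2 ler_wpM2l.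
    apply: le_trans (ler_wpM2r p0 h1) _; rewrite mulrDl lerD2l mulrAC.
    rewrite (mulrC 2) -!mulrA ler_wpM2l ?invr_ge0 ?(ltW m0)// mulrCA.
    by rewrite mulrCA -expr2 ler_wpM2r ?sqr_ge0.
  rewrite gaussED ?gaussEZ//; try exact: goodZ.
  rewrite -/q; apply: (@le_trans _ _ (2 / m * q)).
    by rewrite gerDr pmulr_rle0.
  rewrite mulrAC ler_pdivrMr// /m mulrDr mulr1 mulrCA mulfV ?gt_eqF// mulr1 lerDl.
  exact: ltW.
have Yev k x : 0 <= Y x ^+ k.*2 by rewrite -mul2n exprM exprn_ge0// sqr_ge0.
have mk k : k.*2.+1%:R * V * gaussE (fun x => Y x ^+ k.*2) <=
    h ^+ 2 * gaussE (fun x => Y x ^+ k.*2).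
  have gp : good (fun x => Y x ^+ k.*2.+2 * psi x) by exact: goodM.
  rewrite -moment -gaussEZ//; apply: (@le_trans _ _
    (gaussE (fun x => h ^+ 2 * Y x ^+ k.*2 + Y x ^+ k.*2.+2 * psi x))); last first.
    rewrite gaussED//; last exact: goodZ.
    by rewrite gerDl; apply: key => // x; exact: (Yev k.+1).
  apply: gaussE_le => //; first by apply: goodD => //; exact: goodZ.
  move=> x; have y0 := Yev k x; have y2 := Yev k.+1 x; rewrite doubleS in y2.
  have [/andP[h1 h2]|hx] := boolP ((Y x <= h) && (Y (- x) <= h)).
    apply: (@le_trans _ _ (h ^+ 2 * Y x ^+ k.*2)); last first.
      by rewrite lerDl mulr_ge0//; have /andP[] := psi02 x.
    rewrite -addn2 exprD mulrC ler_wpM2r//.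
    rewrite /Y dotN in h2; rewrite -[leLHS]real_normK ?num_real// lerXn2r ?nnegrE//.
      by have := h1; rewrite /Y in h1 *; lra.
    by rewrite ler_norml lerNl h2.
  have : 1 <= psi x.
    have /andP[q1 q2] := A01 x; have /andP[q3 q4] := A01 (- x).
    move: hx; rewrite negb_and /psi /A'; case/orP => /negbTE hx.
      by rewrite {1}/A hx subr0 lerDl subr_ge0.
    by rewrite {2}/A hx subr0 lerDr subr_ge0.
  move=> p1; apply: (@le_trans _ _ (Y x ^+ k.*2.+2 * psi x)); first by rewrite ler_peMr.
  by rewrite lerDr mulr_ge0// sqr_ge0.
have V0 : 0 < V.
  have [i vi] := vN0; rewrite /V (bigD1 i)//= ltr_wpDr ?sumr_ge0//.
    by move=> k _; exact: sqr_ge0.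
  by rewrite lt_neqAle sqr_ge0 eq_sym sqrf_eq0 vi.
have mom0 k : 0 < gaussE (fun x => Y x ^+ k.*2).
  elim: k => [|k IH]; first by under eq_fun do rewrite expr0; rewrite gaussE_cst.
  by rewrite doubleS moment !mulr_gt0.
have big k : k.*2.+1%:R * V <= h ^+ 2 by have := mk k; rewrite ler_pM2r.
have := archi_boundP (_ : 0 <= h ^+ 2 / V); rewrite divr_ge0 ?sqr_ge0 ?(ltW V0)// => /(_ isT).
set k := Num.bound _; rewrite ltr_pdivrMr// ltNge => /negP; apply.
apply: le_trans (big k); rewrite ler_wpM2r ?(ltW V0)// ler_nat.
by rewrite -addnn -addSn (leq_trans (leqnSn k))// leq_addr.
Qed.

End half_space.

(** * Supporting functionals *)

Section hahn_banach.
Context {R : realType} {n : nat}.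
Local Notation V := 'rV[R]_n.
Implicit Types (p : V -> R) (x y v : V).

Definition sublinear p : Prop := (forall x y, p (x + y) <= p x + p y) /\
  (forall (t : R) x, 0 <= t -> p (t *: x) <= t * p x).

Lemma sublinear0 p : sublinear p -> p 0 = 0.
Proof.
move=> [pD pZ]; apply/eqP; rewrite eq_le; apply/andP; split.
  by have := pZ 0 0 (lexx 0); rewrite scale0r mul0r.
by have := pD 0 0; rewrite addr0 -[leLHS]addr0 lerD2l.
Qed.

Lemma sublinearZ p (t : R) x : sublinear p -> 0 <= t -> p (t *: x) = t * p x.
Proof.
move=> sp; have [pD pZ] := sp; rewrite le_eqVlt => /predU1P[<-|t0].
  by rewrite scale0r mul0r sublinear0.
apply/eqP; rewrite eq_le pZ ?(ltW t0)//= -ler_pdivlMl//.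
have ti : 0 <= t^-1 by rewrite invr_ge0 ltW.
by have := pZ t^-1 (t *: x) ti; rewrite scalerA mulVf ?gt_eqF// scale1r.
Qed.

(** The infimum over t >= 0 of p (x + t v) - t p v is still sublinear, and t = 1 at x = - v gives
    the last inequality, which forces additivity along v. *)
Lemma sublinear_step p v : sublinear p ->
  exists p', [/\ sublinear p', (forall x, p' x <= p x) & p' (- v) <= - p v].
Proof.
move=> sp; have [pD pZ] := sp.
pose S x : set R := [set p (x + t *: v) - t * p v | t in [set t : R | 0 <= t]].
pose p' x := inf (S x).
have lb x (t : R) : 0 <= t -> - p (- x) <= p (x + t *: v) - t * p v.
  move=> t0; rewrite lerBrDr -(sublinearZ _ sp t0) addrC lerBlDr.
  by have := pD (x + t *: v) (- x); rewrite addrAC subrr add0r.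
have hS x : has_inf (S x).
  split; first by exists (p (x + 0 *: v) - 0 * p v); exists 0 => //=.
  by exists (- p (- x)) => _ [t t0 <-]; exact: lb.
have p'_le x (t : R) : 0 <= t -> p' x <= p (x + t *: v) - t * p v.
  by move=> t0; apply: (ge_inf (hS x).2); exists t.
have p'_ge x (c : R) : (forall t : R, 0 <= t -> c <= p (x + t *: v) - t * p v) -> c <= p' x.
  by move=> h; apply: (lb_le_inf (hS x).1) => _ [t t0 <-]; exact: h.
have p'p x : p' x <= p x by have := p'_le x 0 (lexx 0); rewrite scale0r addr0 mul0r subr0.
exists p'; split => //; last first.
  have := p'_le (- v) 1 ler01; rewrite scale1r addNr (sublinear0 sp) mul1r add0r//.
split=> [x y|t x t0].
  rewrite -lerBlDl; apply: (p'_ge) => s s0.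
  rewrite lerBlDl -lerBlDr; apply: (p'_ge) => t t0; rewrite lerBlDr.
  apply: le_trans (p'_le (x + y) (t + s) (addr_ge0 t0 s0)) _.
  rewrite scalerDl addrACA mulrDl opprD [leRHS]addrACA lerD2r.
  exact: pD.
move: t0; rewrite le_eqVlt => /predU1P[<-|t0].
  by rewrite scale0r mul0r (le_trans (p'p 0))// (sublinear0 sp).
rewrite -ler_pdivrMl//; apply: (p'_ge) => s s0; rewrite ler_pdivrMl//.
apply: le_trans (p'_le (t *: x) (t * s) (mulr_ge0 (ltW t0) s0)) _.
by rewrite -scalerA -scalerDr (sublinearZ _ sp (ltW t0)) mulrBr mulrA.
Qed.

Lemma sublinear_list (vs : seq V) p : sublinear p ->
  exists p', [/\ sublinear p', (forall x, p' x <= p x) &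
    forall v, v \in vs -> p' (- v) <= - p' v].
Proof.
elim: vs p => [|v vs IH] p sp; first by exists p.
have [p1 [sp1 p1p p1v]] := sublinear_step v sp.
have [p2 [sp2 p2p1 p2v]] := IH p1 sp1.
exists p2; split => // [x|w]; first exact: le_trans (p2p1 x) (p1p x).
rewrite in_cons => /predU1P[->|]; last exact: p2v.
apply: le_trans (p2p1 _) _; apply: le_trans p1v _; rewrite lerN2.
exact: le_trans (p2p1 v) (p1p v).
Qed.

(* Among the sublinear functionals below p, pass to one that is additive along q and along
   the coordinate vectors: it is linear. *)
Lemma hahn_banach p q : sublinear p ->
  exists th : 'I_n -> R, (forall x, dot th x <= p x) /\ p q <= dot th q.
Proof.
move=> sp; have [p1 [sp1 p1p p1q]] := sublinear_step q sp.
have [p2 [sp2 p2p1 p2e]] := sublinear_list [seq delta_mx ord0 i | i <- enum 'I_n] sp1.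
have [p2D p2Z] := sp2.
pose th i := p2 (delta_mx ord0 i).
have p2th x : p2 x <= dot th x.
  rewrite {1}[x]row_sum_delta /dot.
  elim: (index_enum 'I_n) => [|i r IH]; first by rewrite !big_nil (sublinear0 sp2).
  rewrite !big_cons; apply: le_trans (p2D _ _) _; apply: lerD => //.
  rewrite mulrC; have [x0|/ltW x0] := leP 0 (x ord0 i); first exact: p2Z.
  have nx0 : 0 <= - x ord0 i by rewrite oppr_ge0.
  have := p2Z _ (- delta_mx ord0 i) nx0; rewrite scaleNr scalerN opprK => h.
  apply: le_trans h _; rewrite -[leRHS]mulrNN ler_wpM2l// p2e//.
  by apply: map_f; rewrite mem_enum.
have thp2 x : dot th x <= p2 x.
  rewrite -[dot th x]opprK -dotN lerNl; apply: le_trans (p2th (- x)).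
  by have := p2D x (- x); rewrite subrr (sublinear0 sp2) addrC -lerBlDr sub0r.
exists th; split => [x|]; first exact: le_trans (thp2 x) (le_trans (p2p1 x) (p1p x)).
have := le_trans (thp2 (- q)) (le_trans (p2p1 (- q)) p1q).
by rewrite dotN lerN2.
Qed.

End hahn_banach.

(** * Minkowski gauge and separation *)

Section gauge.
Context {R : realType} {n : nat}.
Variable M : set 'rV[R]_n.
Hypothesis M_convex : convex_set M.
Variable dl : R.
Hypothesis dl_gt0 : 0 < dl.
Hypothesis M_ball : forall x, l1norm x <= dl -> M x.

Lemma convex_comb (t : R) (x y : 'rV[R]_n) :
  0 <= t <= 1 -> M x -> M y -> M (t *: x + (1 - t) *: y).
Proof.
move=> /andP[t0 t1] Mx My.
pose l : {i01 R} := Itv01 t0 t1.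
have := @M_convex x y l; rewrite !inE => /(_ Mx My).
done.
Qed.

Let M0 : M 0.
Proof. by apply: M_ball; rewrite /l1norm big1 ?(ltW dl_gt0)// => i _; rewrite mxE normr0. Qed.

Definition gauge (x : 'rV[R]_n) : R := inf [set t : R | 0 < t /\ M (t^-1 *: x)].

Let has_inf_gauge x : has_inf [set t : R | 0 < t /\ M (t^-1 *: x)].
Proof.
split; last by exists 0 => t [t0 _]; exact: ltW.
have l0 : 0 < l1norm x + 1 by rewrite ltr_wpDl// l1norm_ge0.
exists ((l1norm x + 1) / dl); split; first by rewrite divr_gt0.
apply: M_ball; rewrite l1normZ gtr0_norm ?invr_gt0 ?divr_gt0// invf_div.
by rewrite mulrAC ler_pdivrMr// ler_wpM2l ?(ltW dl_gt0)// lerDl.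
Qed.

Lemma gauge_le x (t : R) : 0 < t -> M (t^-1 *: x) -> gauge x <= t.
Proof. by move=> t0 Mt; apply: (ge_inf (has_inf_gauge x).2). Qed.

Lemma gauge_ge x (c : R) : (forall t : R, 0 < t -> M (t^-1 *: x) -> c <= t) -> c <= gauge x.
Proof. by move=> h; apply: (lb_le_inf (has_inf_gauge x).1) => t [t0 Mt]; exact: h. Qed.

Lemma sublinear_gauge : sublinear gauge.
Proof.
split=> [x y|t x].
  rewrite -lerBlDl; apply: gauge_ge => s s0 Ms.
  rewrite lerBlDl -lerBlDr; apply: gauge_ge => t t0 Mt; rewrite lerBlDr.
  have ts0 : 0 < t + s by rewrite addr_gt0.
  apply: gauge_le => //.
  have -> : (t + s)^-1 *: (x + y) =
      (t / (t + s)) *: (t^-1 *: x) + (1 - t / (t + s)) *: (s^-1 *: y).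
    rewrite !scalerA scalerDr; congr (_ *: _ + _ *: _); first by field; rewrite !gt_eqF.
    by field; rewrite !gt_eqF.
  apply: convex_comb => //; rewrite divr_ge0 ?(ltW t0) ?(ltW ts0)//= ler_pdivrMr// mul1r.
  by rewrite lerDl ltW.
rewrite le_eqVlt => /predU1P[<-|t0].
  rewrite scale0r mul0r; apply/ler_addgt0Pr => e e0; rewrite add0r.
  by apply: gauge_le => //; rewrite scaler0.
rewrite -ler_pdivrMl//; apply: gauge_ge => s s0 Ms; rewrite ler_pdivrMl//.
apply: gauge_le; first by rewrite mulr_gt0.
by rewrite scalerA invfM mulrAC mulVf ?gt_eqF// mul1r.
Qed.

Lemma gauge_mem x : M x -> gauge x <= 1.
Proof. by move=> Mx; apply: gauge_le => //; rewrite invr1 scale1r. Qed.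

Lemma gauge_notin x : ~ M x -> 1 <= gauge x.
Proof.
move=> Mx; apply: gauge_ge => t t0 Mt; rewrite leNgt; apply/negP => t1; apply: Mx.
have -> : x = t *: (t^-1 *: x) + (1 - t) *: 0.
  by rewrite scaler0 addr0 scalerA mulfV ?scale1r// gt_eqF.
by apply: convex_comb => //; rewrite !ltW.
Qed.

(** Both inequalities are weak because M need not be closed; the strictness required later is gained
    by dilating. *)
Lemma separation q : ~ M q ->
  exists th : 'I_n -> R, (forall x, M x -> dot th x <= 1) /\ 1 <= dot th q.
Proof.
move=> Mq; have [th [h1 h2]] := hahn_banach q sublinear_gauge.
exists th; split=> [x Mx|]; first by rewrite (le_trans (h1 x))// gauge_mem.
by rewrite (le_trans _ h2)// gauge_notin.
Qed.

End gauge.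

(** * Gaussian measure of convex sets *)

Section gamma_basics.
Context {R : realType} {n : nat}.
Implicit Types A : set 'rV[R]_n.

Lemma gauss_density_ge0 (x : 'rV[R]_n) : 0 <= gauss_density x.
Proof. by rewrite mulr_ge0 ?powR_ge0 ?expR_ge0. Qed.

Let mass A := leb_int (fun x => (\1_A x * gauss_density x)%:E).

Let mass_ge0 A : (0 <= mass A)%E.
Proof. by apply: leb_int_ge0 => x; rewrite lee_fin mulr_ge0 ?gauss_density_ge0. Qed.

Let mass_le A (G : 'rV[R]_n -> R) : good G -> (forall x, 0 <= G x) ->
  (forall x, A x -> 1 <= G x) -> (mass A <= (gaussE G)%:E)%E.
Proof.
move=> gG G0 AG; rewrite -leb_int_gaussE//; apply: le_leb_int => x.
  by rewrite lee_fin mulr_ge0 ?gauss_density_ge0.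
rewrite lee_fin ler_wpM2r ?gauss_density_ge0// indicE.
by case: (boolP (x \in A)) => [|_]; [rewrite inE => /AG|exact: G0].
Qed.

Let mass_fin A : mass A \is a fin_num.
Proof.
rewrite ge0_fin_numE//; apply: (@le_lt_trans _ _ (gaussE (fun=> 1))%:E); last exact: ltry.
by apply: mass_le => //; exact: good_cst.
Qed.

(** Together with [gaussE_le_gamma], the main access to the measure of a set that has not been shown
    measurable. *)
Lemma gamma_le_gaussE A (G : 'rV[R]_n -> R) : good G -> (forall x, 0 <= G x) ->
  (forall x, A x -> 1 <= G x) -> gamma_n A <= gaussE G.
Proof.
by move=> gG G0 AG; rewrite -lee_fin /gamma_n (fineK (mass_fin A)); exact: mass_le.
Qed.

Lemma gaussE_le_gamma A (G : 'rV[R]_n -> R) : good G -> (forall x, 0 <= G x <= 1) ->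
  (forall x, ~ A x -> G x = 0) -> gaussE G <= gamma_n A.
Proof.
move=> gG G01 AG; rewrite -lee_fin /gamma_n (fineK (mass_fin A)).
rewrite -leb_int_gaussE//; last by move=> x; have /andP[] := G01 x.
apply: le_leb_int => x; have /andP[G0 G1] := G01 x.
  by rewrite lee_fin mulr_ge0 ?gauss_density_ge0.
rewrite lee_fin ler_wpM2r ?gauss_density_ge0// indicE.
by case: (boolP (x \in A)) => [//|]; rewrite notin_setE => /AG ->.
Qed.

Lemma gamma_n_ge0 A : 0 <= gamma_n A.
Proof. by apply: fine_ge0; exact: mass_ge0. Qed.

Lemma gamma_n_le1 A : gamma_n A <= 1.
Proof. by rewrite -(@gaussE_cst R n 1); apply: gamma_le_gaussE => //; exact: good_cst. Qed.

Lemma gamma_n_setT : gamma_n [set: 'rV[R]_n] = 1.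
Proof.
apply/eqP; rewrite eq_le gamma_n_le1/= -{1}(@gaussE_cst R n 1).
by apply: gaussE_le_gamma => [|x|x]; [exact: good_cst|rewrite ler01 lexx|case].
Qed.

(* The weight p (1 - p) of a single strip of slope lam equals 1/4 on the hyperplane and has
   mean O(1 / lam). *)
Lemma gamma_hyperplane A (v : 'I_n -> R) : (exists i, v i != 0) ->
  (forall x, A x -> dot v x = 0) -> gamma_n A = 0.
Proof.
move=> vN0 Av; apply/eqP; rewrite eq_le gamma_n_ge0 andbT.
have [C C0 hC] := @gaussE_var_le R n unit (fun=> v) (fun=> vN0).
apply/ler_addgt0Pr => e e0; rewrite add0r.
pose lam := 4 * (C + 1) / e.
have lam0 : 0 < lam by rewrite divr_gt0// mulr_gt0// ltr_wpDl.
pose pv x := prob (fun=> v) (fun=> 0) lam tt x * (1 - prob (fun=> v) (fun=> 0) lam tt x).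
have gv : good pv := nice_good (nice_var (fun=> v) (fun=> 0) lam tt).
apply: (@le_trans _ _ (gaussE (fun x => 4 * pv x))).
  apply: gamma_le_gaussE; first exact: goodZ.
    by move=> x; rewrite mulr_ge0// var_ge0.
  move=> x /Av h; rewrite /pv /prob /zeta h subr0 mulr0 /logistic expR0.
  by rewrite le_eqVlt; apply/orP; left; apply/eqP; field.
rewrite gaussEZ//; apply: le_trans (ler_wpM2l _ (hC (fun=> 0) lam tt lam0)) _ => //.
rewrite /lam mulrA ler_pdivrMr//.
have -> : e * (4 * (C + 1) / e) = 4 * (C + 1) by field; rewrite gt_eqF.
by rewrite ler_wpM2l// lerDl.
Qed.

End gamma_basics.

(** * Symmetric convex sets are flat or contain a ball *)

Section flat_or_full.
Context {R : realType} {n : nat}.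
Variable M : set 'rV[R]_n.
Hypothesis M_convex : convex_set M.
Hypothesis M_sym : symmetric_set M.
Hypothesis M_nonempty : M !=set0.

Lemma sym_opp x : M x -> M (- x).
Proof. by move=> Mx; rewrite M_sym; exists x. Qed.

Lemma sym_convex0 : M 0.
Proof.
have [x Mx] := M_nonempty.
have -> : 0 = 2^-1 *: x + (1 - 2^-1) *: - x :> 'rV[R]_n.
  have -> : 1 - 2^-1 = 2^-1 :> R by field.
  by rewrite scalerN subrr.
apply: (convex_comb M_convex) => //; last exact: sym_opp.
by rewrite invr_ge0 ler0n/= invf_le1// ler1n.
Qed.

Lemma abs_convex (J : Type) (r : seq J) (c : J -> R) (v : J -> 'rV[R]_n) :
  (forall j, M (v j)) -> \sum_(j <- r) `|c j| <= 1 -> M (\sum_(j <- r) c j *: v j).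
Proof.
move=> Mv c1.
(* Stronger form for the induction: the sum is its total absolute weight times a single point of
   M. *)
have [y My ->] : exists2 y, M y &
    \sum_(j <- r) c j *: v j = (\sum_(j <- r) `|c j|) *: y.
  elim: r {c1} => [|j r [y My IH]].
    by exists 0; [exact: sym_convex0|rewrite !big_nil scaler0].
  rewrite !big_cons IH; set T := \sum_(k <- r) _.
  have T0 : 0 <= T by exact: sumr_ge0.
  have [s0|s0] := eqVneq (`|c j| + T) 0.
    have [c0 t0] : `|c j| = 0 /\ T = 0 by have := normr_ge0 (c j); split; lra.
    exists 0; first exact: sym_convex0.
    by rewrite t0 scaler0 scale0r addr0 (normr0_eq0 c0) scale0r.
  have sp : 0 < `|c j| + T by rewrite lt_neqAle eq_sym s0 addr_ge0.
  have [w Mw cw] : exists2 w, M w & c j *: v j = `|c j| *: w.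
    have [h|/ltW h] := leP 0 (c j); first by exists (v j); rewrite // ger0_norm.
    by exists (- v j); [exact: sym_opp|rewrite ler0_norm// scaleNr scalerN opprK].
  exists ((`|c j| / (`|c j| + T)) *: w + (1 - `|c j| / (`|c j| + T)) *: y).
    apply: (convex_comb M_convex) => //.
    by rewrite divr_ge0 ?(ltW sp)//= ler_pdivrMr// mul1r lerDl.
  rewrite cw scalerDr !scalerA; congr (_ *: _ + _ *: _); field; exact: s0.
set T := \sum_(j <- r) _ in c1 *.
have -> : T *: y = T *: y + (1 - T) *: 0 by rewrite scaler0 addr0.
apply: (convex_comb M_convex) => //; last exact: sym_convex0.
by rewrite c1 andbT; exact: sumr_ge0.
Qed.

(** Take points of M forming a matrix of maximal rank. If the rank is n, every short vector is an
    absolutely convex combination of the rows; otherwise M lies in the row space, and a nonzero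
    column of the cokernel annihilates it. *)
Lemma flat_or_full :
  (exists2 dl : R, 0 < dl & forall x, l1norm x <= dl -> M x) \/
  (exists2 v : 'I_n -> R, (exists i, v i != 0) & forall x, M x -> dot v x = 0).
Proof.
pose P r := `[< exists m (A : 'M[R]_(m, n)), (forall i, M (row i A)) /\ \rank A = r >].
have exP : exists r, P r.
  by exists 0%N; apply/asboolP; exists 0%N, 0; split=> [[]//|]; rewrite mxrank0.
have leP r : P r -> (r <= n)%N by move=> /asboolP[m [A [_ <-]]]; exact: rank_leq_col.
case: (ex_maxnP exP leP) => r /asboolP[m [A [MA rA]]] rmax.
have [rn|rn] := eqVneq r n.
  left; have /row_fullP[B BA] : row_full A by rewrite /row_full rA rn.
  pose be := \sum_k \sum_i `|B k i|.
  have be0 : 0 <= be by apply: sumr_ge0 => k _; exact: sumr_ge0.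
  exists (be + 1)^-1; first by rewrite invr_gt0 ltr_wpDl.
  move=> x hx; rewrite -[x]mulmx1 -BA mulmxA mulmx_sum_row.
  apply: abs_convex => //.
  have B1 k : \sum_i `|B k i| <= be + 1.
    rewrite /be (bigD1 k)//= -addrA lerDl addr_ge0// sumr_ge0// => j _; exact: sumr_ge0.
  apply: (@le_trans _ _ (\sum_i \sum_k `|x ord0 k| * `|B k i|)).
    apply: ler_sum => i _; rewrite mxE; apply: le_trans (ler_norm_sum _ _ _) _.
    by apply: ler_sum => k _; rewrite normrM.
  rewrite exchange_big /=; apply: (@le_trans _ _ (\sum_k `|x ord0 k| * (be + 1))).
    by apply: ler_sum => k _; rewrite -mulr_sumr ler_wpM2l.
  by rewrite -mulr_suml -ler_pdivlMr ?mul1r// ltr_wpDl.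
right.
have rltn : (r < n)%N by rewrite ltn_neqAle rn leP//; apply/asboolP; exists m, A.
have subA x : M x -> (x <= A)%MS.
  move=> Mx; have PB : P (\rank (col_mx A x)).
    apply/asboolP; exists (m + 1)%N, (col_mx A x); split=> // i.
    by case: (split_ordP i) => k ->; rewrite ?rowKu// rowKd row_id.
  have AB : (A <= col_mx A x)%MS by rewrite -addsmxE addsmxSl.
  have := mxrank_leqif_sup AB; move=> [h1 h2].
  have : (col_mx A x <= A)%MS by rewrite -h2 eqn_leq h1/= rA rmax.
  by rewrite col_mx_sub => /andP[].
have [i [j cij]] : exists i j, cokermx A i j != 0.
  apply: contrapT => h; have : cokermx A = 0.
    apply/matrixP => i j; rewrite [RHS]mxE; apply: contrapT => hij; apply: h.
    by exists i, j; apply/eqP.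
  move=> /(congr1 mxrank); rewrite mxrank_coker mxrank0 rA => /eqP.
  by rewrite subn_eq0 leqNgt rltn.
exists (fun k => cokermx A k j); first by exists i.
move=> x /subA; rewrite submxE => /eqP /matrixP/(_ ord0 j); rewrite !mxE => h.
by rewrite -[RHS]h; apply: eq_bigr => k _; rewrite mulrC.
Qed.

End flat_or_full.

(** * Outer approximation by countably many strips *)

Section outer_approximation.
Context {R : realType} {n : nat}.
Variable M : set 'rV[R]_n.
Hypothesis M_convex : convex_set M.
Variable dl : R.
Hypothesis dl_gt0 : 0 < dl.
Hypothesis M_ball : forall x, l1norm x <= dl -> M x.
Variables (q : nat -> 'rV[R]_n) (th : nat -> 'I_n -> R).
Hypothesis q_dense : forall (x : 'rV[R]_n) (e : R), 0 < e -> exists m, l1norm (x - q m) <= e.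
Hypothesis th_le1 : forall m x, M x -> dot (th m) x <= 1.
Hypothesis th_sep : forall m, ~ M (q m) -> 1 <= dot (th m) (q m).
Hypothesis thN0 : forall m, exists i, th m i != 0.

Definition signed (v : 'I_n -> R) (s : bool) (i : 'I_n) : R := (-1) ^+ s * v i.

(** Both signs of each functional are listed, so that flipping the sign is the involution required
    by the flow. *)
Definition strips N (j : 'I_N * bool) : 'I_n -> R := signed (th j.1) j.2.

Lemma dot_signed v s x : dot (signed v s) x = (-1) ^+ s * dot v x.
Proof. by rewrite /dot mulr_sumr; apply: eq_bigr => i _; rewrite mulrA. Qed.

Lemma strips_N0 N j : exists i, @strips N j i != 0.
Proof.
have [i hi] := thN0 j.1; exists i.
by rewrite mulf_neq0// signr_eq0.
Qed.

Lemma sind_stripsP N (b : R) x :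
  reflect (forall m, (m < N)%N -> `|dot (th m) x| <= b)
    [forall j, (dot (@strips N j) x <= b)%R].
Proof.
apply: (iffP forallP) => [h m mN|h [[m mN] s]].
  have h1 := h (Ordinal mN, false); have h2 := h (Ordinal mN, true).
  rewrite dot_signed /= mul1r in h1; rewrite dot_signed /= mulN1r in h2.
  by rewrite ler_norml lerNl h2.
rewrite dot_signed /=; apply: le_trans (ler_norm _) _.
by rewrite normrM normr_sign mul1r; exact: h.
Qed.

Definition polar_ind (r : R) (x : 'rV[R]_n) : R :=
  if `[< forall m, `|dot (th m) x| <= r >] then 1 else 0.

(** The widths carry a vanishing slack because the finite families used later need strictly positive
    widths even where a support function is 0. *)
Lemma sind_polar_cvg (r : R) x : 0 < r ->
  (fun N => sind (@strips N.+1) (fun=> (1 + N.+1%:R^-1) * r) x) @ \oo --> polar_ind r x.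
Proof.
move=> r0; rewrite /polar_ind; case: asboolP => h.
  apply: cvg_near_cst; near=> N.
  rewrite /sind (_ : [forall j, _] = true)//; apply/sind_stripsP => m _.
  apply: le_trans (h m) _; rewrite ler_peMl ?(ltW r0)// lerDl invr_ge0//.
have /existsNP[m /negP] := h; rewrite -ltNge => hm.
have d0 : 0 < `|dot (th m) x| / r - 1 by rewrite subr_gt0 ltr_pdivlMr// mul1r.
apply: cvg_near_cst; near=> N.
rewrite /sind (_ : [forall j, _] = false)//; apply/negbTE/negP => /sind_stripsP/(_ m).
have mN : (m < N.+1)%N by rewrite ltnS; near: N; exact: nbhs_infty_ge.
move=> /(_ mN); rewrite leNgt -ltr_pdivlMr// -ltrBrDl => /negP; apply.
by near: N; exact: near_infty_natSinv_lt (PosNum d0).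
Unshelve. all: by end_near. Qed.

Lemma mfun_polar_ind (r : R) : 0 < r -> mfun (polar_ind r).
Proof.
move=> r0 d T X mX.
apply: (@measurable_fun_cvg _ _ _ _ (fun N w =>
  sind (@strips N.+1) (fun=> (1 + N.+1%:R^-1) * r) (X w))) => [N|w _].
  exact: (good_sind _ _).1.
exact: sind_polar_cvg.
Qed.

Lemma gaussE_polar_cvg (r : R) : 0 < r ->
  (fun N => gaussE (sind (@strips N.+1) (fun=> (1 + N.+1%:R^-1) * r))) @ \oo -->
  gaussE (polar_ind r).
Proof.
move=> r0; apply: (@gaussE_dct _ _ (fun N =>
  sind (@strips N.+1) (fun=> (1 + N.+1%:R^-1) * r)) _ (fun=> 1)).
- by move=> N; exact: (good_sind _ _).1.
- exact: mfun_polar_ind.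
- exact: good_cst.
- by move=> N x; have /andP[h1 h2] := sind_itv (@strips N.+1) (fun=> (1 + N.+1%:R^-1) * r) x;
    rewrite ger0_norm.
- by move=> x; exact: sind_polar_cvg.
Qed.

(* A point x outside M is separated from M by the functional attached to a rational point
   close to r x, which is still outside M because M contains a ball. *)
Lemma polar_ind_sub (r : R) x : 1 < r -> (forall m, `|dot (th m) x| <= (r ^+ 2)^-1) -> M x.
Proof.
move=> r1 hx; apply: contrapT => Mx.
have r0 : 0 < r by exact: lt_trans r1.
have rV : r^-1 < 1 by rewrite invf_lt1.
pose tau := dl / 2 * Num.min (r - 1) (1 - r^-1).
have t0 : 0 < tau by rewrite mulr_gt0 ?divr_gt0// lt_min !subr_gt0 r1.
have tr : tau <= dl * (r - 1).
  rewrite /tau -mulrA ler_wpM2l ?(ltW dl_gt0)//.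
  have : Num.min (r - 1) (1 - r^-1) <= r - 1 by rewrite ge_min lexx.
  have : 0 < r - 1 by rewrite subr_gt0.
  by move: (Num.min _ _) => u; lra.
have tr2 : tau < dl * (1 - r^-1).
  rewrite /tau -mulrA ltr_pM2l//.
  have : Num.min (r - 1) (1 - r^-1) <= 1 - r^-1 by rewrite ge_min lexx orbT.
  have : 0 < 1 - r^-1 by rewrite subr_gt0.
  by move: (Num.min _ _) => u; lra.
have [m hm] := q_dense (r *: x) t0.
set d := r *: x - q m in hm.
have xE : r *: x = q m + d by rewrite /d addrC subrK.
have qM : ~ M (q m).
  move=> Mq; apply: Mx.
  have rp : 0 < r - 1 by rewrite subr_gt0.
  have -> : x = r^-1 *: q m + (1 - r^-1) *: ((r - 1)^-1 *: d).
    rewrite scalerA (_ : (1 - r^-1) / (r - 1) = r^-1); last by field; rewrite !gt_eqF.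
    by rewrite -scalerDr -xE scalerA mulVf ?gt_eqF// scale1r.
  apply: (convex_comb M_convex) => //; first by rewrite invr_ge0 (ltW r0) ltW.
  apply: M_ball; rewrite l1normZ gtr0_norm ?invr_gt0// mulrC ler_pdivrMr//.
  exact: le_trans hm tr.
have h1 := th_sep qM.
have Md : M (- (dl / tau) *: d).
  apply: M_ball; rewrite l1normZ normrN gtr0_norm ?divr_gt0//.
  rewrite mulrAC ler_pdivrMr// ler_wpM2l ?(ltW dl_gt0)//.
have dotZ (t : R) y : dot (th m) (t *: y) = t * dot (th m) y.
  by rewrite /dot mulr_sumr; apply: eq_bigr => i _; rewrite mxE; ring.
have dotD y z : dot (th m) (y + z) = dot (th m) y + dot (th m) z.
  by rewrite /dot -big_split; apply: eq_bigr => i _; rewrite mxE mulrDr.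
have h2 := th_le1 m Md; rewrite dotZ in h2.
have h3 : - dot (th m) d <= tau / dl.
  rewrite ler_pdivlMr//; move: h2.
  rewrite (_ : - (dl / tau) * dot (th m) d = (- dot (th m) d * dl) / tau); last by ring.
  by rewrite ler_pdivrMr// mul1r.
have h4 : dot (th m) (q m) + dot (th m) d <= r^-1.
  rewrite -dotD -xE dotZ; apply: (@le_trans _ _ (r * (r ^+ 2)^-1)).
    by rewrite ler_wpM2l ?(ltW r0)// (le_trans (ler_norm _)).
  by rewrite le_eqVlt; apply/orP; left; apply/eqP; field; rewrite gt_eqF.
have h5 : tau / dl < 1 - r^-1 by rewrite ltr_pdivrMr// mulrC.
lra.
Qed.

(** The intersection of all strips may exceed M by boundary points, but its copy shrunk by r^2 lies
    in M. By the dilation bound this costs the factor r^(2 n), and r tends to 1; the argument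
    replaces the fact that the boundary is null. *)
Lemma gaussE_polar_le : gaussE (polar_ind 1) <= gamma_n M.
Proof.
have key (r : R) : 1 < r -> gaussE (polar_ind 1) <= (r ^+ 2) ^+ n * gamma_n M.
  move=> r1; have r0 : 0 < r by exact: lt_trans r1.
  have r20 : 0 < (r ^+ 2)^-1 by rewrite invr_gt0 exprn_gt0.
  have r21 : 1 <= r ^+ 2 by rewrite exprn_ege1// ltW.
  apply: (@le_trans _ _ ((r ^+ 2) ^+ n * gaussE (polar_ind (r ^+ 2)^-1))); last first.
    rewrite ler_wpM2l ?exprn_ge0 ?(ltW r0)//.
    have gP : good (polar_ind (r ^+ 2)^-1).
      apply: (@good_bounded _ _ 1); first exact: mfun_polar_ind.
      by move=> x; rewrite /polar_ind; case: ifP => _; rewrite ?normr1 ?normr0.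
    apply: gaussE_le_gamma => // x.
      by rewrite /polar_ind; case: ifP => _; rewrite ?lexx ?ler01.
    move=> Mx; rewrite /polar_ind; case: asboolP => // h.
    by exfalso; apply: Mx; exact: polar_ind_sub h.
  have c1 := gaussE_polar_cvg ltr01.
  have c2 := gaussE_polar_cvg r20.
  have c3 : (fun N => (r ^+ 2) ^+ n *
      gaussE (sind (@strips N.+1) (fun=> (1 + N.+1%:R^-1) * (r ^+ 2)^-1))) @ \oo -->
      (r ^+ 2) ^+ n * gaussE (polar_ind (r ^+ 2)^-1).
    by apply: cvgM => //; exact: cvg_cst.
  apply: (ler_cvg_to c1 c3); near=> N.
  have := sind_dilation (@strips_N0 N.+1) (fun=> (1 + N.+1%:R^-1) * (r ^+ 2)^-1) r21.
  rewrite (_ : (fun j => r ^+ 2 * ((1 + N.+1%:R^-1) * (r ^+ 2)^-1)) =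
    fun=> (1 + N.+1%:R^-1) * 1)//.
  by apply/funext => j; rewrite mulr1 mulrCA mulfV ?mulr1// gt_eqF// exprn_gt0.
have c1 : (fun m : nat => ((1 + m.+1%:R^-1) ^+ 2) ^+ n * gamma_n M) @ \oo -->
    ((1 + 0) ^+ 2) ^+ n * gamma_n M.
  apply: cvgM; last exact: cvg_cst.
  have c : (fun m : nat => 1 + m.+1%:R^-1 : R) @ \oo --> (1 + 0 : R).
    by apply: cvgD; [exact: cvg_cst|exact: cvg_harmonic].
  apply: (@cvg_comp _ _ _ (fun m : nat => 1 + m.+1%:R^-1 : R)
    (fun y => (y ^+ 2) ^+ n) _ (nbhs (1 + 0 : R))) => //.
  apply: (@cvg_comp _ _ _ (fun y : R => y ^+ 2) (fun y => y ^+ n) _ (nbhs ((1 + 0 : R) ^+ 2))).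
    exact: exprn_continuous.
  exact: exprn_continuous.
rewrite addr0 !expr1n mul1r in c1.
apply: (ler_cvg_to (cvg_cst (gaussE (polar_ind 1))) c1); near=> m.
by apply: key; rewrite ltrDl invr_gt0.
Unshelve. all: by end_near. Qed.

End outer_approximation.

(** * The concavity inequality *)

Section main_inequality.
Context {R : realType} {n : nat}.
Variable sigma : R -> R.
Hypothesis n_gt0 : (0 < n)%N.
Hypothesis sigma_mono : forall x y, 0 <= x -> x < y -> y <= 1 -> sigma x < sigma y.
Hypothesis sigma_d : forall x, 0 < x < 1 ->
  [/\ derivable sigma x 1, derivable (derive1 sigma) x 1 & 0 < (derive1 sigma) x].
Hypothesis sigma_ode : forall r : R, 0 < r ->
  1 + (derive1 (derive1 sigma)) (Psi n r) * Psi n r / (derive1 sigma) (Psi n r)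
  = 2 / n%:R - c_const n / (n%:R ^+ 2 * Psi n r) * r ^+ n * expR (- (r ^+ 2 / 2)).

Local Notation s1 := (derive1 sigma).
Local Notation s2 := (derive1 (derive1 sigma)).

(** Read off from the differential equation instead of inverting [Psi]: the equation in terms of v
    holds by construction, and at v = [Psi n r] the value is c_n r^n exp(- r^2 / 2). *)
Let B (v : R) : R := n%:R ^+ 2 * v * (2 / n%:R - 1 - s2 v * v / s1 v).

Let N0 : 0 < n%:R :> R. Proof. by rewrite ltr0n. Qed.

Let BE (r : R) : 0 < r -> 0 < Psi n r < 1 ->
  B (Psi n r) = c_const n * r ^+ n * expR (- (r ^+ 2 / 2)).
Proof.
move=> r0 /andP[v0 v1]; have h := sigma_ode r0; rewrite /B.
have -> : 2 / n%:R - 1 - s2 (Psi n r) * Psi n r / s1 (Psi n r) =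
    c_const n / (n%:R ^+ 2 * Psi n r) * r ^+ n * expR (- (r ^+ 2 / 2)) by lra.
by field; rewrite !gt_eqF.
Qed.

Let B_bound : exists Bb : R, forall v, 0 < v < 1 -> `|B v| <= Bb.
Proof.
(* From r^n <= n! exp r and r - r^2 / 2 <= 1. *)
exists (`|c_const n| * (n`!%:R * expR 1)) => v v01.
have [r r0 [hv _]] := bathtub n_gt0 v01.
rewrite -hv in v01 *; rewrite BE// -mulrA normrM ler_wpM2l//.
rewrite ger0_norm ?mulr_ge0 ?exprn_ge0 ?expR_ge0 ?(ltW r0)//.
have h1 : r ^+ n <= n`!%:R * expR r.
  have := @expR_ge1Dxn R r n.-1 (ltW r0); rewrite prednK// => h.
  rewrite mulrC -ler_pdivrMr ?ltr0n ?fact_gt0//; apply: le_trans h.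
  by rewrite lerDr.
apply: (@le_trans _ _ (n`!%:R * expR r * expR (- (r ^+ 2 / 2)))).
  by rewrite ler_wpM2r ?expR_ge0.
rewrite -mulrA ler_wpM2l// -expRD ler_expR.
have : 0 <= (r - 1) ^+ 2 by exact: sqr_ge0.
by rewrite sqrrB1; move: (r ^+ 2) => r2; rewrite -mulr_natr; lra.
Qed.

Let B_bathtub (g : 'rV[R]_n -> R) : good g -> (forall x, 0 <= g x <= 1) ->
  0 < gaussE g < 1 -> n%:R * gaussE g - gaussE (fun x => g x * rad2 x) <= B (gaussE g).
Proof.
move=> gg g01 v01; have [r r0 [hv h]] := bathtub n_gt0 v01.
by have := h g gg g01 erefl; rewrite -hv BE// hv.
Qed.

Let sigma_le x y : 0 <= x -> x <= y -> y <= 1 -> sigma x <= sigma y.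
Proof.
by move=> x0; rewrite le_eqVlt => /predU1P[->//|xy] y1; exact/ltW/sigma_mono.
Qed.

Lemma strip_concave (I : finType) (th : I -> 'I_n -> R) (h d : I -> R) (inv : I -> I) (t : R) :
  involutive inv -> (forall j i, th (inv j) i = - th j i) ->
  (forall j, h (inv j) = h j) -> (forall j, d (inv j) = d j) ->
  (forall j, exists i, th j i != 0) -> (exists j : I, true) ->
  (forall j, 0 < h j) -> (forall j, 0 < h j + d j) -> 0 <= t <= 1 ->
  (1 - t) * sigma (gaussE (sind th h)) + t * sigma (gaussE (sind th (fun j => h j + d j))) <=
  sigma (gaussE (sind th (fun j => h j + t * d j))).
Proof.
move=> invK th_inv h_inv d_inv thN0 [j0 _] h0 hd0 tI.
pose a (s : R) := gaussE (sind th (fun j => h j + s * d j)).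
have pos s : 0 <= s <= 1 -> forall j, 0 < h j + s * d j.
  move=> /andP[s0 s1] j.
  have -> : h j + s * d j = (1 - s) * h j + s * (h j + d j) by ring.
  have [->|sN] := eqVneq s 0; first by rewrite subr0 mul1r mul0r addr0.
  apply: ltr_wpDl; first by rewrite mulr_ge0 ?subr_ge0// ltW.
  by rewrite mulr_gt0// lt_neqAle eq_sym sN.
(* Positive widths give positivity; a < 1 because the set lies in a half-space, which is what the
   index [j0] is for. *)
have a01 s : 0 <= s <= 1 -> 0 < a s < 1.
  move=> sI; rewrite (sind_gt0 thN0 (pos s sI))/=.
  apply: le_lt_trans (half_space_lt1 (thN0 j0) (h j0 + s * d j0)).
  apply: gaussE_le; first exact: good_sind.
    exact: good_sublevel (good_dot (th j0)).1.
  move=> x; rewrite /sind; case: forallP => [hx|_]; first by rewrite hx.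
  exact: ler0n.
have [Bb hB] := B_bound.
have ode v : 0 < v < 1 ->
    1 + s2 v * v / s1 v = 2 / n%:R - B v / (n%:R ^+ 2 * v).
  move=> /andP[v0 v1]; rewrite /B; have s10 : 0 < s1 v by case: (sigma_d (introT andP (conj v0 v1))).
  by field; rewrite !gt_eqF.
have approx (c e : R) : 0 < e -> exists Z Z1 Z2 : R -> R, forall s : R, 0 <= s <= 1 ->
    [/\ is_derive s 1 Z (Z1 s), is_derive s 1 Z1 (Z2 s), `|Z s - a s| <= e &
    0 < Z s < 1 -> Z2 s <= Z1 s ^+ 2 / Z s - 2 * c * Z1 s + c ^+ 2 * B (Z s) + c ^+ 2 * e].
  move=> e0; have [w [Z1 [Z2 hw]]] := strip_approx invK th_inv h_inv d_inv thN0 c e0.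
  exists (fun s => gaussE (w s)), Z1, Z2 => s sI.
  have [[gw w01 d1 d2 wa] hZ] := hw s sI.
  split=> // Z01; apply: le_trans hZ _; rewrite lerD2r lerD2l ler_wpM2l ?sqr_ge0//.
  by apply: B_bathtub => // x; have /andP[/ltW ? ?] := w01 x; apply/andP.
have := sigma_concave n_gt0 sigma_d hB ode a01 approx tI.
rewrite /a (_ : (fun j => h j + 0 * d j) = h); last first.
  by apply/funext => j; rewrite mul0r addr0.
by rewrite (_ : (fun j => h j + 1 * d j) = fun j => h j + d j)//; apply/funext => j; rewrite mul1r.
Qed.

Section bodies.
Variables (K L : set 'rV[R]_n) (l : R).
Hypotheses (K_convex : convex_set K) (K_sym : symmetric_set K) (K_neq0 : K !=set0).
Hypotheses (L_convex : convex_set L) (L_sym : symmetric_set L) (L_neq0 : L !=set0).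
Hypothesis l01 : 0 < l < 1.

Let M := mink_comb l K L.
Let l0 : 0 < l. Proof. by case/andP: l01. Qed.
Let l1 : l < 1. Proof. by case/andP: l01. Qed.
Let K0 : K 0. Proof. exact: sym_convex0. Qed.
Let L0 : L 0. Proof. exact: sym_convex0. Qed.

Let dotZ v (t : R) (x : 'rV[R]_n) : dot v (t *: x) = t * dot v x.
Proof. by rewrite /dot mulr_sumr; apply: eq_bigr => i _; rewrite mxE; ring. Qed.
Let dotD v (x y : 'rV[R]_n) : dot v (x + y) = dot v x + dot v y.
Proof. by rewrite /dot -big_split; apply: eq_bigr => i _; rewrite mxE mulrDr. Qed.

Let M_comb x y : K x -> L y -> M (l *: x + (1 - l) *: y).
Proof. by move=> Kx Ly; exists x => //; exists y. Qed.

Let M_convex : convex_set M.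
Proof.
move=> u1 u2 t; rewrite !inE => -[x1 Kx1 [y1 Ly1 <-]] [x2 Kx2 [y2 Ly2 <-]].
pose k : R := t%:num.
have k01 : 0 <= k <= 1 by rewrite /k; apply/andP.
have Kx := convex_comb K_convex k01 Kx1 Kx2.
have Ly := convex_comb L_convex k01 Ly1 Ly2.
have := M_comb Kx Ly; congr (M _).
rewrite -[RHS]/(k *: (l *: x1 + (1 - l) *: y1) + (1 - k) *: (l *: x2 + (1 - l) *: y2)).
rewrite !scalerDr !scalerA addrACA.
by rewrite (mulrC l k) (mulrC (1 - l) k) (mulrC l (1 - k)) (mulrC (1 - l) (1 - k)).
Qed.

Let M_sym : symmetric_set M.
Proof.
have opp x : M x -> M (- x).
  move=> [y Ky [z Lz <-]]; exists (- y); first exact: sym_opp.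
  by exists (- z); [exact: sym_opp|rewrite !scalerN opprD].
apply/seteqP; split=> [x Mx|_ [x Mx <-]]; last exact: opp.
by exists (- x); [exact: opp|rewrite opprK].
Qed.

Let M_neq0 : M !=set0.
Proof. by exists (l *: 0 + (1 - l) *: 0); exact: M_comb. Qed.

(** K and L both contain 0, so each inherits the equation of the hyperplane, and all three measures
    vanish. *)
Let flat_case (v : 'I_n -> R) : (exists i, v i != 0) -> (forall x, M x -> dot v x = 0) ->
  l * sigma (gamma_n K) + (1 - l) * sigma (gamma_n L) <= sigma (gamma_n M).
Proof.
move=> vN0 Mv.
have Kv x : K x -> dot v x = 0.
  move=> Kx; have := Mv _ (M_comb Kx L0); rewrite scaler0 addr0 dotZ => /eqP.
  by rewrite mulf_eq0 gt_eqF//= => /eqP.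
have Lv x : L x -> dot v x = 0.
  move=> Lx; have := Mv _ (M_comb K0 Lx); rewrite scaler0 add0r dotZ => /eqP.
  by rewrite mulf_eq0 subr_eq0 gt_eqF//= => /eqP.
rewrite (gamma_hyperplane vN0 Mv) (gamma_hyperplane vN0 Kv) (gamma_hyperplane vN0 Lv).
by rewrite -mulrDl addrC subrK mul1r.
Qed.

Let rational_seq : exists q : nat -> 'rV[R]_n,
  forall (x : 'rV[R]_n) (e : R), 0 < e -> exists m, l1norm (x - q m) <= e.
Proof.
pose q m : 'rV[R]_n := if @unpickle 'rV[rat]_n m is Some v then map_mx ratr v else 0.
exists q => x e e0; have e1 : 0 < e / n%:R by rewrite divr_gt0.
have hr i : exists r : rat, `|x ord0 i - ratr r| <= e / n%:R.
  have [|r] := @rat_in_itvoo R (x ord0 i) (x ord0 i + e / n%:R); first by rewrite ltrDl.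
  rewrite in_itv/= => /andP[h1 h2]; exists r.
  rewrite ler_norml; apply/andP; split; lra.
have [r hr'] := choice hr.
exists (pickle (\row_i r i)); rewrite /q pickleK.
apply: (@le_trans _ _ (\sum_(i < n) e / n%:R)).
  by apply: ler_sum => i _; rewrite !mxE; exact: hr'.
by rewrite sumr_const card_ord -[leLHS]mulr_natr divfK// gt_eqF.
Qed.

(** The flow runs from strips around L to strips around K, with the support functions in the normals
    of M as widths. At time l the widths are at most 1 plus the slack, so the strips lie in an outer
    approximation of M; monotonicity of sigma handles the enlargement of K and L. *)
Let full_case (dl : R) : 0 < dl -> (forall x, l1norm x <= dl -> M x) -> gamma_n M < 1 ->
  l * sigma (gamma_n K) + (1 - l) * sigma (gamma_n L) <= sigma (gamma_n M).
Proof.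
move=> dl0 hM M1.
have [q hq] := rational_seq.
(* Where [q m] lies in M there is nothing to separate; the point q0 supplies a nonzero functional
   for those m. *)
have [q0 Mq0] : exists q0, ~ M q0.
  apply: contrapT => h; move: M1; rewrite (_ : M = setT) ?gamma_n_setT ?ltxx//.
  by apply/seteqP; split=> // x _; apply: contrapT => Mx; apply: h; exists x.
have nz (v : 'I_n -> R) y : 1 <= dot v y -> exists i, v i != 0.
  move=> h; apply: contrapT => vz; move: h; rewrite /dot big1 ?ler10// => i _.
  have [->|vi] := eqVneq (v i) 0; first by rewrite mul0r.
  by exfalso; apply: vz; exists i.
have hth m : exists v : 'I_n -> R, [/\ forall x, M x -> dot v x <= 1,
    exists i, v i != 0 & ~ M (q m) -> 1 <= dot v (q m)].
  have [Mq|Mq] := pselect (M (q m)).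
    by have [v [v1 v2]] := separation M_convex dl0 hM Mq0; exists v; split => //; exact: nz v2.
  by have [v [v1 v2]] := separation M_convex dl0 hM Mq; exists v; split => //; exact: nz v2.
have [th hth'] := choice hth.
have th1 m x : M x -> dot (th m) x <= 1 by case: (hth' m) => h _ _; exact: h.
have th2 m : exists i, th m i != 0 by case: (hth' m).
have th3 m : ~ M (q m) -> 1 <= dot (th m) (q m) by case: (hth' m).
have l1' : 0 < 1 - l by rewrite subr_gt0.
pose hK m := sup [set dot (th m) x | x in K].
pose hL m := sup [set dot (th m) x | x in L].
have dotM m x y : K x -> L y -> l * dot (th m) x + (1 - l) * dot (th m) y <= 1.
  by move=> Kx Ly; rewrite -!dotZ -dotD; apply: th1; exact: M_comb.
have dot0 v : dot v (0 : 'rV[R]_n) = 0.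
  by rewrite /dot big1// => i _; rewrite mxE mulr0.
have supK m : has_sup [set dot (th m) x | x in K].
  split; first by exists (dot (th m) 0); exists 0.
  exists l^-1 => _ [x Kx <-]; have := dotM m x 0 Kx L0.
  by rewrite dot0 mulr0 addr0 mulrC -ler_pdivlMr// mul1r.
have supL m : has_sup [set dot (th m) x | x in L].
  split; first by exists (dot (th m) 0); exists 0.
  exists (1 - l)^-1 => _ [y Ly <-]; have := dotM m 0 y K0 Ly.
  by rewrite dot0 mulr0 add0r mulrC -ler_pdivlMr// mul1r.
have K_le m x : K x -> dot (th m) x <= hK m.
  by move=> Kx; apply: (ub_le_sup (supK m).2); exists x.
have L_le m x : L x -> dot (th m) x <= hL m.
  by move=> Lx; apply: (ub_le_sup (supL m).2); exists x.
have hK0 m : 0 <= hK m by have := K_le m 0 K0; rewrite dot0.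
have hL0 m : 0 <= hL m by have := L_le m 0 L0; rewrite dot0.
have hKL m : l * hK m + (1 - l) * hL m <= 1.
  rewrite -lerBrDl mulrC -ler_pdivlMr//; apply: (ge_sup (supL m).1) => _ [y Ly <-].
  rewrite ler_pdivlMr// lerBrDl -lerBrDr -ler_pdivlMl//.
  apply: (ge_sup (supK m).1) => _ [x Kx <-].
  by rewrite ler_pdivlMl// lerBrDr [dot _ y * _]mulrC; exact: dotM.
have cP := @gaussE_polar_cvg R n th 1 ltr01.
have leP := gaussE_polar_le M_convex dl0 hM hq th1 th3 th2.
(* The outer approximations are only known to fall below each v above [gamma_n M]; continuity of
   sigma at an interior point closes the gap at the end. *)
have key v : gamma_n M < v -> v < 1 ->
    l * sigma (gamma_n K) + (1 - l) * sigma (gamma_n L) <= sigma v.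
  move=> Mv v1; have := cvgr_lt _ cP v (le_lt_trans leP Mv).
  move=> [N _ /(_ N (leqnn N)) /= hN].
  pose I := ('I_N.+1 * bool)%type.
  pose thN : I -> 'I_n -> R := @strips R n th N.+1.
  (* The slack of this outer approximation of M; it also makes the widths positive where a support
     function is 0. *)
  pose e : R := N.+1%:R^-1.
  have e0 : 0 < e by rewrite invr_gt0.
  pose h (j : I) := hL j.1 + e.
  pose d (j : I) := hK j.1 - hL j.1.
  pose inv (j : I) : I := (j.1, ~~ j.2).
  have invK : involutive inv by move=> [j s]; rewrite /inv /= negbK.
  have th_inv j i : thN (inv j) i = - thN j i.
    by rewrite /thN /strips /signed /=; case: j => j [] /=; rewrite ?mul1r ?mulN1r ?opprK.
  have thN0 j : exists i, thN j i != 0 by exact: strips_N0.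
  have hd0 j : 0 < h j + d j by rewrite /h /d (_ : _ + _ = hK j.1 + e) ?ltr_wpDl//; ring.
  have h0 j : 0 < h j by rewrite ltr_wpDl.
  have ex : exists j : I, true by exists (ord0, true).
  have lI : 0 <= l <= 1 by rewrite !ltW.
  have := @strip_concave I thN h d inv l invK th_inv (fun=> erefl) (fun=> erefl) thN0 ex h0 hd0 lI.
  set gl := gaussE (sind thN (fun j => h j + l * d j)) => hs.
  have sind_ge0 b (x : 'rV[R]_n) : 0 <= sind thN b x by have /andP[] := sind_itv thN b x.
  have signN (A : set 'rV[R]_n) (hA : nat -> R) : symmetric_set A ->
      (forall m x, A x -> dot (th m) x <= hA m) ->
      forall x, A x -> forall j : I, dot (thN j) x <= hA j.1 + e.
    move=> sA hA_le x Ax [j s]; rewrite /thN /strips dot_signed /=.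
    apply: (@le_trans _ _ (hA j)); last by rewrite lerDl ltW.
    case: s => /=; last by rewrite mul1r; exact: hA_le.
    by rewrite mulN1r -dotN; apply: hA_le; exact: sym_opp.
  have gK : gamma_n K <= gaussE (sind thN (fun j => h j + d j)).
    apply: gamma_le_gaussE; [exact: good_sind|exact: sind_ge0|move=> x Kx].
    rewrite /sind (_ : [forall j, _] = true)//; apply/forallP => j.
    rewrite (_ : h j + d j = hK j.1 + e); last by rewrite /h /d; ring.
    exact: (signN K hK).
  have gL : gamma_n L <= gaussE (sind thN h).
    apply: gamma_le_gaussE; [exact: good_sind|exact: sind_ge0|move=> x Lx].
    rewrite /sind (_ : [forall j, _] = true)//; apply/forallP => j.
    exact: (signN L hL).
  have sind_le1 b : gaussE (sind thN b) <= 1.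
    rewrite -(@gaussE_cst R n 1); apply: gaussE_le; [exact: good_sind|exact: good_cst|].
    by move=> x; have /andP[] := sind_itv thN b x.
  have glv : gl <= v.
    apply: le_trans (ltW hN); apply: gaussE_le; [exact: good_sind|exact: good_sind|move=> x].
    rewrite /sind ler_nat; case: forallP => // hx.
    rewrite (_ : [forall j, _] = true)//; apply/forallP => j.
    apply: le_trans (hx j) _; rewrite mulr1.
    have -> : h j + l * d j = l * hK j.1 + (1 - l) * hL j.1 + e by rewrite /h /d; ring.
    by rewrite lerD2r.
  have sK : sigma (gamma_n K) <= sigma (gaussE (sind thN (fun j => h j + d j))).
    by apply: sigma_le => //; exact: gamma_n_ge0.
  have sL : sigma (gamma_n L) <= sigma (gaussE (sind thN h)).
    by apply: sigma_le => //; exact: gamma_n_ge0.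
  have sv : sigma gl <= sigma v.
    by apply: sigma_le => //; [apply: gaussE_ge0 => x; exact: sind_ge0|exact: ltW].
  apply: le_trans sv; apply: le_trans hs; rewrite addrC.
  by rewrite lerD// ler_wpM2l// ltW.
(* M contains a cube, which is an intersection of coordinate strips. *)
have M0 : 0 < gamma_n M.
  pose thc (j : 'I_n * bool) : 'I_n -> R := signed (fun k => (j.1 == k)%:R) j.2.
  have dotc j (x : 'rV[R]_n) : dot (thc j) x = (-1) ^+ j.2 * x ord0 j.1.
    rewrite dot_signed /dot (bigD1 j.1)//= eqxx mul1r big1 ?addr0// => k /negbTE.
    by rewrite eq_sym => ->; rewrite mul0r.
  have thc0 j : exists i, thc j i != 0.
    by exists j.1; rewrite /thc /signed eqxx mulr1 signr_eq0.
  have b0 (j : 'I_n * bool) : 0 < dl / n%:R by rewrite divr_gt0.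
  apply: lt_le_trans (sind_gt0 thc0 b0) _.
  apply: gaussE_le_gamma; [exact: good_sind|exact: sind_itv|move=> x Mx].
  rewrite /sind; case: forallP => // hx; exfalso; apply: Mx; apply: hM.
  apply: (@le_trans _ _ (\sum_(i < n) dl / n%:R)); last first.
    by rewrite sumr_const card_ord -[leLHS]mulr_natr divfK// gt_eqF.
  apply: ler_sum => i _; have := hx (i, false); have := hx (i, true).
  by rewrite !dotc /= mul1r mulN1r ler_norml lerNl => -> ->.
rewrite leNgt; apply/negP => hlt.
have M01 : 0 < gamma_n M < 1 by rewrite M0.
have cs : {for gamma_n M, continuous sigma}.
  by apply: differentiable_continuous; apply/derivable1_diffP; case: (sigma_d M01).
have nr : \forall x \near (gamma_n M)^'+, sigma x < l * sigma (gamma_n K) + (1 - l) * sigma (gamma_n L).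
  by apply: cvg_within; exact: (cvgr_lt _ cs).
have [v [v0 v1 hv]] : exists v, [/\ gamma_n M < v, v < 1 &
    sigma v < l * sigma (gamma_n K) + (1 - l) * sigma (gamma_n L)].
  near (gamma_n M)^'+ => v; exists v; split; first by near: v; exact: nbhs_right_gt.
    by near: v; exact: nbhs_right_lt.
  by near: v.
by have := lt_le_trans hv (key v v0 v1); rewrite ltxx.
Unshelve. all: by end_near. Qed.

Lemma gamma_mink_comb :
  l * sigma (gamma_n K) + (1 - l) * sigma (gamma_n L) <= sigma (gamma_n M).
Proof.
(* Continuity of [sigma] is available only inside ]0, 1[; at measure 1 monotonicity alone gives the
   claim. *)
have [M1|M1] := ltP (gamma_n M) 1; last first.
  have -> : gamma_n M = 1 by apply/eqP; rewrite eq_le gamma_n_le1.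
  have h1 : sigma (gamma_n K) <= sigma 1.
    by apply: sigma_le; rewrite ?gamma_n_ge0 ?gamma_n_le1.
  have h2 : sigma (gamma_n L) <= sigma 1.
    by apply: sigma_le; rewrite ?gamma_n_ge0 ?gamma_n_le1.
  have -> : sigma 1 = l * sigma 1 + (1 - l) * sigma 1 by ring.
  by rewrite lerD// ler_wpM2l ?(ltW l0)// subr_ge0 ltW.
case: (flat_or_full M_convex M_sym M_neq0) => [[dl dl0 hM]|[v vN0 Mv]].
  exact: full_case hM M1.
exact: flat_case Mv.
Qed.

End bodies.
End main_inequality.

Theorem theorem1p5 (R : realType) (n : nat) (sigma : R -> R) :
  (0 < n)%N ->
  (forall x y, 0 <= x -> x < y -> y <= 1 -> sigma x < sigma y) ->
  (forall x, 0 < x < 1 ->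
     [/\ derivable sigma x 1, derivable (derive1 sigma) x 1 & 0 < (derive1 sigma) x]) ->
  (forall r : R, 0 < r ->
     1 + (derive1 (derive1 sigma)) (Psi n r) * Psi n r / (derive1 sigma) (Psi n r)
     = 2 / n%:R - c_const n / (n%:R ^+ 2 * Psi n r) * r ^+ n * expR (- (r ^+ 2 / 2))) ->
  forall (K L : set 'rV[R]_n),
    convex_set K -> symmetric_set K -> K !=set0 ->
    convex_set L -> symmetric_set L -> L !=set0 ->
  forall l : R, 0 < l < 1 ->
    sigma (gamma_n (mink_comb l K L))
    >= l * sigma (gamma_n K) + (1 - l) * sigma (gamma_n L).
Proof.
move=> n_gt0 sm sd so K L cK sK K0 cL sL L0 l l01.
exact: (gamma_mink_comb n_gt0 sm sd so cK sK K0 cL sL L0 l01).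
Qed.
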